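(* Let $\mathcal{A}=(\mathcal{A}_1,\dots,\mathcal{A}_n)$ be a family of finite sets in $(\mathbb{Z}_{\ge 0})^n$ such that (H1) $0\notin\mathcal{A}_j$ for every $1\le j\le n$; (H3) for every $1\le i,j\le n$ there exists $\mu_{ij}\in\mathbb{N}$ such that $\mu_{ij}e_i\in\mathcal{A}_j$. Let $\mathbf{f}=(f_1,\dots,f_n)$ be a generic system of sparse polynomials in $\mathbb{C}[x_1,\dots,x_n]$ supported on $\mathcal{A}$. For every $1\le j\le n$, let $\overline{\rho}_j$ be the restriction to $\pi(\Delta_j)$ of the convex function $\rho_j$ parameterizing the lower envelope of $Q_j=\mathrm{conv}(\mathcal{A}_j)$. Then the origin is an isolated common zero of $\mathbf{f}$ and $$\mathrm{mult}_0(\mathbf{f})=MI'_n(\overline{\rho}_1,\dots,\overline{\rho}_n).$$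
   Context: $\mathbb{N}$ denotes the positive integers, and $e_i$ is the $i$th canonical basis vector. A system supported on $\mathcal{A}$ is $\mathbf{f}=(f_1,\dots,f_n)$ with $f_j=\sum_{a\in\mathcal{A}_j}c_{j,a}x^a$ and all $c_{j,a}\in\mathbb{C}\setminus\{0\}$. A statement holds for a generic system supported on $\mathcal{A}$ if it holds for all coefficient vectors in some non-empty Zariski open subset of $\mathbb{C}^{\#\mathcal{A}_1}\times\dots\times\mathbb{C}^{\#\mathcal{A}_n}$. For an isolated zero $\zeta$ of $\mathbf{f}$, $\mathrm{mult}_\zeta(\mathbf{f})=\dim_{\mathbb{C}}\mathbb{C}[x]_{\mathfrak{m}_\zeta}/(f_1,\dots,f_n)\mathbb{C}[x]_{\mathfrak{m}_\zeta}$, with $\mathfrak{m}_\zeta=(x_1-\zeta_1,\dots,x_n-\zeta_n)$. Let $\pi:\mathbb{R}^n\to\mathbb{R}^{n-1}$ be the projection to the first $n-1$ coordinates. The convex function $\rho_j:\pi(Q_j)\to\mathbb{R}$ is $\rho_j(x)=\min\{t\in\mathbb{R}:(x,t)\in Q_j\}$. Let $\lambda_{ij}=\min\{\mu\in\mathbb{N}\mid\mu e_i\in Q_j\}$ for $1\le i\le n$ and $\Delta_j=\mathrm{conv}\{0,\lambda_{1j}e_1,\dots,\lambda_{nj}e_n\}$; one has $\pi(\Delta_j)\subset\pi(Q_j)$, and $\overline{\rho}_j=\rho_j|_{\pi(\Delta_j)}$. Mixed integral: for convex functions $\rho_j:P_j\to\mathbb{R}$ on polytopes $P_j\subset\mathbb{R}^{n-1}$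 ($1\le j\le n$) and non-empty $J\subset\{1,\dots,n\}$, let $(\boxplus'_{j\in J}\rho_j)(x)=\min\{\sum_{j\in J}\rho_j(y_j):y_j\in P_j,\ \sum_{j\in J}y_j=x\}$ for $x\in\sum_{j\in J}P_j$ (Minkowski sum). Then $MI'_n(\rho_1,\dots,\rho_n)=\sum_{k=1}^n(-1)^{n-k}\sum_{J\subset\{1,\dots,n\},\ \#J=k}\int_{\sum_{j\in J}P_j}(\boxplus'_{j\in J}\rho_j)(x)\,dx$. *)

(* Defs.v *)
From HB Require Import structures.
From mathcomp Require Import all_boot all_order all_algebra finmap.
From mathcomp Require Import fraction complex.
(* the notations of mpoly clash with those of MathComp-Analysis *)
From mathcomp Require Import -(notations) mpoly.
From mathcomp Require Import all_classical all_reals all_analysis.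

Set Implicit Arguments.
Unset Strict Implicit.
Unset Printing Implicit Defensive.

Import Order.TTheory GRing.Theory Num.Theory.

Local Open Scope classical_set_scope.
Local Open Scope ring_scope.

Section Systems.
Variables (C : numClosedFieldType) (n : nat).

Local Notation polys := (mpoly n C).

(* The coefficient space C^{#A_1} x ... x C^{#A_n}: one coordinate c_{j,a} for
   each pair of an index j and an exponent a in A_j. *)
Definition coef_index (A : 'I_n -> {fset multinom n}) : finType :=
  {j : 'I_n & A j}.

Definition sparse_system (A : 'I_n -> {fset multinom n})
    (c : coef_index A -> C) (j : 'I_n) : polys :=
  \sum_(a : A j) c (Tagged (fun j => A j) a) *: mpolyX C (val a).

(* U is the complement of the common zero locus of a set S of polynomials in
   variables indexed by the finite type I. *)
Definition zariski_open (I : finType) (U : set (I -> C)) : Prop :=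
  exists S : set (mpoly #|I| C),
    U = [set c : I -> C | exists2 p, S p & meval (c \o enum_val) p != 0].

Definition generically (A : 'I_n -> {fset multinom n})
    (P : ('I_n -> polys) -> Prop) : Prop :=
  exists U : set (coef_index A -> C),
    [/\ zariski_open U, U !=set0 &
        forall c, U c -> (forall t, c t != 0) /\ P (sparse_system c)].

Definition common_zero (f : 'I_n -> polys) (z : 'I_n -> C) : Prop :=
  forall j, meval z (f j) = 0.

Definition isolated_zero (f : 'I_n -> polys) (z : 'I_n -> C) : Prop :=
  common_zero f z /\
  exists2 e : C, 0 < e &
    forall w, (forall i, `|w i - z i| < e) -> common_zero f w -> w = z.

(* The localization C[x]_{m_z}, as the subring of C(x) of the fractions whose
   denominator does not vanish at z. *)
Definition local_ring (z : 'I_n -> C) : set {fraction polys} :=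
  [set u | exists p q : polys,
    meval z q != 0 /\ u = tofrac p / tofrac q].

Definition local_ideal (f : 'I_n -> polys) (z : 'I_n -> C) :
    set {fraction polys} :=
  [set u | exists2 g : 'I_n -> {fraction polys},
    forall j, local_ring z (g j) & u = \sum_j g j * tofrac (f j)].

(* mult_z(f) = d, that is, C[x]_{m_z} / (f_1, ..., f_n) C[x]_{m_z} has a basis
   over C with d elements, here the classes of the b i. *)
Definition has_mult (f : 'I_n -> polys) (z : 'I_n -> C) (d : nat) : Prop :=
  exists2 b : 'I_d -> {fraction polys},
    forall i, local_ring z (b i) &
    forall u, local_ring z u ->
      exists! c : 'rV[C]_d,
        local_ideal f z (u - \sum_i tofrac (mpolyC n (c 0 i)) * b i).

End Systems.

Section Polyhedra.
Variable R : realType.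

(* Junk value 0 when S has no least element. *)
Definition set_min (S : set R) : R := xget 0 (S `&` lbound S).

Definition conv_hull (V : lmodType R) (S : set V) : set V :=
  [set x | exists k (p : 'I_k -> V) (w : 'I_k -> R),
    [/\ forall i, S (p i), forall i, 0 <= w i, \sum_i w i = 1 &
        x = \sum_i w i *: p i]].

Definition exp_row n (a : multinom n) : 'rV[R]_n :=
  \row_i (fun_of_multinom a i)%:R.

Definition newton_polytope n (A : {fset multinom n}) : set 'rV[R]_n :=
  conv_hull [set exp_row a | a in [set a | a \in A]].

(* The projection R^n -> R^{n-1} forgetting the last coordinate, n = m.+1. *)
Definition proj_last m (x : 'rV[R]_m.+1) : 'rV[R]_m := col' ord_max x.

Definition lower_envelope m (Q : set 'rV[R]_m.+1) (x : 'rV[R]_m) : R :=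
  set_min [set t | exists q, [/\ Q q, proj_last q = x & q 0 ord_max = t]].

Definition axis_min n (Q : set 'rV[R]_n) (i : 'I_n) : R :=
  set_min [set mu%:R | mu in
    [set mu : nat | (0 < mu)%N /\ Q (mu%:R *: delta_mx 0 i)]].

Definition axis_simplex n (Q : set 'rV[R]_n) : set 'rV[R]_n :=
  conv_hull (0 |` [set axis_min Q i *: delta_mx 0 i | i in setT]).

(* Lebesgue measure on R^m, as the m-fold product of the one on R, with R^m
   represented by m-tuples (and the point mass in dimension 0). *)
Fixpoint lebesgue_tuple (m : nat) :
    set (m.-tuple (measurableTypeR R)) -> \bar R :=
  match m with
  | 0 => dirac [tuple]
  | k.+1 => pushforward
      (product_measure1 (@lebesgue_measure R) (@lebesgue_tuple k))
      (fun p : measurableTypeR R * k.-tuple (measurableTypeR R) =>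
         [tuple of p.1 :: p.2])
  end.

Definition row_integral m (D : set 'rV[R]_m) (g : 'rV[R]_m -> R) : R :=
  let row (t : m.-tuple (measurableTypeR R)) : 'rV[R]_m :=
    \row_i tnth t i in
  fine (\int[@lebesgue_tuple m]_(t in row @^-1` D) (g (row t))%:E)%E.

(* In the next three definitions the convex function number j is given by its
   domain P j together with rho j, whose values outside P j are irrelevant. *)
Definition minkowski_sum m n (P : 'I_n -> set 'rV[R]_m) (J : {set 'I_n}) :
    set 'rV[R]_m :=
  [set x | exists2 y : 'I_n -> 'rV[R]_m,
    forall j, j \in J -> P j (y j) & \sum_(j in J) y j = x].

Definition inf_convolution m n (P : 'I_n -> set 'rV[R]_m)
    (rho : 'I_n -> 'rV[R]_m -> R) (J : {set 'I_n}) (x : 'rV[R]_m) : R :=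
  set_min [set s | exists y : 'I_n -> 'rV[R]_m,
    [/\ forall j, j \in J -> P j (y j), \sum_(j in J) y j = x &
        \sum_(j in J) rho j (y j) = s]].

Definition mixed_integral m (P : 'I_m.+1 -> set 'rV[R]_m)
    (rho : 'I_m.+1 -> 'rV[R]_m -> R) : R :=
  \sum_(1 <= k < m.+2) (-1) ^+ (m.+1 - k) *
    \sum_(J : {set 'I_m.+1} | #|J| == k)
      row_integral (minkowski_sum P J) (inf_convolution P rho J).

End Polyhedra.

Arguments newton_polytope R {n} A.

(* Main.v *)
(* Let [I_j] be the ideal of the monomials [x^a], [a] in [A_j]; by (H3) it is primary
   to the origin. A generic system is a joint reduction of [I_1, ..., I_n]: up to a
   unit at the origin, a product [I] of powers of these ideals equals the sum of the
   [f_j I / I_j], since the matrix expressing the minimal generators of [I] in this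
   sum is invertible for generic coefficients. The acyclicity of the Koszul complex
   makes the multiplicity additive in each [f_j], so that all joint reductions have
   the same multiplicity, and the multiplicity [D_J] of a system of products
   [F_i = prod_(j in J) f_ij] of generic polynomials governs the growth of the
   colength of the powers of [prod_(j in J) I_j]. Expanding these products and
   applying inclusion-exclusion, [n! mult_0(f) = sum_J (-1)^(n - #J) D_J].
   Finally, the colength of the [N]-th power of [prod_(j in J) I_j] counts, up to a
   lower order term, the lattice points below the graph of the inf-convolution of the
   [rho_j], [j] in [J], dilated by [N]: outside the sum of the simplices [pi(Delta_j)]
   every point dominates a sum of points of the faces on which the [rho_j] vanish.
   Hence [D_J] is [n!] times the integral of this inf-convolution. *)
Require Import Defs.
From HB Require Import structures.
From mathcomp Require Import all_boot all_order all_algebra finmap perm.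
From mathcomp Require Import fraction complex ring lra zify.
(* the notations of mpoly clash with those of MathComp-Analysis *)
From mathcomp Require Import -(notations) mpoly.
From mathcomp Require Import all_classical all_reals all_analysis.
From mathcomp Require Import measurable_realfun.

Set Implicit Arguments.
Unset Strict Implicit.
Unset Printing Implicit Defensive.

Import Order.TTheory GRing.Theory Num.Theory.

Local Open Scope classical_set_scope.
Local Open Scope ring_scope.

(** * Ideals of finite codimension *)

(** Ideals of the local ring at the origin are replaced by their contractions to the polynomial
    ring, the ideals saturated by polynomials with non-zero constant term; the price is a
    denominator [q] with [unit0 q] in most relations. The main obstacle is that the matrix of the
    joint reduction is invertible for generic coefficients. A minimal generator of the product of
    the [Kd]-th powers may decompose in several ways into exponents of the supports; a weight
    selects one. An integer relation among one exponent difference per support shows that, in a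
    selected decomposition, some support is used almost entirely through a single exponent, the
    dominant one. Exchanging one copy of it for the other exponents of that support gives a row of
    the matrix. Under a substitution of powers of one variable for the coefficients, and after
    rescaling rows and columns, the dominant terms alone survive at 0 and give the identity matrix.
    Multiplicities are compared only up to a constant independent of [N], but they are exactly
    linear in powers; large [N] removes the constant. The volume is obtained from the colengths by
    the same device. *)

Section Codimension.
Variables (K : fieldType) (V : lmodType K).
Implicit Types (X Y Z : set V).

Definition sspace X := X 0 /\ forall a u v, X u -> X v -> X (a *: u + v).

(** Read in the quotient [V/X], as is [indep]; thus [codim X d] gives a basis of [V/X] with [d]
    elements. *)
Definition spans X d (b : 'I_d -> V) :=
  forall u, exists c : 'I_d -> K, X (u - \sum_i c i *: b i).

Definition indep X d (b : 'I_d -> V) :=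
  forall c : 'I_d -> K, X (\sum_i c i *: b i) -> forall i, c i = 0.

Definition codim X d := exists b : 'I_d -> V, spans X b /\ indep X b.

Lemma sspace0 X : sspace X -> X 0. Proof. by case. Qed.

Lemma sspaceD X u v : sspace X -> X u -> X v -> X (u + v).
Proof. by move=> [_ h] xu xv; rewrite -[u]scale1r; apply: h. Qed.

Lemma sspaceZ X a u : sspace X -> X u -> X (a *: u).
Proof. by move=> [x0 h] xu; rewrite -[_ *: _]addr0; apply: h. Qed.

Lemma sspaceN X u : sspace X -> X u -> X (- u).
Proof. by move=> hX xu; rewrite -scaleN1r; apply: sspaceZ. Qed.

Lemma sspaceB X u v : sspace X -> X u -> X v -> X (u - v).
Proof. by move=> hX xu xv; apply: sspaceD => //; apply: sspaceN. Qed.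

Lemma sspace_sum X (I : Type) (r : seq I) (P : pred I) (F : I -> V) :
  sspace X -> (forall i, P i -> X (F i)) -> X (\sum_(i <- r | P i) F i).
Proof.
move=> hX h; apply: big_ind => //; first exact: sspace0.
by move=> u v; apply: sspaceD.
Qed.

(** The coordinates of the [b' i] in terms of the [b k] form an [e] by [d] matrix; for [d < e] it
    has a non-zero left kernel vector, a relation modulo [X]. *)
Lemma leq_spans_indep X d e (b : 'I_d -> V) (b' : 'I_e -> V) :
  sspace X -> spans X b -> indep X b' -> (e <= d)%N.
Proof.
move=> hX sb ib; rewrite leqNgt; apply/negP => lt_de.
have /choice [M hM] : forall i, exists c : 'I_d -> K,
  X (b' i - \sum_k c k *: b k) by move=> i; apply: sb.
pose A : 'M[K]_(e, d) := \matrix_(i, j) M i j.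
have : kermx A != 0.
  apply/eqP => k0; have := mxrank_ker A; rewrite k0 mxrank0 => /esym/eqP.
  by rewrite subn_eq0 leqNgt (leq_ltn_trans (rank_leq_col A) lt_de).
move=> /rowV0Pn [v /sub_kermxP vA v0].
have key : X (\sum_i v 0 i *: b' i).
  have -> : \sum_i v 0 i *: b' i = \sum_i v 0 i *: (b' i - \sum_k M i k *: b k).
    apply/eqP; rewrite -subr_eq0 -sumrB; apply/eqP.
    rewrite (eq_bigr (fun i => \sum_k (v 0 i * M i k) *: b k)); last first.
      move=> i _; rewrite -scalerBr opprB addrC subrK scaler_sumr.
      by apply: eq_bigr => k _; rewrite scalerA.
    rewrite exchange_big /= big1 // => k _; rewrite -scaler_suml.
    have := congr1 (fun B : 'rV[K]_d => B 0 k) vA; rewrite !mxE.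
    rewrite (eq_bigr (fun i => v 0 i * M i k)); last by move=> i _; rewrite mxE.
    by move=> ->; rewrite scale0r.
  by apply: sspace_sum => // i _; apply: sspaceZ.
by case/eqP: v0; apply/rowP => i; rewrite mxE (ib (fun i => v 0 i) key).
Qed.

Lemma leq_codim X Y d e : sspace X -> sspace Y -> X `<=` Y ->
  codim X d -> codim Y e -> (e <= d)%N.
Proof.
move=> hX hY XY [b [sb _]] [b' [_ ib]].
apply: (@leq_spans_indep Y _ _ b b') => // u.
by have [c hc] := sb u; exists c; apply: XY.
Qed.

Lemma codim_uniq X d e : sspace X -> codim X d -> codim X e -> d = e.
Proof.
by move=> hX hd he; apply/eqP; rewrite eqn_leq !(@leq_codim X X).
Qed.

(** As long as the family is dependent modulo [X], a vector with a non-zero coefficient in some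
    relation can be eliminated. *)
Lemma spans_codim X d (b : 'I_d -> V) : sspace X -> spans X b ->
  exists2 e, (e <= d)%N & codim X e.
Proof.
move=> hX; elim: d b => [|d IH] b sb.
  by exists 0%N => //; exists b; split => // c _ [].
have [ib|] := pselect (indep X b); first by exists d.+1 => //; exists b.
move=> /existsNP [c /not_implyP [Xc /existsNP [i0 /eqP ci0]]].
have [e le_ed he] : exists2 e, (e <= d)%N & codim X e.
  apply: (IH (fun k => b (lift i0 k))) => u; have [c' hc'] := sb u.
  exists (fun k => c' (lift i0 k) - c' i0 / c i0 * c (lift i0 k)).
  have -> : u - \sum_k (c' (lift i0 k) - c' i0 / c i0 * c (lift i0 k)) *: b (lift i0 k)
    = (u - \sum_i c' i *: b i) + (c' i0 / c i0) *: \sum_i c i *: b i.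
    rewrite !(bigD1_ord i0) //= scalerDr scalerA divfK // scaler_sumr.
    rewrite (eq_bigr (fun k => c' (lift i0 k) *: b (lift i0 k)
      - (c' i0 / c i0) *: (c (lift i0 k) *: b (lift i0 k)))); last first.
      by move=> k _; rewrite scalerBl scalerA.
    rewrite sumrB opprB -addrA; congr (u + _).
    by rewrite opprD addrACA addNr add0r addrC.
  by apply: sspaceD => //; apply: sspaceZ.
by exists e => //; apply: leqW.
Qed.

(** Right exactness of [V/Z -> V/X -> V/Y -> 0], the first map being induced by [phi]. *)
Lemma spans_cat X Y Z d1 d2 (phi : {linear V -> V}) (b1 : 'I_d1 -> V) (b2 : 'I_d2 -> V) :
  sspace X -> (forall s, Z s -> X (phi s)) ->
  (forall u, Y u -> exists s, X (u - phi s)) ->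
  spans Z b1 -> spans Y b2 ->
  spans X (fun k : 'I_(d1 + d2) => match fintype.split k with inl i => phi (b1 i) | inr j => b2 j end).
Proof.
move=> hX ZX YX s1 s2 u; have [c2 h2] := s2 u; have [s hs] := YX _ h2.
have [c1 h1] := s1 s.
exists (fun k => match fintype.split k with inl i => c1 i | inr j => c2 j end).
rewrite big_split_ord /=.
under eq_bigr => i _ do rewrite (unsplitK (inl i)).
under [X in _ - (_ + X)]eq_bigr => j _ do rewrite (unsplitK (inr j)).
have -> : \sum_i c1 i *: phi (b1 i) = phi (\sum_i c1 i *: b1 i).
  by rewrite linear_sum; apply: eq_bigr => i _; rewrite linearZ.
move/ZX: h1; rewrite linearB /= => h1; have := sspaceD hX hs h1.
by rewrite addrA subrK opprD addrA addrAC.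
Qed.

Lemma codim_exact_le X Y Z d1 d2 (phi : {linear V -> V}) :
  sspace X -> (forall s, Z s -> X (phi s)) ->
  (forall u, Y u -> exists s, X (u - phi s)) ->
  codim Z d1 -> codim Y d2 -> exists2 e, (e <= d1 + d2)%N & codim X e.
Proof.
move=> hX ZX YX [b1 [s1 _]] [b2 [s2 _]].
exact: spans_codim hX (spans_cat hX ZX YX s1 s2).
Qed.

(** The equivalence between [Z s] and [X (phi s)] makes the first map injective, so that dimensions
    add up. *)
Lemma codim_exact X Y Z d1 d2 (phi : {linear V -> V}) :
  sspace X -> sspace Y -> X `<=` Y -> (forall s, Y (phi s)) ->
  (forall s, Z s <-> X (phi s)) ->
  (forall u, Y u -> exists s, X (u - phi s)) ->
  codim Z d1 -> codim Y d2 -> codim X (d1 + d2).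
Proof.
move=> hX hY XY Yphi ZX YX [b1 [s1 i1]] [b2 [s2 i2]].
exists (fun k : 'I_(d1 + d2) => match fintype.split k with inl i => phi (b1 i) | inr j => b2 j end); split.
  by apply: (spans_cat hX _ YX s1 s2) => s /ZX.
move=> c; rewrite big_split_ord /=.
under eq_bigr => i _ do rewrite (unsplitK (inl i)).
under [X in _ + X]eq_bigr => j _ do rewrite (unsplitK (inr j)).
have -> : \sum_i c (lshift d2 i) *: phi (b1 i) = phi (\sum_i c (lshift d2 i) *: b1 i).
  by rewrite linear_sum; apply: eq_bigr => i _; rewrite linearZ.
move=> h; have c2 : forall j, c (rshift d1 j) = 0.
  apply: i2; have /XY hY' := h.
  by have := sspaceB hY hY' (Yphi (\sum_i c (lshift d2 i) *: b1 i)); rewrite addrAC subrr add0r.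
move: h; rewrite [X in _ + X]big1 ?addr0; last by move=> j _; rewrite c2 scale0r.
move=> /ZX /i1 c1 k; case: (splitP k) => [i ki|j kj].
  by rewrite -[RHS](c1 i); congr c; apply: val_inj.
by rewrite -[RHS](c2 j); congr c; apply: val_inj.
Qed.

End Codimension.

(** * Contractions of ideals of the local ring at the origin *)

Section LocalIdeals.
Variables (n : nat) (K : fieldType).
Local Notation S := (mpoly n K).
Local Notation X_ b := (@mpolyX n K b).
Implicit Types (X Y : set S) (G : set S) (f g q u : S).

Definition ideal X :=
  [/\ X 0, forall u v, X u -> X v -> X (u + v) & forall a u, X u -> X (a * u)].

(** The polynomials that become units in the local ring at the origin. *)
Definition unit0 q := mcoeff (@mnm0 n) q != 0.

Definition satid X := ideal X /\ forall q u, unit0 q -> X (q * u) -> X u.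

(** Given as an intersection so that an inclusion [sidl G] in [X] reduces to [X] being saturated and
    containing [G]; this serves as the induction principle for membership. *)
Definition sidl G : set S := [set u | forall X, satid X -> G `<=` X -> X u].

(** [X] contains a power of the maximal ideal at the origin. *)
Definition cof X := exists M, forall b, (M <= mdeg b)%N -> X (X_ b).

Lemma idealN X u : ideal X -> X u -> X (- u).
Proof. by case=> _ _ hM xu; rewrite -mulN1r; apply: hM. Qed.

Lemma idealB X u v : ideal X -> X u -> X v -> X (u - v).
Proof. by move=> hX xu xv; case: (hX) => _ hD _; apply: hD => //; apply: idealN. Qed.

Lemma idealMr X u a : ideal X -> X u -> X (u * a).
Proof. by case=> _ _ hM xu; rewrite mulrC; apply: hM. Qed.

Lemma ideal_sum X (I : Type) (r : seq I) (P : pred I) (F : I -> S) :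
  ideal X -> (forall i, P i -> X (F i)) -> X (\sum_(i <- r | P i) F i).
Proof.
move=> [h0 hD hM] h.
exact: big_ind.
Qed.

Lemma ideal_sspace X : ideal X -> sspace X.
Proof.
move=> [h0 hD hM]; split=> // a u v xu xv; apply: hD => //.
by rewrite -mul_mpolyC; apply: hM.
Qed.

Lemma satid_ideal X : satid X -> ideal X. Proof. by case. Qed.

Lemma unit0_1 : unit0 1.
Proof. by rewrite /unit0 mcoeff1 eqxx oner_eq0. Qed.

Lemma mcoeff0M (p q : S) :
  mcoeff (@mnm0 n) (p * q) = mcoeff (@mnm0 n) p * mcoeff (@mnm0 n) q.
Proof. exact: (rmorphM (@mcoeff n K (@mnm0 n))). Qed.

Lemma unit0M p q : unit0 p -> unit0 q -> unit0 (p * q).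
Proof. by rewrite /unit0 mcoeff0M => h1 h2; rewrite mulf_neq0. Qed.

Lemma sidl_satid G : satid (sidl G).
Proof.
split; first split.
- by move=> X [[h0 _ _] _] _.
- move=> u v hu hv X hX GX; case: (hX) => [[_ hD _] _].
  by apply: hD; [apply: hu | apply: hv].
- by move=> a u hu X hX GX; case: (hX) => [[_ _ hM] _]; apply: hM; exact: hu.
- move=> q u hq hu X hX GX; case: (hX) => [_ hs].
  by apply: (hs q) => //; apply: hu.
Qed.

Lemma sidl_ideal G : ideal (sidl G).
Proof. exact: satid_ideal (sidl_satid G). Qed.

Lemma sidl_sspace G : sspace (sidl G).
Proof. exact: ideal_sspace (sidl_ideal G). Qed.
Hint Resolve sidl_satid sidl_ideal sidl_sspace : core.

Lemma sidl_gen G u : G u -> sidl G u.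
Proof. by move=> Gu X _ GX; apply: GX. Qed.

Lemma sidlD G u v : sidl G u -> sidl G v -> sidl G (u + v).
Proof. by case: (sidl_satid G) => [[_ hD _] _]; apply: hD. Qed.

Lemma sidlM G a u : sidl G u -> sidl G (a * u).
Proof. by case: (sidl_satid G) => [[_ _ hM] _]; apply: hM. Qed.

Lemma sidlMr G u a : sidl G u -> sidl G (u * a).
Proof. by rewrite mulrC; apply: sidlM. Qed.

Lemma sidl_min G X : satid X -> G `<=` X -> sidl G `<=` X.
Proof. by move=> hX GX u; apply. Qed.

Lemma sidl_sub G G' : G `<=` sidl G' -> sidl G `<=` sidl G'.
Proof. exact: sidl_min. Qed.

Lemma cof_sub X Y : X `<=` Y -> cof X -> cof Y.
Proof. by move=> XY [M h]; exists M => b /h /XY. Qed.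

Definition vanishes M (p : S) := forall b, mcoeff b p != 0 -> (M <= mdeg b)%N.

Lemma vanishesM a b p q : vanishes a p -> vanishes b q -> vanishes (a + b) (p * q).
Proof.
move=> hp hq c; rewrite -mcoeff_msupp => /msuppM_le /allpairsP [[m1 m2] /=].
rewrite !mcoeff_msupp => -[/hp h1 /hq h2 ->].
by rewrite mdegD leq_add.
Qed.

Lemma vanishesX a p k : vanishes a p -> vanishes (a * k) (p ^+ k).
Proof.
move=> hp; elim: k => [|k IH]; first by rewrite muln0.
by rewrite exprS mulnS; apply: vanishesM.
Qed.

Lemma ideal_vanishes X M p : ideal X -> (forall b, (M <= mdeg b)%N -> X (X_ b)) ->
  vanishes M p -> X p.
Proof.
move=> hX hM hp; rewrite (mpolyE p) big_seq; apply: ideal_sum => // b.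
by rewrite mcoeff_msupp => /hp /hM xb; apply: sspaceZ => //; apply: ideal_sspace.
Qed.

(** Modulo a power of the maximal ideal, an element of [unit0] is a non-zero constant plus a
    nilpotent, hence already invertible. *)
Lemma ideal_cof_satid X : ideal X -> cof X -> satid X.
Proof.
move=> hX [M hM]; split=> // q u hq xqu; case: (hX) => [h0 hD hMul].
set c := mcoeff (@mnm0 n) q; set r : S := - mpolyC n c.
have van : vanishes M ((q + r) ^+ M).
  rewrite -[X in vanishes X _]mul1n; apply: vanishesX => b.
  rewrite mcoeffD mcoeffN mcoeffC; case: (eqVneq b (@mnm0 n)) => [->|b0 _].
    by rewrite mulr1 subrr eqxx.
  by rewrite lt0n mdeg_eq0.
(* [q + r] is the nilpotent part. Since [q * u] is in [X], multiplying [u] by [q + r] amounts,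
   modulo [X], to multiplying it by the constant [r]. *)
have diff k : X ((q + r) ^+ k * u - r ^+ k * u).
  elim: k => [|k IH]; first by rewrite subrr.
  have -> : (q + r) ^+ k.+1 * u - r ^+ k.+1 * u =
    (q + r) * ((q + r) ^+ k * u - r ^+ k * u) + r ^+ k * (q * u).
    by rewrite !exprS; ring.
  by apply: hD; apply: hMul.
have : X (r ^+ M * u).
  have /(idealMr u hX) h := ideal_vanishes hX hM van.
  by have := idealB hX h (diff M); rewrite opprB addrC subrK.
have -> : r ^+ M = mpolyC n ((- c) ^+ M).
  by rewrite /r -mpolyCN rmorphXn.
move=> h; have := hMul (mpolyC n ((- c) ^+ M)^-1) _ h.
by rewrite mulrA -mpolyCM mulVf ?mpolyC1 ?mul1r // expf_neq0 // oppr_eq0.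
Qed.

(** Adjoining a generator to a cofinite ideal needs no further saturation, so membership in the sum
    is written without denominators. *)
Lemma satid_cofactor X f : ideal X -> cof X ->
  satid [set u | exists s, X (u - f * s)].
Proof.
move=> hX hc; apply: ideal_cof_satid; last first.
  by apply: cof_sub hc => u xu; exists 0; rewrite mulr0 subr0.
case: (hX) => h0 hD hM; split.
- by exists 0; rewrite mulr0 subr0.
- move=> u v [s hs] [t ht]; exists (s + t).
  by have := hD _ _ hs ht; rewrite mulrDr opprD addrACA.
- by move=> a u [s hs]; exists (a * s); have := hM a _ hs; rewrite mulrBr mulrCA.
Qed.

Lemma satid_colon X f : satid X -> satid [set u | X (f * u)].
Proof.
move=> [[h0 hD hM] hs]; split; first split => /=.
- by rewrite mulr0.
- by move=> u v hu hv; rewrite mulrDr; apply: hD.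
- by move=> a u hu; rewrite mulrCA; apply: hM.
- by move=> q u hq; rewrite /= mulrCA; apply: hs.
Qed.

Lemma sidl_setU1 G f u : sidl (f |` G) u ->
  exists q a, unit0 q /\ sidl G (q * u - a * f).
Proof.
have hG := sidl_satid G; case: (hG) => [[h0 hD hM] hs].
apply: (@sidl_min (f |` G) [set u | exists q a, unit0 q /\ sidl G (q * u - a * f)]).
  split; first split.
  - by exists 1, 0; split; [exact: unit0_1|rewrite mulr0 mul0r subrr].
  - move=> v w [q [a [hq ha]]] [r [b [hr hb]]].
    exists (q * r), (r * a + q * b); split; first exact: unit0M.
    have := hD _ _ (hM r _ ha) (hM q _ hb).
    by congr (sidl G _); ring.
  - move=> c v [q [a [hq ha]]]; exists q, (c * a); split=> //.
    by have := hM c _ ha; congr (sidl G _); ring.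
  - move=> r v hr [q [a [hq ha]]]; exists (q * r), a; split; first exact: unit0M.
    by rewrite -mulrA.
move=> v [->|Gv].
  by exists 1, 1; split; [exact: unit0_1|rewrite mul1r subrr].
by exists 1, 0; split; [exact: unit0_1|rewrite mul1r mul0r subr0; apply: sidl_gen].
Qed.

(** The monomials of degree below the bound [M] span the quotient. *)
Lemma cof_codim X : ideal X -> cof X -> exists d, codim X d.
Proof.
move=> hX [M hM].
pose e (k : 'I_#|{: bmultinom n M}|) : bmultinom n M := enum_val k.
have sp : spans X (fun k => X_ (e k)).
  move=> u; exists (fun k => mcoeff (e k) u).
  have -> : \sum_k mcoeff (e k) u *: X_ (e k) =
    \sum_(b : bmultinom n M) mcoeff b u *: X_ b.
    by rewrite (reindex e) //=; apply: onW_bij; exact: enum_val_bij.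
  apply: (ideal_vanishes hX hM) => b; rewrite mcoeffB raddf_sum /=.
  apply: contraR; rewrite -ltnNge => ltb; rewrite subr_eq0; apply/eqP.
  rewrite (bigD1 (BMultinom ltb)) //= big1 ?addr0.
    by rewrite mcoeffZ mcoeffX eqxx mulr1.
  move=> c /eqP cb; rewrite mcoeffZ mcoeffX; case: eqP => [cb0|]; last by rewrite mulr0.
  by case: cb; apply: val_inj.
by have [d _ hd] := spans_codim (ideal_sspace hX) sp; exists d.
Qed.

Definition mulf f (u : S) : S := f * u.

Fact mulf_is_linear f : linear (mulf f).
Proof. by move=> a u v; rewrite /mulf mulrDr -!mul_mpolyC mulrCA. Qed.

HB.instance Definition _ f := @GRing.isLinear.Build K S S _ (mulf f) (mulf_is_linear f).

(* Multiplication by [f] gives 0 -> S/(g, G) -> S/(fg, G) -> S/(f, G) -> 0 . *)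
Lemma codim_mul G f g d1 d2 :
  (forall u, sidl G (f * u) -> sidl G u) -> cof (sidl (f * g |` G)) ->
  codim (sidl (f |` G)) d1 -> codim (sidl (g |` G)) d2 ->
  codim (sidl (f * g |` G)) (d1 + d2).
Proof.
move=> nzd hc h1 h2; rewrite addnC.
have sub1 : sidl (f * g |` G) `<=` sidl (f |` G).
  apply: sidl_min => // u [->|Gu]; last by apply: sidl_gen; right.
  by apply: sidlMr; apply: sidl_gen; left.
apply: (@codim_exact _ _ _ (sidl (f |` G)) _ _ _ (mulf f) _ _ sub1 _ _ _ h2 h1) => //.
- by move=> s; apply: sidlMr; apply: sidl_gen; left.
- move=> s; split => [|/sidl_setU1 [q [a [hq h]]]].
    apply: (sidl_min (satid_colon f (sidl_satid _))) => u [->|Gu].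
      by apply: sidl_gen; left.
    by case: (sidl_satid (f * g |` G)) => [[_ _ hM] _]; apply: hM; apply: sidl_gen; right.
  case: (sidl_satid (g |` G)) => [[_ hD hM] hs]; apply: (hs q) => //.
  (* Injectivity of the first map: the non-zero-divisor [f] is cancelled. *)
  have /nzd h' : sidl G (f * (q * s - a * g)).
    by move: h; rewrite /= /mulf; congr (sidl G _); ring.
  rewrite -(subrK (a * g) (q * s)); apply: hD; last by apply: hM; apply: sidl_gen; left.
  by apply: sidl_sub h' => v Gv; apply: sidl_gen; right.
- move=> u; apply: (sidl_min (satid_cofactor f (satid_ideal (sidl_satid _)) hc)).
  move=> v [->|Gv]; first by exists 1; rewrite mulr1 subrr; case: (sidl_satid (f * g |` G)) => [[]].
  by exists 0; rewrite mulr0 subr0; apply: sidl_gen; right.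
Qed.

(** Right exactness alone, hence only a bound, but for any [f]: it is enough that [f] multiplies [Z]
    into [X]. *)
Lemma codim_step X Z f d1 d2 : ideal X -> cof X ->
  (forall s, Z s -> X (f * s)) -> codim Z d1 -> codim (sidl (f |` X)) d2 ->
  exists2 e, (e <= d1 + d2)%N & codim X e.
Proof.
move=> hX hc ZX h1 h2.
apply: (@codim_exact_le _ _ X (sidl (f |` X)) Z _ _ (mulf f) _ ZX _ h1 h2); first exact: ideal_sspace.
move=> u; apply: (sidl_min (satid_cofactor f hX hc)) => v [->|Xv].
  by exists 1; rewrite mulr1 subrr; case: hX.
by exists 0; rewrite mulr0 subr0.
Qed.

Lemma sidl_idem X : satid X -> sidl X = X.
Proof. by move=> hX; apply/seteqP; split; [exact: sidl_min|exact: sidl_gen]. Qed.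

End LocalIdeals.
#[global] Hint Resolve sidl_satid sidl_ideal sidl_sspace : core.

(** * Acyclicity of the Koszul complex *)

Section Koszul.
Variables (n : nat) (K : fieldType).
Local Notation S := (mpoly n K).
Local Notation X_ b := (@mpolyX n K b).

(* The exterior algebra on [k] generators: a pair [(x, y)] in degree [k.+1]
   stands for [x + e_k /\ y]. *)
Fixpoint ext (k : nat) : lmodType S :=
  if k is k'.+1 then [the lmodType S of (ext k' * ext k')%type]
  else [the lmodType S of S^o].

Variable F : nat -> S.

(** The Koszul differential, contraction with [F]; the minus sign comes from moving it past the top
    generator. *)
Fixpoint kos k : ext k -> ext k :=
  if k is k'.+1 then
    fun x : ext k' * ext k' => (kos x.1 + F k' *: x.2, - kos x.2)
  else fun=> 0.

(** Left multiplication by [e_j]; the minus sign comes from exchanging [e_j] with the top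
    generator. *)
Fixpoint wedge k j : ext k -> ext k :=
  if k is k'.+1 then
    fun x : ext k' * ext k' =>
      if j == k' then (0, x.1) else (wedge j x.1, - wedge j x.2)
  else fun=> 0.

Fixpoint homdeg k i : ext k -> Prop :=
  if k is k'.+1 then
    fun x : ext k' * ext k' =>
      homdeg i x.1 /\ (if i is i'.+1 then homdeg i' x.2 else x.2 = 0)
  else fun x => i = 0%N \/ x = 0.

Fixpoint coefin (X : set S) k : ext k -> Prop :=
  if k is k'.+1 then
    fun x : ext k' * ext k' => coefin X x.1 /\ coefin X x.2
  else X.

Lemma kosP k : forall (a : S) (x y : ext k), kos (a *: x + y) = a *: kos x + kos y.
Proof.
elim: k => [|k IH] a; first by move=> x y; rewrite /= scaler0 addr0.
move=> [x1 x2] [y1 y2]; rewrite /= !IH; congr (_, _).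
  rewrite -[RHS]/(a *: (kos x1 + F k *: x2) + (kos y1 + F k *: y2)).
  by rewrite !scalerDr addrACA !scalerA mulrC.
rewrite -[RHS]/(a *: - kos x2 - kos y2).
by rewrite opprD scalerN.
Qed.

Lemma kosD k (x y : ext k) : kos (x + y) = kos x + kos y.
Proof. by rewrite -[x in LHS]scale1r kosP scale1r. Qed.

Lemma kos0 k : kos (0 : ext k) = 0.
Proof. by apply: (addIr (kos (0 : ext k))); rewrite -kosD !add0r. Qed.

Lemma kosZ k a (x : ext k) : kos (a *: x) = a *: kos x.
Proof. by rewrite -[a *: x]addr0 kosP kos0 addr0. Qed.

Lemma kosN k (x : ext k) : kos (- x) = - kos x.
Proof. by rewrite -scaleN1r kosZ scaleN1r. Qed.

Lemma kos_sum k (I : Type) (r : seq I) (x : I -> ext k) :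
  kos (\sum_(i <- r) x i) = \sum_(i <- r) kos (x i).
Proof. by elim/big_rec2: _ => [|i y1 y2 _ <-]; rewrite ?kos0 ?kosD. Qed.

Lemma kos_kos k (x : ext k) : kos (kos x) = 0.
Proof.
elim: k x => [//|k IH] [x1 x2] /=; congr (_, _).
  by rewrite kosD IH add0r kosZ scalerN subrr.
by rewrite kosN IH oppr0 oppr0.
Qed.

Lemma wedgeP j k : forall (x y : ext k) (a : S),
  wedge j (x + a *: y) = wedge j x + a *: wedge j y.
Proof.
elim: k => [|k IH]; first by move=> x y a; rewrite /= scaler0 addr0.
move=> [x1 x2] [y1 y2] a /=; case: eqP => _.
  rewrite -[RHS]/(0 + a *: (0 : ext k), x1 + a *: y1).
  by rewrite scaler0 addr0.
rewrite -[RHS]/(wedge j x1 + a *: wedge j y1, - wedge j x2 + a *: - wedge j y2).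
by rewrite !IH opprD scalerN.
Qed.

Lemma wedge0 j k : wedge j (0 : ext k) = 0.
Proof.
by elim: k => [//|k IH] /=; case: eqP => // _; rewrite !IH oppr0.
Qed.

Lemma wedgeN j k (x : ext k) : wedge j (- x) = - wedge j x.
Proof. by rewrite -scaleN1r -[_ *: _]add0r wedgeP wedge0 add0r scaleN1r. Qed.

(** The differential is an antiderivation sending [e_j] to [F j]. Multiplication by [F j] is
    therefore homotopic to zero, and so is that by any element of the ideal of the [F j]. *)
Lemma kos_wedge k j (x : ext k) : (j < k)%N ->
  kos (wedge j x) + wedge j (kos x) = F j *: x.
Proof.
elim: k x => [//|k IH] [x1 x2]; rewrite ltnS leq_eqVlt => /orP[/eqP ->|jk] /=.
  rewrite eqxx /= kos0 add0r.
  rewrite -[LHS]/(F k *: x1 + 0, - kos x1 + (kos x1 + F k *: x2)).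
  by rewrite addr0 addKr.
rewrite (ltn_eqF jk) /=.
rewrite -[LHS]/(kos (wedge j x1) + F k *: - wedge j x2 + wedge j (kos x1 + F k *: x2),
  - kos (- wedge j x2) - wedge j (- kos x2)).
by rewrite wedgeP addrACA IH // scalerN addNr addr0 kosN opprK wedgeN opprK IH.
Qed.

Lemma homdegP k : forall i (a : S) (x y : ext k), homdeg i x -> homdeg i y ->
  homdeg i (a *: x + y).
Proof.
elim: k => [|k IH] i a.
  by move=> x y [->|->] [i0|->]; [left|left|left|right; rewrite scaler0 addr0].
move=> [x1 x2] [y1 y2] /= [hx1 hx2] [hy1 hy2]; split; first exact: IH.
by case: i hx1 hx2 hy1 hy2 => [_ -> _ ->|i _ hx2 _ hy2]; [rewrite scaler0 addr0|exact: IH].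
Qed.

Lemma homdeg0 k : forall i, homdeg i (0 : ext k).
Proof. by elim: k => [|k IH] [|i] /=; auto. Qed.

Lemma homdegZ k i a (x : ext k) : homdeg i x -> homdeg i (a *: x).
Proof. by move=> h; rewrite -[_ *: _]addr0; apply: homdegP => //; apply: homdeg0. Qed.

Lemma homdegD k i (x y : ext k) : homdeg i x -> homdeg i y -> homdeg i (x + y).
Proof. by move=> hx hy; rewrite -[x]scale1r; apply: homdegP. Qed.

Lemma homdegN k i (x : ext k) : homdeg i x -> homdeg i (- x).
Proof. by move=> h; rewrite -scaleN1r; apply: homdegZ. Qed.

Lemma homdeg_sum k i (I : Type) (r : seq I) (x : I -> ext k) :
  (forall j, homdeg i (x j)) -> homdeg i (\sum_(j <- r) x j).
Proof.
move=> h; elim/big_rec: _ => [|j y _ hy]; [exact: homdeg0|exact: homdegD].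
Qed.

Lemma homdeg_kos k : forall i (x : ext k), homdeg i.+1 x -> homdeg i (kos x).
Proof.
elim: k => [|k IH] i; first by move=> x _; right.
move=> [x1 x2] /= [h1 h2]; split.
  by apply: homdegD; [exact: IH|exact: homdegZ].
case: i h1 h2 => [_ h2|i _ h2]; last by apply/homdegN/IH.
suff -> : kos x2 = 0 by rewrite oppr0.
move: (k) x2 h2 => {IH x1}; elim=> [//|k' IH] [y1 y2] /= [h1 ->].
by rewrite scaler0 addr0 IH // kos0 oppr0.
Qed.

Lemma homdeg_wedge k j : forall i (x : ext k), homdeg i x -> homdeg i.+1 (wedge j x).
Proof.
elim: k => [|k IH] i; first by move=> x _; right.
move=> [x1 x2] /= [h1 h2]; case: eqP => _ /=; split => //.
- exact: homdeg0.
- exact: IH.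
- case: i h1 h2 => [_ ->|i _ h2]; last by apply/homdegN/IH.
  by rewrite wedge0 oppr0; apply: homdeg0.
Qed.

Lemma homdeg_gt k : forall i (x : ext k), (k < i)%N -> homdeg i x -> x = 0.
Proof.
elim: k => [|k IH] [|i] //; first by move=> x _ [].
move=> [x1 x2] ki /= [h1 h2]; congr (_, _); first exact: IH (ltnW ki) h1.
exact: IH h2.
Qed.

Lemma coefin_mono (X Y : set S) k (x : ext k) :
  (forall u, X u -> Y u) -> coefin X x -> coefin Y x.
Proof.
move=> XY; elim: k x => [|k IH]; first exact: XY.
by move=> [x1 x2] [h1 h2]; split; apply: IH.
Qed.

Section CoefficientIdeal.
Variable X : set S.
Hypothesis hX : ideal X.

Lemma coefinP k : forall (a : S) (x y : ext k), coefin X x -> coefin X y ->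
  coefin X (a *: x + y).
Proof.
case: hX => h0 hD hM; elim: k => [|k IH] a.
  by move=> x y hx hy; apply: hD => //; apply: hM.
by move=> [x1 x2] [y1 y2] /= [hx1 hx2] [hy1 hy2]; split; apply: IH.
Qed.

Lemma coefin0 k : coefin X (0 : ext k).
Proof. by case: hX => h0 _ _; elim: k => [|k IH] //=. Qed.

Lemma coefinZ k a (x : ext k) : coefin X x -> coefin X (a *: x).
Proof. by move=> h; rewrite -[_ *: _]addr0; apply: coefinP => //; apply: coefin0. Qed.

Lemma coefinD k (x y : ext k) : coefin X x -> coefin X y -> coefin X (x + y).
Proof. by move=> hx hy; rewrite -[x]scale1r; apply: coefinP. Qed.

Lemma coefinN k (x : ext k) : coefin X x -> coefin X (- x).
Proof. by move=> h; rewrite -scaleN1r; apply: coefinZ. Qed.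

Lemma coefin_kos k : forall x : ext k, coefin X x -> coefin X (kos x).
Proof.
elim: k => [|k IH]; first by move=> x _; case: hX.
move=> [x1 x2] [h1 h2]; split => /=; last exact/coefinN/IH.
by apply: coefinD; [exact: IH|exact: coefinZ].
Qed.

Lemma coefin_wedge j k : forall x : ext k, coefin X x -> coefin X (wedge j x).
Proof.
elim: k => [|k IH]; first by move=> x _; case: hX.
move=> [x1 x2] [h1 h2] /=; case: eqP => _; split => //=; first exact: coefin0.
  exact: IH.
exact/coefinN/IH.
Qed.

Lemma coefin_nzd t k : (forall u, X (t * u) -> X u) ->
  forall x : ext k, coefin X (t *: x) -> coefin X x.
Proof.
move=> nzd; elim: k => [|k IH]; first exact: nzd.
by move=> [x1 x2] [h1 h2]; split; apply: IH.
Qed.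

(** Coefficientwise division by [t] modulo [X], arranged to preserve the homological degree. *)
Lemma coefin_lift (Y : set S) t k : (forall u, Y u -> exists v, X (u - t * v)) ->
  forall i (x : ext k), homdeg i x -> coefin Y x ->
  exists y : ext k, homdeg i y /\ coefin X (x - t *: y).
Proof.
case: hX => h0 _ _ YX; elim: k => [|k IH] i.
  move=> x [->|->] /YX [v hv]; first by exists v; split => //; left.
  by exists 0; split; [right|rewrite scaler0 subr0].
move=> [x1 x2] [h1 h2] [c1 c2].
have [y1 [d1 e1]] := IH _ _ h1 c1.
case: i h1 h2 d1 => [_ h2 d1|i _ h2 d1].
  exists (y1, 0); split; split => //.
  change (coefin X (x2 - t *: (0 : ext k))).
  by rewrite scaler0 subr0 (h2 : x2 = 0); apply: coefin0.
have [y2 [d2 e2]] := IH _ _ h2 c2.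
by exists (y1, y2); split; split.
Qed.

End CoefficientIdeal.

(* The ideal of [x_0 ^ M, ..., x_(s-1) ^ M]. *)
Definition powideal M s : set S :=
  [set u | forall b, mcoeff b u != 0 -> exists2 i : 'I_n, (i < s)%N & (M <= b i)%N].

Lemma powideal_ideal M s : ideal (powideal M s).
Proof.
split.
- by move=> b; rewrite mcoeff0 eqxx.
- move=> u v hu hv b; rewrite mcoeffD; have [->|nz _] := eqVneq (mcoeff b u) 0.
    by rewrite add0r; apply: hv.
  exact: hu.
- move=> a u hu b; rewrite -mcoeff_msupp => /msuppM_le /allpairsP [[m1 m2] /=].
  rewrite !mcoeff_msupp => -[_ /hu [i li Mi] ->]; exists i => //.
  by rewrite mnmDE (leq_trans Mi) ?leq_addl.
Qed.

Definition powvar M (s : 'I_n) : S := X_ (mnm_muln (mnm1 s) M).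

Lemma powideal_var M (s : 'I_n) : powideal M s.+1 (powvar M s).
Proof.
move=> b; rewrite mcoeffX; have [<- _|_] := eqVneq (mnm_muln (mnm1 s) M) b; last by rewrite eqxx.
by exists s => //; rewrite mulmnE mnm1E eqxx mul1n.
Qed.

Lemma powidealS M s u : powideal M s u -> powideal M s.+1 u.
Proof. by move=> h b /h [i li Mi]; exists i => //; apply: ltnW. Qed.

(** The variable [x_s] does not occur in the generators, so its power can be cancelled monomial by
    monomial. *)
Lemma powideal_nzd M (s : 'I_n) u : powideal M s (powvar M s * u) -> powideal M s u.
Proof.
move=> h b nz; have := h (mnm_add b (mnm_muln (mnm1 s) M)).
rewrite mulrC /powvar addmC mcoeffMX => /(_ nz) [i li Mi]; exists i => //.
by move: Mi; rewrite mnmDE mulmnE mnm1E -(inj_eq val_inj) /= (gtn_eqF li) mul0n add0n.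
Qed.

(** The monomials divisible by [x_s ^ M] are collected in [v]; each remaining one is divisible by an
    earlier power. *)
Lemma powideal_split M (s : 'I_n) u : powideal M s.+1 u ->
  exists v, powideal M s (u - powvar M s * v).
Proof.
move=> h; set t := mnm_muln (mnm1 s) M.
have tE (i : 'I_n) : t i = if i == s then M else 0%N.
  by rewrite mulmnE mnm1E eq_sym; case: eqP; rewrite ?mul1n ?mul0n.
pose v : S := \sum_(b <- msupp u | (M <= b s)%N) mcoeff b u *: X_ (mnm_sub b t).
exists v.
have -> : powvar M s * v = \sum_(b <- msupp u | (M <= b s)%N) mcoeff b u *: X_ b.
  rewrite mulr_sumr; apply: eq_bigr => b Mb.
  rewrite -mul_mpolyC mulrCA mul_mpolyC -mpolyXD; congr (_ *: X_ _).
  rewrite addmC submK //; apply/mnm_lepP => i; rewrite tE; case: eqP => [->|] //.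
rewrite [X in X - _]mpolyE (bigID (fun b : multinom n => (M <= b s)%N)) /= addrAC subrr add0r.
move=> b; rewrite raddf_sum /= => nz.
have {nz} : b \in msupp u /\ ~~ (M <= b s)%N.
  apply/andP; apply: contraR nz => nb; rewrite big_seq_cond big1 // => c /andP[cu Mc].
  rewrite mcoeffZ mcoeffX; case: (eqVneq c b) => [cb|]; last by rewrite mulr0.
  by move: nb; rewrite -cb cu Mc.
rewrite mcoeff_msupp => -[hb nM]; case: (h b hb) => i.
rewrite ltnS leq_eqVlt => /orP[/eqP eis|li] Mi.
  by case/negP: nM; rewrite -(val_inj eis : i = s).
by exists i.
Qed.

Hypothesis cofF : exists M, forall s : 'I_n, exists q g,
  unit0 q /\ q * powvar M s = \sum_(j < n) g j * F j.

(* Descending induction on [s]: the Koszul homology of [S / (x_0^M, ..., x_(s-1)^M)]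
   vanishes (up to units) in degrees above [s]; each [x_s^M] kills the homology. *)
Lemma koszul_acyclic : exists M, forall r s, (s + r = n)%N ->
  forall i (z : ext n), (s < i)%N -> homdeg i z -> coefin (powideal M s) (kos z) ->
  exists q w, [/\ unit0 q, homdeg i.+1 w & coefin (powideal M s) (q *: z - kos w)].
Proof.
case: cofF => M hM; exists M; elim=> [|r IH] s.
  (* For [s = n] the degree exceeds the number of generators, so [z = 0]. *)
  rewrite addn0 => -> i z ni hz _; exists 1, 0.
  rewrite (homdeg_gt ni hz) scaler0 kos0 subrr; split.
  - exact: unit0_1.
  - exact: homdeg0.
  - exact/coefin0/powideal_ideal.
move=> srn i z si hz hdz.
have sn : (s < n)%N by rewrite -srn addnS ltnS leq_addr.
pose s' := Ordinal sn; have [q1 [g [uq1 hg]]] := hM s'; set t := powvar M s' in hg.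
have iX := powideal_ideal M s.
(* The homotopy for [q1 * t] applied to [z]: since the boundary of [z] vanishes modulo the ideal,
   that of [W] is [(q1 * t) *: z] there. Once [t] is added to the ideal, [W] is a cycle of degree
   [i.+1], to which the induction applies. *)
pose W : ext n := \sum_(j < n) g j *: wedge j z.
have hW : homdeg i.+1 W by apply: homdeg_sum => j; apply/homdegZ/homdeg_wedge.
have dW : coefin (powideal M s) (kos W - (q1 * t) *: z).
  rewrite kos_sum hg scaler_suml -sumrB.
  elim/big_rec: _ => [|j y _ hy]; first exact: coefin0.
  apply: coefinD => //; rewrite kosZ -scalerA -scalerBr; apply: coefinZ => //.
  rewrite -(kos_wedge z (ltn_ord j)) opprD addrA subrr add0r; apply: coefinN => //.
  exact: coefin_wedge.
have dW' : coefin (powideal M s.+1) (kos W).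
  have iX' := powideal_ideal M s.+1.
  rewrite -(subrK ((q1 * t) *: z) (kos W)); apply: coefinD => //.
    by apply: coefin_mono dW => u; apply: powidealS.
  rewrite mulrC -scalerA.
  have ht : forall k (x : ext k), coefin (powideal M s.+1) (t *: x).
    have tX := @powideal_var M s'.
    elim=> [x|k IHk [x1 x2]] /=; last by split; apply: IHk.
    by rewrite /GRing.scale /= mulrC; case: iX' => _ _ hMu; apply: hMu.
  exact: ht.
have srn' : (s.+1 + r = n)%N by rewrite addSnnS.
have [q2 [V [uq2 hV hqV]]] := IH s.+1 srn' i.+1 W si hW dW'.
have hD : homdeg i.+1 (q2 *: W - kos V).
  by apply: homdegD; [exact: homdegZ|apply/homdegN/homdeg_kos].
have [y [hy hXy]] := coefin_lift iX (@powideal_split M s') hD hqV.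
(* Modulo the ideal [q2 *: W - kos V] is [t *: y]. Taking boundaries gives [q2 * q1 * t] times [z]
   equal to [t] times [kos y], and [t] is cancelled. *)
exists (q2 * q1), y; split => //; first exact: unit0M.
apply: (coefin_nzd (@powideal_nzd M s')).
have := coefinD iX (coefin_kos iX hXy) (coefinN iX (coefinZ iX q2 dW)).
rewrite !kosD kosN kosZ kos_kos oppr0 addr0 kosN kosZ -/t.
congr coefin; rewrite !scalerBr !scalerA opprB addrC addrA subrK.
by rewrite [t * _]mulrC mulrA.
Qed.

Fixpoint ext1 k : ext k := if k is k'.+1 then (ext1 k', 0) else 1.

Lemma homdeg_ext1 k : homdeg 0 (ext1 k).
Proof. by elim: k => [|k IH] /=; [left|split]. Qed.

Lemma kos_ext1 k : kos (ext1 k) = 0.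
Proof. by elim: k => [//|k /= ->]; rewrite scaler0 addr0 kos0 oppr0. Qed.

Lemma ext1_inj k (a b : S) : a *: ext1 k = b *: ext1 k -> a = b.
Proof.
elim: k => [|k IH] /=; first by rewrite /GRing.scale /= !mulr1.
by case=> /IH.
Qed.

Lemma homdeg0_ext1 k : forall x : ext k, homdeg 0 x -> exists a, x = a *: ext1 k.
Proof.
elim: k => [x _|k IH [x1 x2] /= [/IH [a ->] ->]].
  by exists x; rewrite /= /GRing.scale /= mulr1.
by exists a; congr (_, _); rewrite scaler0.
Qed.

Lemma kos_homdeg1 k : forall x : ext k, homdeg 1 x ->
  exists a : nat -> S, kos x = (\sum_(j < k) a j * F j) *: ext1 k.
Proof.
elim: k => [x _|k IH [x1 x2] /= [/IH [a ha] /homdeg0_ext1 [b ->]]].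
  by exists (fun=> 0); rewrite big_ord0 scale0r.
exists (fun j => if j == k then b else a j).
rewrite big_ord_recr /= eqxx ha kosZ kos_ext1 scaler0 oppr0; congr (_, _); last by rewrite scaler0.
rewrite scalerA scalerDl mulrC; congr (_ *: _ + _).
by apply: eq_bigr => j _; rewrite (ltn_eqF (ltn_ord j)).
Qed.

End Koszul.

(** * Cofinite systems are regular sequences *)

Section Systems.
Variables (n' : nat) (K : fieldType).
Local Notation n := n'.+1.
Local Notation S := (mpoly n K).
Local Notation X_ b := (@mpolyX n K b).
Implicit Types (f : 'I_n -> S).

Definition sys f : set S := sidl (range f).

Definition others f i : set S := [set f j | j in [set j | j != i]].

Definition upd f i g : 'I_n -> S := fun j => if j == i then g else f j.

Lemma range_others f i : range f = f i |` others f i.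
Proof.
apply/seteqP; split => [u [j _ <-]|u [->|[j _ <-]]]; [|by exists i|by exists j].
by have [->|ji] := eqVneq j i; [left|right; exists j].
Qed.

Lemma upd_at f i g : upd f i g i = g.
Proof. by rewrite /upd eqxx. Qed.

Lemma upd_id f i : upd f i (f i) = f.
Proof. by apply/funext => j; rewrite /upd; case: eqP => [->|]. Qed.

Lemma others_upd f i g : others (upd f i g) i = others f i.
Proof.
by apply/seteqP; split => u [j /= ji <-]; exists j => //; rewrite /upd (negbTE ji).
Qed.

Lemma sys_upd f i g : sys (upd f i g) = sidl (g |` others f i).
Proof. by rewrite /sys (range_others _ i) upd_at others_upd. Qed.

Lemma sidl_explicit (I : finType) (P : pred I) (F : I -> S) u :
  sidl [set F i | i in [set i | P i]] u ->
  exists q a, unit0 q /\ q * u = \sum_(i | P i) a i * F i.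
Proof.
apply: (@sidl_min _ _ _ [set u | exists q a, unit0 q /\ q * u = \sum_(i | P i) a i * F i]).
  split; first split.
  - exists 1, (fun=> 0); split; first exact: unit0_1.
    by rewrite mulr0 big1 // => i _; rewrite mul0r.
  - move=> v w [q [a [hq ha]]] [r [b [hr hb]]].
    exists (q * r), (fun i => r * a i + q * b i); split; first exact: unit0M.
    have -> : q * r * (v + w) = r * (q * v) + q * (r * w) by ring.
    rewrite ha hb !mulr_sumr -big_split; apply: eq_bigr => i _ /=; ring.
  - move=> c v [q [a [hq ha]]]; exists q, (fun i => c * a i); split=> //.
    by rewrite mulrCA ha mulr_sumr; apply: eq_bigr => i _; rewrite mulrA.
  - move=> r v hr [q [a [hq ha]]]; exists (q * r), a; split; first exact: unit0M.
    by rewrite -mulrA.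
move=> _ [i Pi <-]; exists 1, (fun j => (j == i)%:R); split; first exact: unit0_1.
rewrite mul1r (bigD1 i) //= eqxx mul1r big1 ?addr0 // => j /andP[_ /negbTE ->].
by rewrite mul0r.
Qed.

Lemma sidl_combination (G : set S) (I : Type) (r : seq I) (P : pred I) (a g : I -> S) :
  (forall i, P i -> sidl G (g i)) -> sidl G (\sum_(i <- r | P i) a i * g i).
Proof. by move=> h; apply: ideal_sum => // i /h; apply: sidlM. Qed.

Lemma sidl_unit (G : set S) q u : unit0 q -> sidl G (q * u) -> sidl G u.
Proof. by move=> hq; case: (sidl_satid G) => _; apply. Qed.

(** A relation expressing [f i0 * u] through the other entries is, up to a unit, a Koszul cycle of
    degree 1; being a boundary up to a unit, it puts [u] in the ideal of the others. *)
Theorem cof_sys_nzd f i0 : cof (sys f) ->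
  forall u, sidl (others f i0) (f i0 * u) -> sidl (others f i0) u.
Proof.
move=> [M hM] u /sidl_explicit [q [a [uq hq]]].
(* The Koszul recursion splits off the last generator, so a transposition moves [f i0] to the last
   place. *)
pose pi (j : 'I_n) := tperm i0 ord_max j.
pose F k := f (pi (inord k)).
have F_ord (j : 'I_n) : F j = f (pi j) by rewrite /F inord_val.
have Fn : F n' = f i0 by rewrite -[n']/(val (@ord_max n')) F_ord /pi tpermR.
have cofF : exists M, forall s : 'I_n, exists q g,
    unit0 q /\ q * powvar K M s = \sum_(j < n) g j * F j.
  exists M => s.
  have hs : sys f (powvar K M s) by apply: hM; rewrite mdegMn mdeg1 mul1n.
  have {hs} : sidl [set f i | i in [set i | xpredT i]] (powvar K M s).
    by move: hs; rewrite /sys; congr (sidl _ _); apply/seteqP; split => v [j _ <-]; exists j.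
  move=> /sidl_explicit [r [b [ur hr]]]; exists r, (fun j => b (pi j)).
  split=> //; rewrite hr (reindex_inj (@perm_inj _ (tperm i0 ord_max))) /=.
  by apply: eq_bigr => j _; rewrite F_ord.
(* For [s = 0] the auxiliary ideal is zero, and the complex itself is acyclic in degree 1, up to
   units. *)
have [M' /(_ n 0%N (add0n _) 1%N) hK] := koszul_acyclic cofF.
pose a' (k : nat) := a (pi (inord k)).
have qfu : (q * u) * f i0 = \sum_(j < n') a' j * F j.
  rewrite -mulrA [u * _]mulrC hq (reindex_inj (@perm_inj _ (tperm i0 ord_max))) /=.
  rewrite big_mkcond big_ord_recr /= tpermR eqxx addr0.
  apply: eq_bigr => j _; have -> : tperm i0 ord_max (widen_ord (leqnSn n') j) != i0.
    by rewrite -{2}(tpermR i0 ord_max) (inj_eq perm_inj) -(inj_eq val_inj) /= (ltn_eqF (ltn_ord j)).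
  have e : inord j = widen_ord (leqnSn n') j by apply/val_inj; rewrite /= inordK // ltnS ltnW.
  by rewrite /a' /F /pi e.
pose z : ext n K n := (- \sum_(j < n') a' j *: wedge j (ext1 n K n'), (q * u) *: ext1 n K n').
have hz : homdeg 1 z.
  split; last by apply/homdegZ/homdeg_ext1.
  by apply/homdegN/homdeg_sum => j; apply/homdegZ/homdeg_wedge/homdeg_ext1.
have wz j : (j < n')%N -> kos F (wedge j (ext1 n K n')) = F j *: ext1 n K n'.
  move=> ln; rewrite -(kos_wedge F (ext1 n K n') ln) kos_ext1.
  by rewrite wedge0 addr0.
have dz : kos F z = 0.
  rewrite /= kosZ kos_ext1 scaler0 oppr0; congr (_, _).
  rewrite kosN kos_sum Fn scalerA [f i0 * _]mulrC qfu scaler_suml.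
  rewrite addrC -sumrB big1 // => j _.
  by rewrite kosZ wz // scalerA subrr.
have [||q' [w [uq' hw hqw]]] := hK z _ hz _ => //.
  by rewrite dz; apply/coefin0/powideal_ideal.
have zw : q' *: z = kos F w.
  have c0 : forall k (v : ext n K k), coefin (powideal M' 0) v -> v = 0.
    elim=> [v hv|k IH [x1 x2] [h1 h2]]; last by congr (_, _); apply: IH.
    by apply/mpolyP => b; rewrite mcoeff0; apply/eqP; apply: contraT => /hv [].
  by apply/eqP; rewrite -subr_eq0; apply/eqP/c0.
have [a2 ha2] := kos_homdeg1 F (proj2 hw).
(* Comparison of the coefficients of the last generator: that of [kos w] is, up to sign, the
   boundary of a form of degree 1 in the other generators. *)
have : q' *: ((q * u) *: ext1 n K n') = - kos F w.2.
  by have := congr1 snd zw.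
rewrite ha2 scalerA -scaleNr => /ext1_inj e.
apply: (@sidl_unit _ (q' * q)); first exact: unit0M.
rewrite -mulrA e; apply: (idealN (sidl_ideal _)); apply: sidl_combination => j _.
apply: sidl_gen; exists (pi (widen_ord (leqnSn n') j)); last by rewrite -F_ord.
by rewrite /= /pi -{2}(tpermR i0 ord_max) (inj_eq perm_inj) -(inj_eq val_inj) /= (ltn_eqF (ltn_ord j)).
Qed.

End Systems.

(** * Multiplicity of a system and colength of its powers *)

Section Multiplicity.
Variables (n' : nat) (K : fieldType).
Local Notation n := n'.+1.
Local Notation S := (mpoly n K).
Local Notation X_ b := (@mpolyX n K b).
Implicit Types (f : 'I_n -> S).

(** The value is 0 by default when the codimension is infinite. *)
Definition codimn (X : set S) : nat := xget 0%N [set d | codim X d].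

Lemma codimnP X : ideal X -> cof X -> codim X (codimn X).
Proof. by move=> hX hc; have [d hd] := cof_codim hX hc; apply: (xgetPex 0%N); exists d. Qed.

Lemma codimnE X d : ideal X -> codim X d -> codimn X = d.
Proof.
move=> hX hd; apply: (codim_uniq (ideal_sspace hX) _ hd).
by apply: (xgetPex 0%N); exists d.
Qed.

Lemma leq_codimn X Y : ideal X -> ideal Y -> cof X -> X `<=` Y ->
  (codimn Y <= codimn X)%N.
Proof.
move=> hX hY cX XY; have cY := cof_sub XY cX.
exact: (leq_codim (ideal_sspace hX) (ideal_sspace hY) XY (codimnP hX cX) (codimnP hY cY)).
Qed.

Definition mult f : nat := codimn (sys f).

Lemma sys_ideal f : ideal (sys f). Proof. exact: sidl_ideal. Qed.
Hint Resolve sys_ideal : core.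

Lemma multP f : cof (sys f) -> codim (sys f) (mult f).
Proof. exact: codimnP. Qed.

Lemma split_mnm (b : multinom n) k : (k <= mdeg b)%N ->
  exists2 c, mdeg c = k & exists d, b = mnm_add c d.
Proof.
elim: k => [|k IH] hk; first by exists (@mnm0 n); [exact: mdeg0|exists b; rewrite add0m].
have [c hc [d hd]] := IH (ltnW hk).
have : d != @mnm0 n.
  by apply: contraL hk => /eqP d0; rewrite hd d0 addm0 hc ltnn.
have [i di|d0] := pickP (fun i => d i != 0%N); last first.
  by case/eqP; apply/mnmP => i; rewrite mnm0E; apply/eqP; have := d0 i; case: eqP.
move=> _; exists (mnm_add c (mnm1 i)); first by rewrite mdegD mdeg1 hc addn1.
exists (mnm_sub d (mnm1 i)); rewrite hd -addmA; congr mnm_add.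
by rewrite addmC submK // lep1mP.
Qed.

Lemma sidl_mul (G : set S) (f g u v : S) :
  sidl (f |` G) u -> sidl (g |` G) v -> sidl (f * g |` G) (u * v).
Proof.
move=> hu hv; have := hu.
apply: (sidl_min (X := [set w | sidl (f * g |` G) (w * v)])).
  split; first split => /=.
  - by rewrite mul0r; case: (sidl_ideal (f * g |` G)).
  - by move=> w1 w2 h1 h2; rewrite mulrDl; apply: sidlD.
  - by move=> a w h; rewrite -mulrA; apply: sidlM.
  - by move=> q w hq; rewrite /= -mulrA; apply: sidl_unit.
move=> w [->|Gw] /=; last by apply: sidlMr; apply: sidl_gen; right.
have := hv; apply: (sidl_min (satid_colon f (sidl_satid _))) => t [->|Gt] /=.
  by apply: sidl_gen; left.
by apply: sidlM; apply: sidl_gen; right.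
Qed.

Lemma cof_updM f i g h : cof (sys (upd f i g)) -> cof (sys (upd f i h)) ->
  cof (sys (upd f i (g * h))).
Proof.
rewrite !sys_upd => -[M1 h1] [M2 h2]; exists (M1 + M2)%N => b hb.
have [c hc [d hd]] := split_mnm (leq_trans (leq_addr M2 M1) hb).
rewrite hd mpolyXD; apply: sidl_mul; [apply: h1|apply: h2]; first by rewrite hc.
by move: hb; rewrite hd mdegD hc leq_add2l.
Qed.

(** The entry [g] is a non-zero-divisor modulo the other entries by [cof_sys_nzd], so the exact
    sequence of [codim_mul] applies. *)
Lemma mult_updM f i g h : cof (sys (upd f i g)) -> cof (sys (upd f i h)) ->
  mult (upd f i (g * h)) = (mult (upd f i g) + mult (upd f i h))%N.
Proof.
move=> cg ch; apply: codimnE => //; have cgh := cof_updM cg ch.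
have pg := multP cg; have ph := multP ch.
rewrite /mult !sys_upd in cgh pg ph *; apply: codim_mul => // u.
by have := cof_sys_nzd (i0 := i) cg (u := u); rewrite others_upd upd_at.
Qed.

Lemma sys_upd1 f i u : sys (upd f i 1) u.
Proof.
by rewrite sys_upd -[u]mulr1; apply: sidlM; apply: sidl_gen; left.
Qed.

Lemma codim_full (X : set S) : (forall u, X u) -> codim X 0.
Proof. by move=> hX; exists (fun=> 0); split => [u|c _ []//]; exists (fun=> 0); apply: hX. Qed.

Lemma mult_upd1 f i : mult (upd f i 1) = 0%N.
Proof. by apply: codimnE => //; apply: codim_full => u; apply: sys_upd1. Qed.

Lemma cof_upd1 f i : cof (sys (upd f i 1)).
Proof. by exists 0%N => b _; apply: sys_upd1. Qed.

Lemma cof_updX f i g N : cof (sys (upd f i g)) -> cof (sys (upd f i (g ^+ N))).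
Proof.
move=> h; elim: N => [|N IH]; first exact: cof_upd1.
by rewrite exprS; apply: cof_updM.
Qed.

Lemma mult_updX f i g N : cof (sys (upd f i g)) ->
  mult (upd f i (g ^+ N)) = (N * mult (upd f i g))%N.
Proof.
move=> h; elim: N => [|N IH]; first exact: mult_upd1.
by rewrite exprS mult_updM ?IH ?mulSn //; apply: cof_updX.
Qed.

(** The entries are replaced by their powers one at a time, each replacement multiplying the
    multiplicity by [N]. *)
Lemma mult_box f N : cof (sys f) ->
  cof (sys (fun i => f i ^+ N)) /\ mult (fun i => f i ^+ N) = (N ^ n * mult f)%N.
Proof.
move=> cf; pose ft t (i : 'I_n) : S := if (i < t)%N then f i ^+ N else f i.
have key t : (t <= n)%N -> cof (sys (ft t)) /\ mult (ft t) = (N ^ t * mult f)%N.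
  elim: t => [_|t IH lt]; first by rewrite mul1n.
  have [c e] := IH (ltnW lt); pose i : 'I_n := Ordinal lt.
  have fti : ft t = upd (ft t) i (f i).
    by apply/funext => j; rewrite /upd; case: eqP => // ->; rewrite /ft ltnn.
  have -> : ft t.+1 = upd (ft t) i (f i ^+ N).
    apply/funext => j; rewrite /upd /ft ltnS leq_eqVlt.
    by have [->|ji] := eqVneq j i; [rewrite eqxx|rewrite -(inj_eq val_inj) /= in ji; rewrite (negbTE ji)].
  rewrite fti in c e; split; first exact: cof_updX.
  by rewrite mult_updX // e mulnA expnS.
have [] := key n (leqnn n); suff -> : ft n = fun i => f i ^+ N by [].
by apply/funext => j; rewrite /ft ltn_ord.
Qed.

Definition fmon f (al : 'I_n -> nat) : S := \prod_i f i ^+ al i.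

(** Up to units at the origin, the [N]-th power of the ideal of the system. *)
Definition powsys f N : set S :=
  sidl [set fmon f al | al in [set al | (N <= \sum_i al i)%N]].

Lemma fmon_mul f al i : f i * fmon f al = fmon f (fun j => (al j + (j == i))%N).
Proof.
rewrite /fmon [in RHS](bigD1 i) //= eqxx addn1 exprS -mulrA; congr (_ * _).
rewrite (bigD1 i) //=; congr (_ * _); apply: eq_bigr => j /negbTE ->.
by rewrite addn0.
Qed.

(** The ideal quotient of [X] by each [g] contains [sys f], so removing one [g] raises the
    codimension by at most [mult f]. *)
Lemma codim_level (X : set S) f (gs : seq S) d : ideal X -> cof X -> cof (sys f) ->
  (forall g i, g \in gs -> X (g * f i)) ->
  codim (sidl (X `|` [set g | g \in gs])) d ->
  exists2 e, (e <= size gs * mult f + d)%N & codim X e.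
Proof.
move=> hX cX cf; elim: gs X hX cX => [|g gs IH] X hX cX hg hd.
  exists d => //; suff <- : sidl (X `|` [set g | g \in [::]]) = X by [].
  rewrite -[RHS](sidl_idem (ideal_cof_satid hX cX)).
  by congr sidl; apply/seteqP; split => [u [|]|u] //; left.
pose X' := sidl (g |` X).
have XX' : X `<=` X' by move=> u Xu; apply: sidl_gen; right.
have [e he hX'] : exists2 e, (e <= size gs * mult f + d)%N & codim X' e.
  apply: IH => //; first exact: sidl_ideal.
  - exact: cof_sub cX.
  - by move=> h i hh; apply: XX'; apply: hg; rewrite inE hh orbT.
  suff -> : sidl (X' `|` [set g | g \in gs]) = sidl (X `|` [set h | h \in g :: gs]) by [].
  apply/seteqP; split; apply: sidl_sub => u.
    case=> [|ug]; last by apply: sidl_gen; right; rewrite /= inE ug orbT.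
    apply: sidl_sub => v [->|Xv]; first by apply: sidl_gen; right; rewrite /= inE eqxx.
    by apply: sidl_gen; left.
  case=> [Xu|]; first by apply: sidl_gen; left; apply: XX'.
  rewrite /= inE => /predU1P[->|ug]; last by apply: sidl_gen; right.
  by apply: sidl_gen; left; apply: sidl_gen; left.
have hZ u : sys f u -> X (g * u).
  apply: (sidl_min (satid_colon g (ideal_cof_satid hX cX))) => _ [i _ <-] /=.
  by apply: hg; rewrite inE eqxx.
have [e' he' hX''] := codim_step hX cX hZ (multP cf) hX'.
by exists e' => //; rewrite /= mulSn -addnA (leq_trans he') // leq_add2l.
Qed.

Section Staircase.
Variables (f : 'I_n -> S) (B : nat).
Hypothesis cf : cof (sys f).

Definition boxdeg (al : {ffun 'I_n -> 'I_B}) : nat := \sum_i al i.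

(** Interpolates between the unit ideal and the ideal of the [B]-th powers: the monomials in [f]
    with exponents below [B] are kept only from degree [d] on. *)
Definition stair d : set S :=
  sidl (range (fun i => f i ^+ B) `|`
        [set fmon f al | al in [set al | exists2 be : {ffun 'I_n -> 'I_B},
           (d <= boxdeg be)%N & al = (fun i => be i : nat)]]).

Lemma stair_box d : sys (fun i => f i ^+ B) `<=` stair d.
Proof. by apply: sidl_sub => u hu; apply: sidl_gen; left. Qed.

Lemma cof_stair d : cof (stair d).
Proof. by have [c _] := mult_box B cf; apply: cof_sub c; apply: stair_box. Qed.

Lemma stair_mem d (al : {ffun 'I_n -> 'I_B}) : (d <= boxdeg al)%N -> stair d (fmon f (fun i => al i)).
Proof. by move=> h; apply: sidl_gen; right; exists (fun i => al i) => //; exists al. Qed.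

Lemma stair_mem_any d (al : 'I_n -> nat) : (d <= \sum_i al i)%N -> stair d (fmon f al).
Proof.
move=> hd; have [/forallP aB|] := boolP [forall i, (al i < B)%N].
  have e : al = fun i => [ffun i => Ordinal (aB i)] i :> nat.
    by apply/funext => i; rewrite ffunE.
  rewrite e; apply: stair_mem; apply: (leq_trans hd); rewrite /boxdeg.
  by apply: leq_sum => i _; rewrite ffunE.
move=> /forallPn [k]; rewrite -leqNgt => Bi.
rewrite /fmon (bigD1 k) //= -(subnK Bi) exprD mulrAC; apply: sidlM.
by apply: sidl_gen; left; exists k.
Qed.

Lemma codim_stairS d e : codim (stair d) e ->
  exists2 e', (e' <= #|[set al | boxdeg al == d]%SET| * mult f + e)%N & codim (stair d.+1) e'.
Proof.
move=> he; pose gs := [seq fmon f (fun i => (al : {ffun 'I_n -> 'I_B}) i : nat) |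
  al <- enum [set al : {ffun 'I_n -> 'I_B} | boxdeg al == d]%SET].
have -> : #|[set al | boxdeg al == d]%SET| = size gs by rewrite size_map cardE.
apply: codim_level => //; first exact: sidl_ideal.
- exact: cof_stair.
- move=> g i /mapP [al]; rewrite mem_enum inE => /eqP ald ->.
  rewrite mulrC fmon_mul; apply: stair_mem_any.
  rewrite big_split /= -/(boxdeg al) ald (bigD1 i) //= eqxx.
  by rewrite -addn1 leq_add2l leq_addr.
suff -> : sidl (stair d.+1 `|` [set g | g \in gs]) = stair d by [].
apply/seteqP; split; apply: sidl_sub => u.
  case=> [|/mapP [al]]; last first.
    by rewrite mem_enum inE => /eqP ald ->; apply: stair_mem; rewrite ald.
  apply: sidl_sub => v [hv|[_ [al ald ->] <-]]; first by apply: sidl_gen; left.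
  by apply: stair_mem; apply: ltnW.
case=> [hu|[_ [al ald ->] <-]]; first by apply: sidl_gen; left; apply: sidl_gen; left.
have [ed|ne] := eqVneq (boxdeg al) d.
  by apply: sidl_gen; right; apply/mapP; exists al => //; rewrite mem_enum inE; apply/eqP.
by apply: sidl_gen; left; apply: stair_mem; rewrite ltn_neqAle eq_sym ne.
Qed.

Lemma codim_stair_le d k : (codimn (stair (d + k)) <=
  #|[set al | (d <= boxdeg al < d + k)%N]%SET| * mult f + codimn (stair d))%N.
Proof.
elim: k => [|k IH]; first by rewrite addn0 leq_addl.
have [e he hc] := codim_stairS (codimnP (sidl_ideal _) (cof_stair (d + k))).
rewrite addnS (codimnE (sidl_ideal _) hc) (leq_trans he) //.
have -> : [set al | (d <= boxdeg al < (d + k).+1)%N]%SET =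
  ([set al | boxdeg al == d + k]%N :|: [set al | (d <= boxdeg al < d + k)%N])%SET.
  by apply/setP => al; rewrite !inE; move: (boxdeg al) => x; lia.
rewrite cardsU (_ : (_ :&: _)%SET = finset.set0) ?cards0 ?subn0; last first.
  by apply/setP => al; rewrite !inE; case: eqP => [->|] //=; rewrite ltnn andbF.
by rewrite mulnDl -addnA leq_add2l.
Qed.

(** On the way from the unit ideal to the ideal of the [B]-th powers, each of the [B ^ n] box
    monomials costs at most [mult f], while the total is [B ^ n * mult f] by [mult_box]. Hence every
    intermediate bound is an equality. *)
Lemma codim_stair d : (0 < B)%N ->
  codimn (stair d) = (#|[set al | (boxdeg al < d)%N]%SET| * mult f)%N.
Proof.
move=> B0; have s0 : codimn (stair 0) = 0%N.
  apply: codimnE (sidl_ideal _) (codim_full _) => u; rewrite -[u]mulr1; apply: sidlM.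
  rewrite (_ : 1 = fmon f (fun i => [ffun=> Ordinal B0] i : nat)); first exact: stair_mem.
  by rewrite /fmon big1 // => i _; rewrite ffunE.
have up : (codimn (stair d) <= #|[set al | (boxdeg al < d)%N]%SET| * mult f)%N.
  by have := codim_stair_le 0 d; rewrite s0 addn0 add0n.
apply/eqP; rewrite eqn_leq up /=.
(* No box monomial has degree above [n * B], so at [d + k.+1] only the [B]-th powers are left. *)
pose k := (n * B)%N; have lek (al : {ffun 'I_n -> 'I_B}) : (boxdeg al < d + k.+1)%N.
  rewrite addnS ltnS (leq_trans _ (leq_addl _ _)) //.
  rewrite /k -[X in (X * _)%N]card_ord -sum_nat_const; apply: leq_sum => i _.
  by rewrite ltnW.
have := codim_stair_le d k.+1.
have -> : codimn (stair (d + k.+1)) = (B ^ n * mult f)%N.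
  have [c e] := mult_box B cf; rewrite -e /mult; congr codimn.
  apply/seteqP; split; last exact: stair_box.
  apply: sidl_sub => u [hu|[_ [al h ->] _]]; first exact: sidl_gen.
  by move: h; rewrite leqNgt lek.
have -> : (B ^ n = #|[set al | (boxdeg al < d)%N]%SET| +
    #|[set al | (d <= boxdeg al < d + k.+1)%N]%SET|)%N.
  have -> : (B ^ n)%N = #|{: {ffun 'I_n -> 'I_B}}| by rewrite card_ffun !card_ord.
  rewrite -cardsT -(cardsID [set al | (boxdeg al < d)%N]%SET) finset.setTI.
  congr (_ + _)%N; apply: eq_card => al; rewrite !inE; have := lek al; move: (boxdeg al) => x; lia.
by rewrite mulnDl addnC leq_add2l.
Qed.

End Staircase.

(** The pure powers [f i ^+ N.+1] already belong to the [N.+1]-st power, which is thus a staircase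
    in the box of side [N.+1]; the binomial counts the exponents of total degree at most [N]. *)
Lemma codim_powsys f N : cof (sys f) -> codimn (powsys f N.+1) = ('C(n + N, n) * mult f)%N.
Proof.
move=> cf; have -> : powsys f N.+1 = stair f N.+1 N.+1.
  apply/seteqP; split; apply: sidl_sub => u.
    by case=> al hal <-; apply: stair_mem_any.
  case=> [[i _ <-]|[_ [al ald ->] <-]]; last by apply: sidl_gen; exists (fun i => al i).
  apply: sidl_gen; exists (fun j => if j == i then N.+1 else 0%N).
    by rewrite /= (bigD1 i) //= eqxx leq_addr.
  by rewrite /fmon (bigD1 i) //= eqxx big1 ?mulr1 // => j /negbTE ->.
rewrite codim_stair // -card_partial_ord_partitions; congr (_ * _)%N.
pose g (al : {ffun 'I_n -> 'I_N.+1}) := [tuple al i | i < n].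
have g_inj : injective g.
  by move=> al be e; apply/ffunP => i; have := congr1 (fun t => tnth t i) e; rewrite !tnth_mktuple.
rewrite -(card_imset _ g_inj); congr #|pred_of_set _|; apply/setP => t; rewrite inE.
have tE (al : {ffun 'I_n -> 'I_N.+1}) : (\sum_(i <- g al) i = boxdeg al)%N.
  by rewrite big_tuple; apply: eq_bigr => i _; rewrite tnth_mktuple.
apply/imsetP/idP => [[al]|ht].
  by rewrite inE ltnS -tE => h ->.
have te : t = g [ffun i => tnth t i].
  by apply: eq_from_tnth => i; rewrite tnth_mktuple ffunE.
by exists [ffun i => tnth t i]; rewrite // inE ltnS -tE -te.
Qed.

End Multiplicity.

(** * Products of monomial ideals *)

Section MonomialIdeals.
Variables (n : nat) (K : fieldType) (A : 'I_n -> {fset multinom n}).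
Local Notation S := (mpoly n K).
Local Notation X_ b := (@mpolyX n K b).
Local Notation T := (coef_index A).

(* [x^b] lies in the product over [j] in [L] of the ideals of the [x^a], [a] in [A j]. *)
Fixpoint mon (L : seq 'I_n) (b : multinom n) : Prop :=
  if L is j :: L' then exists2 a, a \in A j & mpoly.lem a b /\ mon L' (mnm_sub b a)
  else True.

Definition monideal L : set S := [set u | forall b, mcoeff b u != 0 -> mon L b].

Definition texp (t : T) : multinom n := val (tagged t).

(** A function [de] is a decomposition that takes [de t] copies of the exponent [t]: [dsum] is the
    exponent of the product, [ddeg] the number of factors from one support. *)
Definition dsum (de : T -> nat) (i : 'I_n) : nat := (\sum_t de t * texp t i)%N.

Definition ddeg (de : T -> nat) (j : 'I_n) : nat := (\sum_(t | tag t == j) de t)%N.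

Lemma texpP t : texp t \in A (tag t).
Proof. exact: valP. Qed.

Lemma texp_inj t t' : tag t = tag t' -> texp t = texp t' -> t = t'.
Proof.
case: t t' => [j a] [j' a'] /= e; case: _ / e a' => a'.
by rewrite /texp /= => /val_inj ->.
Qed.

Lemma dsum_pos de t i : (0 < de t)%N -> (texp t i <= dsum de i)%N.
Proof.
move=> h; rewrite /dsum (bigD1 t) //= (leq_trans _ (leq_addr _ _)) //.
by rewrite leq_pmull.
Qed.

Lemma dsum_add de t i : dsum (fun t' => de t' + (t' == t))%N i = (dsum de i + texp t i)%N.
Proof.
rewrite /dsum (eq_bigr (fun t' => de t' * texp t' i + (t' == t) * texp t' i)%N); last first.
  by move=> t' _; rewrite mulnDl.
rewrite big_split /=; congr addn; rewrite (bigD1 t) //= eqxx mul1n big1 ?addn0 //.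
by move=> t' /negbTE ->.
Qed.

Lemma ddeg_add de t j : ddeg (fun t' => de t' + (t' == t))%N j = (ddeg de j + (tag t == j))%N.
Proof.
rewrite /ddeg big_split /=; congr addn; case: eqP => [tj|/eqP tj].
  rewrite (bigD1 t) ?tj //= eqxx big1 // => t' /andP[_ /negbTE -> //].
rewrite big1 // => t' /eqP tj'; case: eqP => // tt.
by move: tj; rewrite -tt tj' eqxx.
Qed.

Lemma dsum_sub de t i : (0 < de t)%N ->
  dsum (fun t' => de t' - (t' == t))%N i = (dsum de i - texp t i)%N.
Proof.
move=> h; apply/eqP; rewrite -(eqn_add2r (texp t i)) subnK ?dsum_pos // -dsum_add.
apply/eqP/eq_bigr => t' _; congr (_ * _)%N.
by rewrite subnK //; case: eqP => // ->.
Qed.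

Lemma ddeg_sub de t j : (0 < de t)%N ->
  ddeg (fun t' => de t' - (t' == t))%N j = (ddeg de j - (tag t == j))%N.
Proof.
move=> h; apply/eqP; rewrite -(eqn_add2r (tag t == j)) subnK; last first.
  by case: eqP => // <-; rewrite /ddeg (bigD1 t) //= (leq_trans h) ?leq_addr.
rewrite -ddeg_add; apply/eqP/eq_bigr => t' _.
by rewrite subnK //; case: eqP => // ->.
Qed.

Lemma mon_decomp L b : mon L b -> exists de : T -> nat,
  (forall j, ddeg de j = count_mem j L) /\ (forall i, (dsum de i <= b i)%N).
Proof.
elim: L b => [|j L IH] b /=.
  by move=> _; exists (fun=> 0%N); split => k; rewrite /ddeg /dsum big1 // => t _; rewrite mul0n.
move=> [a aj [ab /IH [de [h1 h2]]]].
pose t : T := Tagged (fun j => A j) [` aj]%fset.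
exists (fun t' => de t' + (t' == t))%N; split => [k|k].
  by rewrite ddeg_add h1 addnC.
rewrite dsum_add; have := h2 k; rewrite mnmBE /texp /= => h.
by have := mnm_lepP ab k; lia.
Qed.

Lemma monP L b : mon L b <-> exists de : T -> nat,
  (forall j, (count_mem j L <= ddeg de j)%N) /\ (forall i, (dsum de i <= b i)%N).
Proof.
split=> [/mon_decomp [de [h1 h2]]|]; first by exists de; split => // j; rewrite h1.
elim: L b => [//|j L IH] b /= [de [h1 h2]].
have [t /andP[/eqP tj dt]|no] := pickP (fun t => (tag t == j) && (0 < de t)%N); last first.
  have := h1 j; rewrite eqxx /ddeg big1 // => t tj.
  by have := no t; rewrite tj /=; case: (de t).
exists (texp t); first by rewrite -tj; apply: texpP.
have hle i : (texp t i <= b i)%N by apply: leq_trans (h2 i); apply: dsum_pos.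
split; first exact/mnm_lepP.
apply: IH; exists (fun t' => de t' - (t' == t))%N; split => [k|k].
  rewrite ddeg_sub // tj; have := h1 k.
  by case: (j == k) => /= h; lia.
by rewrite dsum_sub // mnmBE leq_sub2r.
Qed.

Lemma mon_count L L' b : (forall j, (count_mem j L' <= count_mem j L)%N) ->
  mon L b -> mon L' b.
Proof.
move=> h /monP [de [h1 h2]]; apply/monP; exists de; split => // j.
exact: leq_trans (h j) (h1 j).
Qed.

Lemma mon_perm L L' b : perm_eq L L' -> mon L b -> mon L' b.
Proof.
by move=> pL; apply: mon_count => j; move/seq.permP: pL => ->.
Qed.

Lemma mon_le L b b' : mpoly.lem b b' -> mon L b -> mon L b'.
Proof.
move=> hb /monP [de [h1 h2]]; apply/monP; exists de; split => // i.
by apply: leq_trans (h2 i) _; apply/mnm_lepP.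
Qed.

Lemma mon_addl L b c : mon L b -> mon L (mnm_add c b).
Proof. by apply: mon_le; apply: lem_addl. Qed.

Lemma mon_cat L1 L2 b1 b2 : mon L1 b1 -> mon L2 b2 -> mon (L1 ++ L2) (mnm_add b1 b2).
Proof.
elim: L1 b1 => [|j L IH] b1 /=; first by move=> _; apply: mon_addl.
move=> [a aj [ab h]] h2; exists a => //; split.
  exact: lepm_trans ab (lem_addr _ _).
by rewrite addmC -addmBA // addmC; apply: IH.
Qed.

Lemma mon_catE L1 L2 b : mon (L1 ++ L2) b ->
  exists b1 b2, [/\ b = mnm_add b1 b2, mon L1 b1 & mon L2 b2].
Proof.
elim: L1 b => [|j L IH] b /=; first by move=> h; exists (@mnm0 n), b; rewrite add0m.
move=> [a aj [ab /IH [b1 [b2 [e h1 h2]]]]]; exists (mnm_add a b1), b2; split => //.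
  by rewrite -addmA -e addmC submK.
exists a => //; split; first exact: lem_addr.
by rewrite addmC addmK.
Qed.

Lemma monideal_ideal L : ideal (monideal L).
Proof.
split.
- by move=> b; rewrite mcoeff0 eqxx.
- move=> u v hu hv b; rewrite mcoeffD; have [->|nz _] := eqVneq (mcoeff b u) 0.
    by rewrite add0r; apply: hv.
  exact: hu.
- move=> a u hu b; rewrite -mcoeff_msupp => /msuppM_le /allpairsP [[m1 m2] /=].
  rewrite !mcoeff_msupp => -[_ /hu h ->]; exact: mon_addl.
Qed.
Hint Resolve monideal_ideal : core.

Lemma monidealX L b : mon L b -> monideal L (X_ b).
Proof.
move=> h c; rewrite mcoeffX; have [<- //|_] := eqVneq b c.
by rewrite eqxx.
Qed.

Lemma monideal_gen L (X : set S) u : ideal X -> (forall b, mon L b -> X (X_ b)) ->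
  monideal L u -> X u.
Proof.
move=> hX h hu; rewrite (mpolyE u) big_seq; apply: ideal_sum => // b.
rewrite mcoeff_msupp => /hu /h; exact: sspaceZ (ideal_sspace hX).
Qed.

Lemma monideal_count L L' u : (forall j, (count_mem j L' <= count_mem j L)%N) ->
  monideal L u -> monideal L' u.
Proof. by move=> h hu b /hu; apply: mon_count. Qed.

Lemma monideal_perm L L' u : perm_eq L L' -> monideal L u -> monideal L' u.
Proof. by move=> h hu b /hu; apply: mon_perm. Qed.

Lemma monidealM L1 L2 u v : monideal L1 u -> monideal L2 v -> monideal (L1 ++ L2) (u * v).
Proof.
move=> hu hv b; rewrite -mcoeff_msupp => /msuppM_le /allpairsP [[m1 m2] /=].
rewrite !mcoeff_msupp => -[/hu h1 /hv h2 ->]; exact: mon_cat.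
Qed.

Definition spoly (c : T -> K) (j : 'I_n) : S :=
  \sum_(a : A j) c (Tagged (fun j => A j) a) *: X_ (val a).

Lemma monideal_spoly (c : T -> K) j : monideal [:: j] (spoly c j).
Proof.
apply: (@ideal_sum _ _ (monideal [:: j])) => // a _.
apply: (@sspaceZ _ _ (monideal [:: j])); first exact: ideal_sspace.
apply: monidealX; exists (val a); first exact: valP.
by split => //; apply: lepm_refl.
Qed.

Hypothesis H3 : forall i j, exists2 mu : nat,
  (0 < mu)%N & mnm_muln (mnm1 i) mu \in A j.

Lemma mon_cof L : exists M, forall b, (M <= mdeg b)%N -> mon L b.
Proof.
elim: L => [|j L [M hM]]; first by exists 0%N.
have /choice [mu hmu] : forall i, exists mu : nat, (0 < mu)%N /\ mnm_muln (mnm1 i) mu \in A j.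
  by move=> i; have [mu ? ?] := H3 i j; exists mu.
(* If all coordinates are at most [m], the degree is at most [n * m]. Otherwise one pure power is
   divided out, at a cost of at most [m], which leaves degree at least [M] for [L]. *)
pose m := (\max_i mu i)%N; exists (M + m + n * m)%N => b hb.
have [k hk|small] := pickP (fun i => (m < b i)%N); last first.
  have : (mdeg b <= n * m)%N.
    rewrite mdegE -[X in (X * _)%N]card_ord -sum_nat_const; apply: leq_sum => i _.
    by rewrite leqNgt small.
  have [hmu0 _] := hmu j; have : (mu j <= m)%N := leq_bigmax j (F := mu).
  by lia.
have [mu0 amu] := hmu k; exists (mnm_muln (mnm1 k) (mu k)) => //.
have muk : (mu k <= m)%N := leq_bigmax k (F := mu).
have le : mpoly.lem (mnm_muln (mnm1 k) (mu k)) b.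
  apply/mnm_lepP => i; rewrite mulmnE mnm1E; case: eqP => [<-|_]; last by rewrite mul0n.
  by rewrite mul1n (leq_trans muk) // ltnW.
split => //; apply: hM.
have := congr1 (@mdeg n) (submK le); rewrite mdegD mdegMn mdeg1 mul1n => h.
by lia.
Qed.

Lemma monideal_cof L : cof (monideal L).
Proof. by have [M hM] := mon_cof L; exists M => b /hM; apply: monidealX. Qed.

Lemma monideal_satid L : satid (monideal L).
Proof. by apply: ideal_cof_satid => //; apply: monideal_cof. Qed.

End MonomialIdeals.

Lemma mon_comp n (A : 'I_n -> {fset multinom n}) (sg : 'I_n -> 'I_n) L b :
  mon (fun i => A (sg i)) L b <-> mon A (map sg L) b.
Proof.
elim: L b => [|j L IH] b //=.
by split=> -[a aj [ab /IH h]]; exists a.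
Qed.

Lemma monideal_comp n (K : fieldType) (A : 'I_n -> {fset multinom n}) (sg : 'I_n -> 'I_n) L :
  @monideal n K (fun i => A (sg i)) L = monideal A (map sg L).
Proof.
apply/seteqP; split => u hu b nz; first exact: (iffLR (mon_comp A sg L b) (hu b nz)).
exact: (iffRL (mon_comp A sg L b) (hu b nz)).
Qed.

(** For a matrix whose rows are differences of two exponents, one per support, this provides a
    non-zero integral combination that either vanishes or lowers the first coordinate alone. *)
Lemma int_relation n' (U : 'M[int]_n'.+1) :
  exists (m : 'rV[int]_n'.+1) (d : nat), m != 0 /\ m *m U = (- d%:Z) *: delta_mx 0 ord0.
Proof.
have [detU|detU] := eqVneq (\det U) 0; last first.
  (* Invertible case: the first row of the adjugate, with the sign that makes the result
     non-positive. *)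
  exists (- sgz (\det U) *: row 0 (\adj U)), `|\det U|%N.
  have e : (- sgz (\det U) *: row 0 (\adj U)) *m U = (- `|\det U|%N%:Z) *: delta_mx 0 ord0.
    rewrite -scalemxAl -row_mul mul_adj_mx rowE mul_mx_scalar scalerA mulNr -abszEsg.
    by [].
  split=> //; apply: contraNneq detU => m0; move: e; rewrite m0 mul0mx => /rowP /(_ ord0).
  by rewrite !mxE eqxx mulr1 => /eqP; rewrite eq_sym oppr_eq0 -absz_eq0 absz_nat absz_eq0.
have : \det (map_mx intr U : 'M[rat]_n'.+1) == 0 by rewrite det_map_mx detU.
(* Singular case: a rational kernel vector with its denominators cleared, and [d = 0]. *)
move=> /det0P [v v0 vU]; pose D := \prod_k denq (v 0 k).
have D0 : D != 0 by apply/prodf_neq0 => k _; rewrite denq_eq0.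
pose m : 'rV[int]_n'.+1 := \row_j (numq (v 0 j) * \prod_(k | k != j) denq (v 0 k)).
have mv : map_mx intr m = D%:~R *: v :> 'rV[rat]_n'.+1.
  apply/rowP => j; rewrite !mxE /D [in RHS](bigD1 j) //= !intrM numqE.
  by ring.
exists m, 0%N; split.
  apply: contraNneq v0 => m0; move: mv; rewrite m0 map_mx0 => /esym/eqP.
  by rewrite scaler_eq0 intr_eq0 (negbTE D0).
have mU0 : map_mx intr (m *m U) = 0 :> 'rV[rat]_n'.+1.
  by rewrite map_mxM mv -scalemxAl vU scaler0.
apply/rowP => j; move/rowP: mU0 => /(_ j); rewrite oppr0 scale0r mxE [RHS]mxE => /eqP.
by rewrite intr_eq0 => /eqP ->; rewrite mxE.
Qed.

(** * Optimal decompositions of the minimal generators *)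

Section Decompositions.
Variables (n' : nat) (B : 'I_n'.+1 -> {fset multinom n'.+1}).
Local Notation n := n'.+1.
Local Notation T := (coef_index B).
Hypothesis B_ne : forall j, exists t : T, tag t = j.
Variables (Lb Kd : nat).

(** One bound for all choices of two exponents per support: transferring [m j] copies from [al j] to
    [be j], backwards when [m j] is negative, lowers the sum by [d] in the first coordinate and
    changes no other. *)
Definition relbound := forall al be : {ffun 'I_n -> T},
  exists (m : 'rV[int]_n) (d : nat), [/\ m != 0, forall j, (`|m 0%R j| <= Lb)%N &
    forall i, \sum_j m 0 j * ((texp (be j) i)%:Z - (texp (al j) i)%:Z) = - (d * (i == ord0))%N%:Z].

Hypothesis hLb : relbound.

(** Multiplicities are at most [Kd], so they are digits in base [Kd.+1] and the total weight
    determines the decomposition. *)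
Definition wt (t : T) : nat := (Kd.+1 ^ enum_rank t)%N.

Local Notation dec := {ffun T -> 'I_Kd.+1}.
Implicit Types (de ga : dec).

Definition isdec de := [forall j, ddeg (fun t => de t : nat) j == Kd].

Definition dws (f : T -> nat) : nat := (\sum_t f t * wt t)%N.

Definition below de de' := [forall i, dsum (fun t => de t : nat) i <= dsum (fun t => de' t : nat) i]%N.

(** The sum is a minimal generator of the product of the [Kd]-th powers, and the weight is least
    among its decompositions. By [opt_uniq] each minimal generator has a single optimal
    decomposition. *)
Definition isopt de := isdec de && [forall de' : dec,
  isdec de' && below de' de ==> below de de' && (dws (fun t => de t : nat) <= dws (fun t => de' t : nat))%N].

Lemma dws_inj de de' : dws (fun t => de t : nat) = dws (fun t => de' t : nat) -> de = de'.
Proof.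
have key : forall r (f g : nat -> nat), (forall i, f i <= Kd)%N -> (forall i, g i <= Kd)%N ->
    (\sum_(i < r) f i * Kd.+1 ^ i = \sum_(i < r) g i * Kd.+1 ^ i)%N ->
    forall i, (i < r)%N -> f i = g i.
  elim=> [//|r IH] f g hf hg; rewrite !big_ord_recl /= !expn0 !muln1.
  have shift (h : nat -> nat) : (\sum_(i < r) h (bump 0 i) * Kd.+1 ^ bump 0 i =
      (\sum_(i < r) h i.+1 * Kd.+1 ^ i) * Kd.+1)%N.
    by rewrite big_distrl; apply: eq_bigr => i _; rewrite /bump /= add1n expnSr mulnA.
  rewrite !shift => e.
  have e0 : f 0%N = g 0%N.
    have := congr1 (fun x => x %% Kd.+1)%N e.
    by rewrite /= ![(_ + _ * Kd.+1)%N]addnC !modnMDl !modn_small // ltnS.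
  have e1 : (\sum_(i < r) f i.+1 * Kd.+1 ^ i = \sum_(i < r) g i.+1 * Kd.+1 ^ i)%N.
    by move/eqP: e; rewrite e0 eqn_add2l eqn_pmul2r // => /eqP.
  case=> [|i] ir //.
  exact: (IH (fun i => f i.+1) (fun i => g i.+1) (fun i => hf i.+1) (fun i => hg i.+1) e1).
move=> e; apply/ffunP => t; apply: val_inj.
have toord (d : dec) : dws (fun t => d t : nat) =
    (\sum_(i < #|T|) d (enum_val i) * Kd.+1 ^ i)%N.
  rewrite /dws (reindex (@enum_val _ (mem T))) /=; last first.
    by apply: onW_bij; exact: enum_val_bij.
  by apply: eq_bigr => i _; rewrite /wt enum_valK.
pose ex (d : dec) (i : nat) : nat := if insub i is Some k then d (enum_val (k : 'I_#|T|)) else 0%N.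
have exE (d : dec) (i : 'I_#|T|) : ex d i = d (enum_val i) by rewrite /ex valK.
have exK (d : dec) i : (ex d i <= Kd)%N by rewrite /ex; case: insub => // k; rewrite -ltnS.
have := key #|T| (ex de) (ex de') (exK de) (exK de').
rewrite (eq_bigr (fun i : 'I__ => de (enum_val i) * Kd.+1 ^ i)%N) => [|i _]; last by rewrite exE.
rewrite [X in _ = X -> _](eq_bigr (fun i : 'I__ => de' (enum_val i) * Kd.+1 ^ i)%N) => [|i _]; last by rewrite exE.
by rewrite -!toord => /(_ e) /(_ (enum_rank t) (ltn_ord _)); rewrite !exE enum_rankK.
Qed.

Definition ofn (f : T -> nat) : dec := [ffun t => inord (f t)].

Lemma ofnE f : (forall j, ddeg f j = Kd) -> (fun t => ofn f t : nat) = f.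
Proof.
move=> h; apply/funext => t; rewrite ffunE inordK // ltnS -(h (tag t)) /ddeg.
by rewrite (bigD1 t) //= leq_addr.
Qed.

Lemma below_refl de : below de de. Proof. by apply/forallP => i. Qed.

Lemma below_trans d1 d2 d3 : below d1 d2 -> below d2 d3 -> below d1 d3.
Proof.
by move=> /forallP h1 /forallP h2; apply/forallP => i; apply: leq_trans (h1 i) (h2 i).
Qed.

Lemma opt_below de : isdec de -> exists2 ga, isopt ga & below ga de.
Proof.
move=> hde; pose size d := (\sum_i dsum (fun t => (d : dec) t : nat) i)%N.
pose W d := dws (fun t => (d : dec) t : nat).
pose BIG := (\max_(d : dec) W d).+1.
have WB d : (W d < BIG)%N by rewrite ltnS; apply: (leq_bigmax (F := W)).
pose P (d : dec) := isdec d && below d de.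
have P0 : P de by rewrite /P hde below_refl.
(* Lexicographic minimum of total degree and then weight, coded in one number because [BIG] exceeds
   every weight. *)
case: (@arg_minnP dec de P (fun d : dec => size d * BIG + W d)%N P0) => ga /andP[dga bga] hmin.
exists ga => //; rewrite /isopt dga; apply/forallP => de'; apply/implyP => /andP[dde' bde'].
have := hmin de'; rewrite /P dde' (below_trans bde' bga) => /(_ isT) hle.
have hs : (size de' <= size ga)%N by apply: leq_sum => i _; move/forallP: bde'.
have hb : below ga de'.
  apply/forallP => i; rewrite leqNgt; apply/negP => hi.
  have lt : (size de' < size ga)%N.
    rewrite /size (bigD1 i) //= [X in (_ < X)%N](bigD1 i) //= -addSn leq_add //.
    by apply: leq_sum => k _; move/forallP: bde'.
  have := WB de'; nia.
rewrite hb /=; have hs' : (size ga <= size de')%N by apply: leq_sum => i _; move/forallP: hb.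
have e : size ga = size de' by apply/eqP; rewrite eqn_leq hs hs'.
by move: hle; rewrite e leq_add2l /W.
Qed.

Lemma opt_uniq ga ga' : isopt ga -> isopt ga' -> below ga' ga -> ga = ga'.
Proof.
move=> /andP[d1 /forallP /(_ ga') h1] /andP[d2 /forallP /(_ ga) h2] b.
move: h1; rewrite d2 b /= => /andP[b' w1]; move: h2; rewrite d1 b' /= => /andP[_ w2].
by apply: dws_inj; apply/eqP; rewrite eqn_leq w1 w2.
Qed.

Lemma tag_sum (be : {ffun 'I_n -> T}) (g : T -> int) : (forall j, tag (be j) = j) ->
  \sum_t (t == be (tag t))%:Z * g t = \sum_j g (be j).
Proof.
move=> hbe; rewrite (partition_big (fun t : T => tag t) xpredT) //=.
apply: eq_bigr => j _; have e : tag (be j) == j by rewrite hbe.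
rewrite (bigD1 (be j)) //= hbe eqxx mul1r big1 ?addr0 // => t /andP[/eqP -> /negbTE ->].
by rewrite mul0r.
Qed.

(** Otherwise every support has two exponents of multiplicity at least [Lb], and a bounded relation
    can be both added to [de] and subtracted from it. Minimality of the sum forces [d = 0]; the two
    changes of weight are then opposite, so minimality of the weight makes them zero. As the weight
    separates decompositions, [m = 0]. *)
Lemma dominant de : isopt de -> exists t0 : T,
  forall t, tag t = tag t0 -> t != t0 -> (de t < Lb)%N.
Proof.
move=> /andP[ddec /forallP hopt]; apply: contrapT => no.
have {no} no t0 : exists t, [/\ tag t = tag t0, t != t0 & (Lb <= de t)%N].
  apply: contrapT => h; apply: no; exists t0 => t tt ne; rewrite ltnNge; apply/negP => hL.
  by apply: h; exists t.
have no2 j : exists ab : T * T, [/\ tag ab.1 = j, tag ab.2 = j, ab.1 != ab.2,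
    (Lb <= de ab.1)%N & (Lb <= de ab.2)%N].
  (* The assumption is used twice: the first exponent found is large, the second is large and
     different from it. *)
  have [t tj] := B_ne j; have [t1 [h1 _ L1]] := no t; have [t2 [h2 ne L2]] := no t1.
  by exists (t2, t1); rewrite /= h2 h1 tj.
have [ab hab] := choice no2.
pose al := [ffun j => (ab j).1]; pose be := [ffun j => (ab j).2].
have tal j : tag (al j) = j by rewrite ffunE; case: (hab j).
have tbe j : tag (be j) = j by rewrite ffunE; case: (hab j).
have ne j : al j != be j by rewrite !ffunE; case: (hab j).
have Lal j : (Lb <= de (al j))%N by rewrite ffunE; case: (hab j).
have Lbe j : (Lb <= de (be j))%N by rewrite ffunE; case: (hab j).
have [m [d [m0 mL mU]]] := hLb al be.
(* The relation is added for [s = 1] and subtracted for [s = -1]; multiplicities stay non-negative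
   because the coefficients are at most [Lb]. *)
pose v (s : int) (t : T) : int := (de t)%:Z +
  s * m 0 (tag t) * ((t == be (tag t))%:Z - (t == al (tag t))%:Z).
have v0 s t : `|s| = 1 -> 0 <= v s t.
  move=> s1; have hm : `|s * m 0 (tag t)| <= Lb%:Z.
    by rewrite normrM s1 mul1r -abszE lez_nat.
  have hm' : - Lb%:Z <= s * m 0 (tag t) <= Lb%:Z by rewrite -ler_norml.
  rewrite /v; have hal := Lal (tag t); have hbe := Lbe (tag t).
  have [tb|tb] := eqVneq t (be (tag t)); have [ta|ta] := eqVneq t (al (tag t)).
  - by rewrite subrr mulr0 addr0.
  - by rewrite -tb in hbe; lia.
  - by rewrite -ta in hal; lia.
  - by rewrite subrr mulr0 addr0.
have lin s (g : T -> int) : \sum_t v s t * g t =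
    \sum_t (de t)%:Z * g t + s * \sum_j m 0 j * (g (be j) - g (al j)).
  have -> : \sum_t v s t * g t = \sum_t (de t)%:Z * g t + s *
     (\sum_t (t == be (tag t))%:Z * (m 0 (tag t) * g t)
      - \sum_t (t == al (tag t))%:Z * (m 0 (tag t) * g t)).
    rewrite -sumrB mulr_sumr -big_split; apply: eq_bigr => t _ /=.
    have dist (x y z b a h : int) : (x + y * z * (b - a)) * h = x * h + y * (b * (z * h) - a * (z * h)) by ring.
    exact: dist.
  have e1 := tag_sum (fun t => m 0 (tag t) * g t) tbe.
  have e2 := tag_sum (fun t => m 0 (tag t) * g t) tal.
  apply: (etrans (congr1 (fun z => _ + s * z) (congr2 (fun x y => x - y) e1 e2))).
  rewrite -sumrB; congr (_ + _ * _); apply: eq_bigr => j _.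
  by rewrite tal tbe; ring.
pose f s t := `|v s t|%N.
have fE s t : `|s| = 1 -> (f s t)%:Z = v s t by move=> s1; rewrite /f gez0_abs // v0.
have flin s (g : T -> nat) : `|s| = 1 -> (\sum_t f s t * g t)%N%:Z =
    (\sum_t de t * g t)%N%:Z + s * \sum_j m 0 j * ((g (be j))%:Z - (g (al j))%:Z).
  have Psum (h : T -> nat) : (\sum_t h t * g t)%N%:Z = \sum_t (h t)%:Z * (g t)%:Z.
    by rewrite (big_morph Posz PoszD (erefl _)); apply: eq_bigr => t _; rewrite PoszM.
  move=> s1; rewrite !Psum; have := lin s (fun t => (g t)%:Z) => /= <-.
  by apply: eq_bigr => t _; rewrite fE.
have fdeg s j : `|s| = 1 -> ddeg (f s) j = Kd.
  move=> s1; have dg (h : T -> nat) : ddeg h j = (\sum_t h t * (tag t == j))%N.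
    by rewrite /ddeg big_mkcond; apply: eq_bigr => t _; case: eqP => _; rewrite ?muln1 ?muln0.
  apply/eqP; rewrite -eqz_nat; have /forallP/(_ j)/eqP <- := ddec.
  rewrite !dg flin // [X in _ + s * X]big1 ?mulr0 ?addr0 // => k _.
  by rewrite tal tbe subrr mulr0.
have fsum s i : `|s| = 1 -> (dsum (f s) i)%:Z =
    (dsum (fun t => de t : nat) i)%:Z - s * (d * (i == ord0))%N%:Z.
  by move=> s1; rewrite /dsum flin // mU mulrN.
have fdec s : `|s| = 1 -> (fun t => ofn (f s) t : nat) = f s.
  by move=> s1; apply: ofnE => j; apply: fdeg.
have fisdec s : `|s| = 1 -> isdec (ofn (f s)).
  by move=> s1; apply/forallP => j; rewrite fdec // fdeg.
have n1 : `|1 : int| = 1 by [].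
have nm1 : `|-1 : int| = 1 by [].
have below1 : below (ofn (f 1)) de.
  by apply/forallP => i; rewrite fdec //; have := fsum 1 i n1; lia.
have := hopt (ofn (f 1)); rewrite fisdec //= below1 => /andP[/forallP/(_ ord0)].
rewrite fdec // => le0 w1; have d0 : d = 0%N.
  by move: (fsum 1 ord0 n1) le0; rewrite eqxx muln1 mul1r; lia.
have below2 : below (ofn (f (-1))) de.
  by apply/forallP => i; rewrite fdec //; have := fsum (-1) i nm1; rewrite d0 mul0n mulr0 subr0; lia.
have := hopt (ofn (f (-1))); rewrite fisdec //= below2 => /andP[_].
rewrite fdec // => w2.
have W1 := flin 1 wt n1; have W2 := flin (-1) wt nm1.
have eqW : dws (fun t => ofn (f 1) t : nat) = dws (fun t => de t : nat).
  rewrite fdec //; move: w1 w2 W1 W2; rewrite /dws mul1r mulN1r.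
  move: (\sum_t f 1%R t * wt t)%N (\sum_t f (-1)%R t * wt t)%N (\sum_t de t * wt t)%N.
  by move: (\sum_j m 0 j * _) => o a b c; lia.
have := dws_inj eqW => efun; have {}efun t : f 1 t = de t.
  by have /= := congr1 (fun h => h t) (fdec 1 n1); rewrite efun => ->.
case/eqP: m0; apply/rowP => j; rewrite mxE.
have := fE 1 (be j) n1; rewrite efun /v tbe eqxx mul1r.
have -> : (be j == al j) = false by rewrite eq_sym (negbTE (ne j)).
rewrite [(true)%:Z - false%:Z]subr0 mulr1; move: (de _) (m 0 j) => /= x y.
by rewrite -[X in X = _]addr0 => /addrI.
Qed.

End Decompositions.

Lemma spolyE n (K : fieldType) (B : 'I_n -> {fset multinom n}) (c : coef_index B -> K) j :
  spoly c j = \sum_(t : coef_index B | tag t == j) c t *: mpolyX K (texp t).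
Proof.
transitivity (\sum_(i | i == j) \sum_(a : B i)
    c (Tagged (fun j => B j) a) *: mpolyX K (val a)); first by rewrite big_pred1_eq.
rewrite sig_big_dep; apply: eq_big => [t|[i a] _ //]; by rewrite andbT.
Qed.

Lemma poly_nonroot (K : numFieldType) (P : {poly K}) : P != 0 -> exists x, ~~ root P x.
Proof.
move=> P0; apply: contrapT => no.
have r x : root P x by apply: contrapT => /negP h; apply: no; exists x.
pose rs := [seq (i%:R : K) | i <- iota 0 (size P)].
have := max_poly_roots P0 (rs := rs); rewrite size_map size_iota ltnn => h.
suff : false by []; apply: h; first by apply/allP => x _; apply: r.
rewrite map_inj_uniq ?iota_uniq // => i j /eqP.
by rewrite eqr_nat => /eqP.
Qed.

(** [L] lists with repetition the factors of the product of ideals, so [rem j L] omits one factor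
    [I_j]; a single denominator [q] serves all [u]. *)
Definition joint_red n (K : fieldType) (B : 'I_n -> {fset multinom n})
    (f : 'I_n -> mpoly n K) (L : seq 'I_n) :=
  (forall j, j \in L) /\ exists2 q, unit0 q & forall u, monideal B L u ->
    exists g, (forall j, monideal B (rem j L) (g j)) /\ q * u = \sum_j f j * g j.

(** * Joint reductions of generic systems *)

Section JointReduction.
Variables (n' : nat) (K : numFieldType) (B : 'I_n'.+1 -> {fset multinom n'.+1}).
Local Notation n := n'.+1.
Local Notation S := (mpoly n K).
Local Notation X_ b := (@mpolyX n K b).
Local Notation T := (coef_index B).
Hypothesis B_ne : forall j, exists t : T, tag t = j.

Lemma relbound_ex : exists Lb, relbound B Lb.
Proof.
have /choice [m hm] : forall ab : {ffun 'I_n -> T} * {ffun 'I_n -> T},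
    exists md : 'rV[int]_n * nat, md.1 != 0 /\
    md.1 *m (\matrix_(j, i) ((texp (ab.2 j) i)%:Z - (texp (ab.1 j) i)%:Z)) =
    (- md.2%:Z) *: delta_mx 0 ord0.
  by move=> ab; have [m [d h]] := int_relation (\matrix_(j, i) ((texp (ab.2 j) i)%:Z - (texp (ab.1 j) i)%:Z));
    exists (m, d).
exists (\max_ab \max_j `|(m ab).1 0%R j|)%N => al be; exists (m (al, be)).1, (m (al, be)).2.
have [h1 h2] := hm (al, be); split=> // [j|i].
  apply: (leq_trans (leq_bigmax (F := fun j => `|(m (al, be)).1 0%R j|%N) j)).
  exact: (leq_bigmax (F := fun ab => (\max_j `|(m ab).1 0%R j|)%N) (al, be)).
have /rowP/(_ i) := h2; rewrite !mxE => e.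
transitivity (- Posz (m (al, be)).2 * ((0 == 0 :> 'I_1) && (i == ord0))%:R).
  by rewrite -e; apply: eq_bigr => j _; rewrite mxE.
by rewrite eqxx /=; case: eqP => _; rewrite ?muln1 ?muln0 ?mulr1 ?mulr0 ?oppr0.
Qed.

Variable Lb : nat.
Hypothesis hLb : relbound B Lb.
(** Chosen so that, when all other multiplicities in a support are below [Lb], the dominant one
    exceeds [Lb] with a margin. *)
Let Kd := (#|{: T}| * Lb + Lb + 2)%N.
Local Notation dec := {ffun T -> 'I_Kd.+1}.

Local Notation opts := [set de : dec | isopt de]%SET.
Local Notation N := #|opts|.
Let opt (r : 'I_N) : dec := enum_val r.

Let optP r : isopt (opt r).
Proof. by have := enum_valP r; rewrite inE. Qed.

Let opt_dec r : isdec (opt r).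
Proof. by have /andP[] := optP r. Qed.

Let dn (de : dec) : T -> nat := fun t => de t.

Lemma dom_ex : exists dom : 'I_N -> T, forall r t, tag t = tag (dom r) -> t != dom r ->
  (opt r t < Lb)%N.
Proof.
have /choice [dom h] : forall r, exists t0 : T, forall t, tag t = tag t0 -> t != t0 ->
    (opt r t < Lb)%N by move=> r; apply: (dominant B_ne hLb).
by exists dom.
Qed.

Variable dom : 'I_N -> T.
Hypothesis domP : forall r t, tag t = tag (dom r) -> t != dom r -> (opt r t < Lb)%N.

Lemma dom_big r : (Lb + 2 <= opt r (dom r))%N.
Proof.
have /forallP/(_ (tag (dom r)))/eqP := opt_dec r; rewrite /ddeg (bigD1 (dom r)) //= => h.
have hs : (\sum_(t | (tag t == tag (dom r)) && (t != dom r)) opt r t <= #|{: T}| * Lb)%N.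
  rewrite big_mkcond -sum_nat_const; apply: leq_sum => t _; case: ifP => // /andP[/eqP tt ne].
  by rewrite ltnW // domP.
have KE : Kd = (#|{: T}| * Lb + Lb + 2)%N by [].
move: h hs KE; move: (\sum_(t | _) _)%N (#|{: T}| * Lb)%N (nat_of_ord (opt r _)).
by move=> x y z; lia.
Qed.

(** One copy of the dominant exponent is exchanged for [t']; these are the terms of
    [spoly c (tag (dom r))] times the rest of the decomposition. *)
Let swf r t' : T -> nat := fun t => (opt r t - (t == dom r) + (t == t'))%N.

Let sw r t' : dec := ofn Kd (swf r t').

Lemma sw_deg r t' j : tag t' = tag (dom r) -> ddeg (swf r t') j = Kd.
Proof.
move=> tt; rewrite /swf (ddeg_add (fun t => opt r t - (t == dom r))%N) ddeg_sub; last first.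
  by have := dom_big r; lia.
have /forallP/(_ j)/eqP -> := opt_dec r; rewrite tt subnK //.
by case: eqP => // _; rewrite /Kd addnC.
Qed.

Lemma swE r t' : tag t' = tag (dom r) -> dn (sw r t') = swf r t'.
Proof. by move=> tt; apply: ofnE => j; apply: sw_deg. Qed.

Lemma sw_dec r t' : tag t' = tag (dom r) -> isdec (sw r t').
Proof. by move=> tt; apply/forallP => j; rewrite -/(dn _) swE // sw_deg. Qed.

Definition mm (f : T -> nat) : multinom n := Multinom [tuple dsum f i | i < n].

Lemma mmE f i : mm f i = dsum f i. Proof. exact: mnmE. Qed.

Lemma mm_sw r t' : tag t' = tag (dom r) ->
  mm (dn (sw r t')) = mnm_add (mnm_sub (mm (dn (opt r))) (texp (dom r))) (texp t').
Proof.
move=> tt; apply/mnmP => i; rewrite mnmDE mnmBE !mmE swE //.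
rewrite /swf (dsum_add (fun t => opt r t - (t == dom r))%N) dsum_sub //.
by have := dom_big r; lia.
Qed.

Lemma dom_le r : mpoly.lem (texp (dom r)) (mm (dn (opt r))).
Proof.
apply/mnm_lepP => i; rewrite mmE; apply: (dsum_pos (de := dn (opt r))).
by rewrite /dn; have := dom_big r; lia.
Qed.

Lemma belowP (de de' : dec) : reflect (mpoly.lem (mm (dn de)) (mm (dn de'))) (below de de').
Proof. by apply: (iffP forallP) => h; [apply/mnm_lepP => i; rewrite !mmE|move=> i; have /mnm_lepP/(_ i) := h; rewrite !mmE]. Qed.

Lemma rho_ex : exists rho : 'I_N * T -> 'I_N, forall r t', tag t' = tag (dom r) ->
  below (opt (rho (r, t'))) (sw r t').
Proof.
have : forall p : 'I_N * T, exists r' : 'I_N, tag p.2 = tag (dom p.1) ->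
    below (opt r') (sw p.1 p.2).
  move=> [r t'] /=; have [tt|tt] := pselect (tag t' = tag (dom r)); last by exists r.
  have [ga hga b] := opt_below (sw_dec tt).
  have gaI : ga \in opts by rewrite inE.
  by exists (enum_rank_in gaI ga); rewrite /opt enum_rankK_in.
by move=> /choice [rho h]; exists rho => r t'; apply: (h (r, t')).
Qed.

Variable rho : 'I_N * T -> 'I_N.
Hypothesis rhoP : forall r t', tag t' = tag (dom r) -> below (opt (rho (r, t'))) (sw r t').

(** Marks the terms that survive modulo the maximal ideal: their quotient by the generator selected
    by [rho] is 1. *)
Definition tight r t' := mm (dn (sw r t')) == mm (dn (opt (rho (r, t')))).

(* The matrix of the rewriting [x^b = - sum_(a' <> a) c_a' / c_a x^(b - a + a')]
   on the minimal generators of the ideal, modulo the maximal ideal. *)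
Definition redmx (R : comNzRingType) (c : T -> R) : 'M[R]_N :=
  \matrix_(r, r') \sum_(t' | [&& tag t' == tag (dom r), rho (r, t') == r' & tight r t']) c t'.

Lemma redmx_map (R R' : comNzRingType) (phi : {rmorphism R -> R'}) c :
  map_mx phi (redmx c) = redmx (phi \o c).
Proof. by apply/matrixP => r r'; rewrite !mxE rmorph_sum. Qed.

Definition L0 : seq 'I_n := flatten [seq nseq Kd j | j <- enum 'I_n].

Lemma count_L0 j : count_mem j L0 = Kd.
Proof.
rewrite /L0 count_flatten -map_comp sumnE big_map big_enum /=.
rewrite (bigD1 j) //= count_nseq /= eqxx mul1n big1 ?addn0 // => i ij.
by rewrite count_nseq /= (negbTE ij).
Qed.

Lemma mem_L0 j : j \in L0.
Proof. by rewrite -has_pred1 has_count count_L0 /Kd; lia. Qed.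

Section Reduce.
Variable c : T -> K.
Hypothesis detc : \det (redmx c) != 0.

Let fullmx : 'M[S]_N := \matrix_(r, r')
  \sum_(t' | (tag t' == tag (dom r)) && (rho (r, t') == r'))
    c t' *: X_ (mnm_sub (mm (dn (sw r t'))) (mm (dn (opt r')))).

Let fullmx_row r : spoly c (tag (dom r)) * X_ (mnm_sub (mm (dn (opt r))) (texp (dom r))) =
  \sum_r' fullmx r r' * X_ (mm (dn (opt r'))).
Proof.
rewrite spolyE mulr_suml.
rewrite (partition_big (fun t' => rho (r, t')) xpredT) //=; apply: eq_bigr => r' _.
rewrite mxE mulr_suml; apply: eq_bigr => t' /andP[/eqP tt /eqP rr].
rewrite -!scalerAl -!mpolyXD; congr (_ *: X_ _).
have le : mpoly.lem (mm (dn (opt r'))) (mm (dn (sw r t'))) by rewrite -rr; apply/belowP/rhoP.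
by rewrite (submK le) mm_sw // addmC.
Qed.

(** By [fullmx_row], the matrix [fullmx] expresses multiples of the [spoly c j] through the minimal
    generators. Its determinant has constant term [\det (redmx c)], hence is a unit at the origin,
    and the adjugate solves for the generators. *)
Lemma joint_reduction_of_det : joint_red B (spoly c) L0.
Proof.
split; first exact: mem_L0.
have uq : unit0 (\det fullmx).
  rewrite /unit0 -(det_map_mx (@mcoeff n K (@mnm0 n))).
  suff -> : map_mx (mcoeff (@mnm0 n)) fullmx = redmx c by [].
  apply/matrixP => r r'; rewrite !mxE raddf_sum /=.
  rewrite [RHS](eq_bigl (fun t' => ((tag t' == tag (dom r)) && (rho (r, t') == r')) && tight r t'));
    last by move=> t'; rewrite andbA.
  rewrite [RHS]big_mkcondr; apply: eq_bigr => t' /andP[/eqP tt /eqP rr].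
  rewrite mcoeffZ mcoeffX /tight rr.
  have le : mpoly.lem (mm (dn (opt r'))) (mm (dn (sw r t'))) by rewrite -rr; apply/belowP/rhoP.
  have -> : (mnm_sub (mm (dn (sw r t'))) (mm (dn (opt r'))) == @mnm0 n) =
      (mm (dn (sw r t')) == mm (dn (opt r'))).
    apply/eqP/eqP => [e|->]; first by rewrite -(submK le) e add0m.
    by apply/mnmP => i; rewrite mnmBE mnm0E subnn.
  by case: eqP => _; rewrite ?mulr1 ?mulr0.
pose P : set S := [set u | exists g, (forall j, monideal B (rem j L0) (g j)) /\
  \det fullmx * u = \sum_j spoly c j * g j].
suff [iP PX] : ideal P /\ forall b, mon B L0 b -> P (X_ b).
  by exists (\det fullmx) => // u; apply: (monideal_gen iP PX).
split; first split.
- exists (fun=> 0); split; first by move=> j; case: (monideal_ideal K B (rem j L0)).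
  by rewrite mulr0 big1 // => j _; rewrite mulr0.
- move=> v w [g [hg eg]] [h [hh eh]]; exists (fun j => g j + h j); split.
    by move=> j; case: (monideal_ideal K B (rem j L0)) => _ hD _; apply: hD.
  by rewrite mulrDr eg eh -big_split; apply: eq_bigr => j _; rewrite mulrDr.
- move=> a v [g [hg eg]]; exists (fun j => a * g j); split.
    by move=> j; case: (monideal_ideal K B (rem j L0)) => _ _ hM; apply: hM.
  by rewrite mulrCA eg mulr_sumr; apply: eq_bigr => j _; rewrite mulrCA.
move=> b /mon_decomp [de [hde1 hde2]]; rewrite /P /=.
have dde : isdec (ofn Kd de).
  by apply/forallP => j; rewrite ofnE ?hde1 ?count_L0 // => k; rewrite hde1 count_L0.
have [ga hga bga] := opt_below dde.
have gaI : ga \in opts by rewrite inE.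
pose r0 := enum_rank_in gaI ga; have r0E : opt r0 = ga by rewrite /opt enum_rankK_in.
have leb : mpoly.lem (mm (dn (opt r0))) b.
  apply/mnm_lepP => i; rewrite mmE r0E; apply: leq_trans (hde2 i).
  move/forallP/(_ i): bga; rewrite ofnE // => k; by rewrite hde1 count_L0.
pose g j := \sum_(r | tag (dom r) == j)
  X_ (mnm_sub b (mm (dn (opt r0)))) * (\adj fullmx) r0 r * X_ (mnm_sub (mm (dn (opt r))) (texp (dom r))).
exists g; split.
  move=> j; have hI := monideal_ideal K B (rem j L0).
  rewrite /g; apply: (@ideal_sum _ _ (monideal B (rem j L0)) _ _ _ _ hI) => r /eqP rj; case: (hI) => _ _ hM; apply: hM.
  apply: monidealX; apply/monP; exists (fun t => dn (opt r) t - (t == dom r))%N.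
  have pos : (0 < dn (opt r) (dom r))%N by rewrite /dn; have := dom_big r; lia.
  split=> k; last by rewrite dsum_sub // mnmBE mmE.
  rewrite ddeg_sub // count_rem count_L0 mem_L0 rj /=.
  by have /forallP/(_ k)/eqP <- := opt_dec r; rewrite eq_sym.
have fin : \sum_j spoly c j * g j = X_ (mnm_sub b (mm (dn (opt r0)))) *
    \sum_r (\adj fullmx) r0 r * \sum_r' fullmx r r' * X_ (mm (dn (opt r'))).
  rewrite mulr_sumr; rewrite [RHS](partition_big (fun r => tag (dom r)) xpredT) //=.
  apply: eq_bigr => j _; rewrite mulr_sumr; apply: eq_bigr => r /eqP <-.
  by rewrite -fullmx_row; ring.
rewrite fin; have -> : \sum_r (\adj fullmx) r0 r * \sum_r' fullmx r r' * X_ (mm (dn (opt r'))) =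
    \sum_r' (\adj fullmx *m fullmx) r0 r' * X_ (mm (dn (opt r'))).
  under eq_bigr => r _ do rewrite mulr_sumr.
  rewrite exchange_big; apply: eq_bigr => r' _; rewrite mxE mulr_suml.
  by apply: eq_bigr => r _; rewrite mulrA.
rewrite mul_adj_mx (bigD1 r0) //= mxE eqxx mulr1n big1 ?addr0; last first.
  by move=> r' /negbTE e; rewrite mxE eq_sym e mulr0n mul0r.
by rewrite mulrCA -mpolyXD submK.
Qed.
End Reduce.

(** Used in the potential [phi], which rescales rows and columns: weight comes first, and the sum of
    squares [h], always below [Kb], breaks ties. *)
Let h (de : dec) := (\sum_t de t ^ 2)%N.
Let Kb := (#|{: T}| * Kd ^ 2).+1.
Let phi (de : dec) := (Kb * dws Kd (dn de) + h de)%N.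

Lemma h_lt de : (h de < Kb)%N.
Proof.
rewrite ltnS -sum_nat_const; apply: leq_sum => t _.
by rewrite leq_exp2r // -ltnS.
Qed.

Lemma sw_dom r : sw r (dom r) = opt r.
Proof.
apply/ffunP => t; apply: val_inj; have /= := congr1 (fun f => f t) (swE (erefl (tag (dom r)))).
rewrite /dn /swf => ->.
by rewrite subnK //; case: eqP => // ->; have := dom_big r; lia.
Qed.

Lemma rho_dom r : rho (r, dom r) = r.
Proof.
have b := rhoP (r := r) (erefl (tag (dom r))); rewrite sw_dom in b.
by apply: enum_val_inj; rewrite -/(opt _) -[RHS]/(opt r) -(opt_uniq (optP r) (optP _) b).
Qed.

Lemma tight_dom r : tight r (dom r).
Proof. by rewrite /tight rho_dom sw_dom. Qed.

Lemma tight_ne r t' : tag t' = tag (dom r) -> tight r t' -> t' != dom r ->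
  rho (r, t') != r.
Proof.
move=> tt /eqP tg; apply: contraNneq => e; apply/eqP; apply: (texp_inj tt).
move: tg; rewrite e mm_sw //.
have -> : mm (dn (opt r)) = mnm_add (mnm_sub (mm (dn (opt r))) (texp (dom r))) (texp (dom r)).
  by rewrite submK // dom_le.
by rewrite addmK => /addmI.
Qed.

Lemma dws_sw r t' : tag t' = tag (dom r) ->
  (dws Kd (dn (sw r t')) + wt Kd (dom r) = dws Kd (dn (opt r)) + wt Kd t')%N.
Proof.
move=> tt; have wadd (f : T -> nat) t0 : dws Kd (fun t => f t + (t == t0))%N = (dws Kd f + wt Kd t0)%N.
  rewrite /dws (eq_bigr (fun t => f t * wt Kd t + (t == t0) * wt Kd t)%N) => [|t _]; last by rewrite mulnDl.
  rewrite big_split /=; congr addn; rewrite (bigD1 t0) //= eqxx mul1n big1 ?addn0 //.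
  by move=> t /negbTE ->.
rewrite swE // /swf (wadd (fun t => opt r t - (t == dom r))%N) addnAC -wadd; congr (_ + _)%N.
congr (dws Kd _); apply/funext => t; rewrite subnK //.
by case: eqP => // ->; have := dom_big r; lia.
Qed.

(** Moving a unit from a multiplicity above [Lb] to one below [Lb] decreases the sum of squares. *)
Lemma h_sw r t' : tag t' = tag (dom r) -> t' != dom r -> (h (sw r t') < h (opt r))%N.
Proof.
move=> tt ne; have hs := swE tt; rewrite /h.
have -> : (\sum_t sw r t' t ^ 2 = \sum_t swf r t' t ^ 2)%N by apply: eq_bigr => t _; rewrite -hs.
have ne' : dom r != t' by rewrite eq_sym.
rewrite (bigD1 (dom r)) //= (bigD1 t') //= [X in (_ < X)%N](bigD1 (dom r)) //= [X in (_ < _ + X)%N](bigD1 t') //=.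
have -> : (\sum_(t | (t != dom r) && (t != t')) swf r t' t ^ 2 =
    \sum_(t | (t != dom r) && (t != t')) opt r t ^ 2)%N.
  by apply: eq_bigr => t /andP[/negbTE e1 /negbTE e2]; rewrite /swf e1 e2 subn0 addn0.
rewrite /swf !eqxx (negbTE ne) (negbTE ne') subn0 addn0.
have := dom_big r; have := domP tt ne.
move: (\sum_(t | _) _)%N (nat_of_ord (opt r (dom r))) (nat_of_ord (opt r t')) => s x y h1 h2.
rewrite !addnA ltn_add2r /=; have [z xE] : exists z, x = z.+1 by exists x.-1; lia.
by rewrite xE subn1 /= -!mulnn; rewrite xE in h2; nia.
Qed.

(** If the selected decomposition differs from the swapped one, its weight is strictly smaller and
    the factor [Kb] outweighs [h]. If they coincide, the weights balance exactly and [h]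
    decreases. *)
Lemma tight_gap r t' : tag t' = tag (dom r) -> tight r t' -> t' != dom r ->
  (Kb * wt Kd (dom r) + phi (opt (rho (r, t'))) < Kb * wt Kd t' + phi (opt r))%N.
Proof.
move=> tt tg ne; set r' := rho (r, t').
have b1 : below (sw r t') (opt r') by apply/belowP; rewrite (eqP tg) lepm_refl.
have wle : (dws Kd (dn (opt r')) <= dws Kd (dn (sw r t')))%N.
  have /andP[_ /forallP/(_ (sw r t'))] := optP r'.
  by rewrite sw_dec // b1 /= => /andP[].
have hsw := h_sw tt ne; have hw := dws_sw tt; have hlt := h_lt (opt r').
have [e|lt] := eqVneq (dws Kd (dn (opt r'))) (dws Kd (dn (sw r t'))).
  rewrite /phi (dws_inj e : opt r' = sw r t').
  move: hsw hw; move: (h _) (h _) (dws Kd _) (dws Kd _) (wt Kd _) (wt Kd _) Kb.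
  by move=> x y a b c d k; nia.
have {}wle : (dws Kd (dn (opt r')) < dws Kd (dn (sw r t')))%N by rewrite ltn_neqAle lt.
rewrite /phi; move: hlt hw wle.
move: (h (opt r')) (h (opt r)) (dws Kd (dn (opt r'))) (dws Kd (dn (sw r t'))) (dws Kd (dn (opt r))).
by move: (wt Kd (dom r)) (wt Kd t') Kb => c d k x y a b e; nia.
Qed.

Let wc (t : T) : {poly K} := 'X^(Kb * wt Kd t).

(** After rescaling by powers of the variable given by [phi], the dominant terms have exponent 0 and
    lie on the diagonal, while [tight_gap] gives all other terms a positive exponent. The rescaled
    matrix [E] is thus the identity at 0. *)
Lemma det_redmx_neq0 : \det (redmx wc) != 0.
Proof.
pose ex r t' := (Kb * wt Kd t' + phi (opt r) - (Kb * wt Kd (dom r) + phi (opt (rho (r, t')))))%N.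
pose E : 'M[{poly K}]_N := \matrix_(r, r')
  \sum_(t' | [&& tag t' == tag (dom r), rho (r, t') == r' & tight r t']) 'X^(ex r t').
have exE r t' : tag t' = tag (dom r) -> tight r t' ->
    (Kb * wt Kd (dom r) + phi (opt (rho (r, t'))) + ex r t' = Kb * wt Kd t' + phi (opt r))%N.
  move=> tt tg; rewrite /ex subnKC //; have [->|ne] := eqVneq t' (dom r); first by rewrite rho_dom.
  exact/ltnW/tight_gap.
have fac : diag_mx (\row_r 'X^(phi (opt r))) *m redmx wc =
    diag_mx (\row_r 'X^(Kb * wt Kd (dom r))) *m E *m diag_mx (\row_r 'X^(phi (opt r))).
  apply/matrixP => r r'; rewrite mul_diag_mx -mulmxA mul_diag_mx mul_mx_diag !mxE.
  rewrite mulr_suml !mulr_sumr; apply: eq_bigr => t' /and3P[/eqP tt /eqP rr tg].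
  by rewrite /wc -!exprD -rr [(phi _ + _)%N]addnC -exE // -addnA [(ex _ _ + _)%N]addnC.
have E0 : (\det E).[0] = 1.
  rewrite -horner_evalE -det_map_mx (_ : map_mx _ _ = 1%:M) ?det1 //.
  apply/matrixP => r r'; rewrite !mxE raddf_sum /=.
  have [<-|ne] := eqVneq r r'.
    rewrite (bigD1 (dom r)) /= ?eqxx ?rho_dom ?eqxx ?tight_dom //.
    rewrite /ex rho_dom subnn expr0 horner_evalE hornerC big1 ?addr0 //.
    move=> t' /andP[/and3P[/eqP tt /eqP rr tg] ne].
    by have := tight_ne tt tg ne; rewrite rr eqxx.
  rewrite big1 // => t' /and3P[/eqP tt /eqP rr tg].
  have ne' : t' != dom r by apply: contraNneq ne => e; rewrite -rr e rho_dom.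
  rewrite horner_evalE hornerXn expr0n /ex subn_eq0 leqNgt.
  by rewrite tight_gap.
apply/eqP => d0; have := congr1 determinant fac; rewrite !det_mulmx d0 mulr0 !det_diag => /esym/eqP.
have pX (k : 'I_N -> nat) : \prod_i (\row_r 'X^(k r) : 'rV[{poly K}]_N) 0 i != 0.
  by apply/prodf_neq0 => r _; rewrite mxE expf_neq0 // polyX_eq0.
rewrite !mulf_eq0 (negbTE (pX _)) (negbTE (pX _)) orbF /= => /eqP e.
by move: E0; rewrite e horner0 => /esym/eqP; rewrite oner_eq0.
Qed.

Lemma generic_joint_red_ex : exists (L : seq 'I_n) (p : mpoly #|{: T}| K),
  (exists c : T -> K, meval (c \o enum_val) p != 0) /\
  forall c : T -> K, meval (c \o enum_val) p != 0 -> joint_red B (spoly c) L.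
Proof.
exists L0, (\det (redmx (fun t : T => mpolyX K (mnm1 (enum_rank t))))).
have ev (c : T -> K) : meval (c \o enum_val) (\det (redmx (fun t : T => mpolyX K (mnm1 (enum_rank t))))) =
    \det (redmx c).
  rewrite -det_map_mx redmx_map; congr (\det (redmx _)); apply/funext => t /=.
  by rewrite mevalXU /= enum_rankK.
split=> [|c]; last by rewrite ev; apply: joint_reduction_of_det.
have [x hx] := poly_nonroot det_redmx_neq0.
exists (fun t => (wc t).[x]); rewrite ev; apply: contraNneq hx => d0.
rewrite /root -horner_evalE -det_map_mx redmx_map -[X in _ == X]d0; apply/eqP.
by congr (\det (redmx _)).
Qed.

End JointReduction.

Theorem generic_joint_red n' (K : numFieldType) (B : 'I_n'.+1 -> {fset multinom n'.+1}) :
  (forall j, exists t : coef_index B, tag t = j) ->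
  exists (L : seq 'I_n'.+1) (p : mpoly #|{: coef_index B}| K),
  (exists c : coef_index B -> K, meval (c \o enum_val) p != 0) /\
  forall c : coef_index B -> K, meval (c \o enum_val) p != 0 -> joint_red B (spoly c) L.
Proof.
move=> B_ne; have [Lb hLb] := relbound_ex B.
have [dom hdom] := dom_ex B_ne hLb; have [rho hrho] := rho_ex hdom.
exact: (generic_joint_red_ex K hdom hrho).
Qed.

(** The relation for [L] is multiplied by monomials of the further factors [R]; [sg] relabels the
    supports, possibly with repetition. *)
Lemma joint_red_ext n (K : fieldType) (A : 'I_n -> {fset multinom n}) (sg : 'I_n -> 'I_n)
    (f : 'I_n -> mpoly n K) L R u :
  joint_red (fun i => A (sg i)) f L -> monideal A (map sg L ++ R) u ->
  exists q g, [/\ unit0 q, forall j, monideal A (map sg (rem j L) ++ R) (g j) &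
    q * u = \sum_j f j * g j].
Proof.
move=> [_ [q uq h]]; pose MI L := @monideal n K A L.
pose P : set (mpoly n K) := [set u | exists g, (forall j, MI (map sg (rem j L) ++ R) (g j)) /\
  q * u = \sum_j f j * g j].
suff [iP PX] : ideal P /\ forall b, mon A (map sg L ++ R) b -> P (mpolyX K b).
  by move=> /(monideal_gen iP PX) [g [h1 h2]]; exists q, g.
split; first split.
- exists (fun=> 0); split; first by move=> j; case: (monideal_ideal K A (map sg (rem j L) ++ R)).
  by rewrite mulr0 big1 // => j _; rewrite mulr0.
- move=> v w [g [hg eg]] [k [hk ek]]; exists (fun j => g j + k j); split.
    move=> j; case: (monideal_ideal K A (map sg (rem j L) ++ R)) => _ hD _; exact: hD (hg j) (hk j).
  by rewrite mulrDr eg ek -big_split; apply: eq_bigr => j _; rewrite mulrDr.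
- move=> a v [g [hg eg]]; exists (fun j => a * g j); split.
    move=> j; case: (monideal_ideal K A (map sg (rem j L) ++ R)) => _ _ hM; exact: hM (hg j).
  by rewrite mulrCA eg mulr_sumr; apply: eq_bigr => j _; rewrite mulrCA.
move=> b /mon_catE [b1 [b2 [-> m1 m2]]].
have hb1 : monideal (fun i => A (sg i)) L (mpolyX K b1).
  apply: monidealX; exact: (iffRL (mon_comp A sg L b1) m1).
have [g [hg eg]] := h _ hb1; exists (fun j => g j * mpolyX K b2); split.
  move=> j; apply: monidealM; last exact: monidealX.
  by have := hg j; rewrite monideal_comp.
by rewrite mpolyXD mulrA eg mulr_suml; apply: eq_bigr => j _; rewrite mulrA.
Qed.

(** * All joint reductions have the same multiplicity *)

Section Exchange.
Variables (n' : nat) (K : fieldType) (B : 'I_n'.+1 -> {fset multinom n'.+1}).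
Local Notation n := n'.+1.
Local Notation S := (mpoly n K).
Local Notation X_ b := (@mpolyX n K b).
Local Notation MI L := (@monideal n K B L).
Implicit Types (f : 'I_n -> S) (L : seq 'I_n).
Hypothesis H3 : forall i j, exists2 mu : nat,
  (0 < mu)%N & mnm_muln (mnm1 i) mu \in B j.

Lemma joint_red_sub f L : joint_red B f L -> MI L `<=` sys f.
Proof.
move=> [_ [q uq h]] u /h [g [_ e]]; apply: (sidl_unit uq); rewrite e.
under eq_bigr => j _ do rewrite mulrC.
by apply: sidl_combination => j _; apply: sidl_gen; exists j.
Qed.

Lemma joint_red_cof f L : joint_red B f L -> cof (sys f).
Proof. by move=> h; apply: cof_sub (joint_red_sub h) (monideal_cof _ H3 _). Qed.

(** Each use of the joint reduction yields multiples of the other entries and one term in which a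
    factor [I_i] has been traded for [f i]. *)
Lemma joint_red_pow f L i N : joint_red B f L ->
  MI (L ++ nseq N i) `<=` sys (upd f i (f i ^+ N)).
Proof.
move=> jr; elim: N => [|N IH] u hu; first exact: sys_upd1.
have [q [g [uq hg e]]] : exists q g, [/\ unit0 q,
    forall j, MI (rem j L ++ nseq N.+1 i) (g j) & q * u = \sum_j f j * g j].
  have := @joint_red_ext _ K B id f L (nseq N.+1 i) u jr; rewrite map_id => /(_ hu) [q [g [h1 h2 h3]]].
  by exists q, g; split => // j; have := h2 j; rewrite map_id.
apply: (sidl_unit uq); rewrite e (bigD1 i) //=; apply: sidlD; last first.
  under eq_bigr => j _ do rewrite mulrC.
  apply: sidl_combination => j ji; apply: sidl_gen; exists j => //.
  by rewrite /upd (negbTE ji).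
have /IH : MI (L ++ nseq N i) (g i).
  apply: monideal_count (hg i) => j; rewrite !count_cat count_rem; case: jr => -> _ /=.
  by case: (i == j) => /=; lia.
rewrite sys_upd => hgi; change (sys (upd f i (f i ^+ N.+1)) (f i * g i)).
rewrite sys_upd; move: (g i) hgi.
apply: (sidl_min (satid_colon (f i) (sidl_satid _))) => v [->|hv] /=.
  by rewrite -exprS; apply: sidl_gen; left.
by apply: sidlM; apply: sidl_gen; right.
Qed.

Lemma monideal_exp L g N : MI L g -> MI (flatten (nseq N L)) (g ^+ N).
Proof. by move=> h; elim: N => [//|N IH]; rewrite exprS; apply: monidealM. Qed.

(* Comparing the colengths of [(f_i^N, f_j)] and [(g^N J, f_j)], where [J] is fixed,
   as [N] grows. *)
Lemma mult_le_upd f L i g : joint_red B f L -> MI [:: i] g ->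
  cof (sys (upd f i g)) -> (mult f <= mult (upd f i g))%N.
Proof.
move=> jr hg cg; have cf := joint_red_cof jr.
have iX := monideal_ideal K B L; have cX := monideal_cof K H3 L.
suff key N : (N * mult f <= codimn (MI L) + N * mult (upd f i g))%N.
  rewrite leqNgt; apply/negP => lt; have := key (codimn (MI L)).+1.
  by move: lt; move: (codimn _) (mult _) (mult _) => a b c; nia.
have cfi : cof (sys (upd f i (f i))) by rewrite upd_id.
have := mult_updX N cfi; rewrite upd_id => <-; rewrite -mult_updX //.
(* This ideal lies in that of [f i ^+ N] and the other entries. Adjoining [g ^+ N] turns it into the
   system with [g ^+ N], and its codimension exceeds that of this system by at most the codimension
   of [MI L], whatever [N] is. *)
pose a := sidl (others f i `|` [set g ^+ N * x | x in MI L]).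
have asub : a `<=` sys (upd f i (f i ^+ N)).
  apply: (sidl_min (X := sys _)); first exact: sidl_satid.
  move=> u [hu|[x hx <-]]; first by rewrite sys_upd; apply: sidl_gen; right.
  apply: (joint_red_pow jr); apply: (monideal_perm (L := flatten (nseq N [:: i]) ++ L)).
    rewrite perm_catC perm_cat2l; elim: (N) => [//|N' /= IH]; by rewrite perm_cons.
  by apply: monidealM => //; apply: monideal_exp.
have cgN := cof_updX N cg.
have ca : cof a.
  case: cX => M1 h1; case: cgN => M2; rewrite sys_upd => h2.
  exists (M1 + M2)%N => b hb.
  have [c hc [d hd]] := split_mnm (leq_trans (leq_addr M2 M1) hb).
  have hd2 : (M2 <= mdeg d)%N by move: hb; rewrite hd mdegD hc leq_add2l.
  rewrite hd mpolyXD; have := h2 d hd2.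
  have hc1 : MI L (X_ c) by apply: h1; rewrite hc.
  apply: (sidl_min (satid_colon (X_ c) (sidl_satid _))) => v [->|hv] /=.
    by rewrite mulrC; apply: sidl_gen; right; exists (X_ c).
  by apply: sidlM; apply: sidl_gen; left.
have hZ u : MI L u -> a (g ^+ N * u).
  by move=> hs; apply: sidl_gen; right; exists u.
have hcod : codim (sidl (g ^+ N |` a)) (mult (upd f i (g ^+ N))).
  suff -> : sidl (g ^+ N |` a) = sys (upd f i (g ^+ N)) by apply: multP.
  rewrite sys_upd; apply/seteqP; split; apply: sidl_sub => v [->|hv].
  + by apply: sidl_gen; left.
  + apply: sidl_sub hv => w [hw|[x _ <-]]; first by apply: sidl_gen; right.
    by apply: sidlMr; apply: sidl_gen; left.
  + by apply: sidl_gen; left.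
  + by apply: sidl_gen; right; apply: sidl_gen; left.
have [e he hce] := codim_step (sidl_ideal _) ca hZ (codimnP iX cX) hcod.
rewrite -(codimnE (sidl_ideal _) hce) in he.
by apply: leq_trans he; apply: leq_codimn => //; exact: sidl_ideal.
Qed.

(** Consecutive hybrids differ in one entry and both are joint reductions, so [mult_le_upd] applies
    in both directions. *)
Lemma mult_eq_hybrid f g :
  (forall i, MI [:: i] (f i)) -> (forall i, MI [:: i] (g i)) ->
  (forall t, exists L, joint_red B (fun i : 'I_n => if (i < t)%N then g i else f i) L) ->
  mult f = mult g.
Proof.
move=> hf hg hyb; pose h t (i : 'I_n) := if (i < t)%N then g i else f i.
have step t : (t < n)%N -> mult (h t) = mult (h t.+1).
  move=> lt; pose i : 'I_n := Ordinal lt.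
  have e1 : h t.+1 = upd (h t) i (g i).
    apply/funext => j; rewrite /upd /h ltnS [(j <= t)%N]leq_eqVlt.
    by have [->|ji] := eqVneq j i; [rewrite eqxx|rewrite -(inj_eq val_inj) /= in ji; rewrite (negbTE ji)].
  have e2 : h t = upd (h t.+1) i (f i).
    apply/funext => j; rewrite /upd /h ltnS [(j <= t)%N]leq_eqVlt.
    by have [->|ji] := eqVneq j i; [rewrite ltnn|rewrite -(inj_eq val_inj) /= in ji; rewrite (negbTE ji)].
  have [L1 jr1] := hyb t; have [L2 jr2] := hyb t.+1; rewrite -/(h _) in jr1 jr2.
  have c1 := joint_red_cof jr1; have c2 := joint_red_cof jr2.
  apply/eqP; rewrite eqn_leq; apply/andP; split.
    by rewrite e1; apply: (mult_le_upd jr1) => //; rewrite -e1.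
  by rewrite [X in (_ <= mult X)%N]e2; apply: (mult_le_upd jr2) => //; rewrite -e2.
have all t : (t <= n)%N -> mult (h 0%N) = mult (h t).
  by elim: t => [//|t IH] lt; rewrite -step // IH // ltnW.
have := all n (leqnn n); have -> : h 0%N = f by apply/funext.
by have -> : h n = g by apply/funext => j; rewrite /h ltn_ord.
Qed.

End Exchange.

(** * Systems of products of generic polynomials *)

Section Products.
Variables (n' : nat) (K : fieldType) (A : 'I_n'.+1 -> {fset multinom n'.+1}).
Local Notation n := n'.+1.
Local Notation S := (mpoly n K).
Local Notation X_ b := (@mpolyX n K b).
Local Notation MI L := (@monideal n K A L).
Hypothesis H3 : forall i j, exists2 mu : nat,
  (0 < mu)%N & mnm_muln (mnm1 i) mu \in A j.
Implicit Types (L M : seq 'I_n) (J : {set 'I_n}).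

(** The factors of the [N]-th power of the product of the [I_j], [j] in [J]. *)
Definition rep N J : seq 'I_n := flatten (nseq N (enum J)).

Lemma count_rep N J j : count_mem j (rep N J) = (N * (j \in J))%N.
Proof.
rewrite /rep; elim: N => [//|N IH] /=; rewrite count_cat IH mulSn; congr addn.
by rewrite count_uniq_mem ?enum_uniq // mem_enum.
Qed.

Lemma monideal_prod (I : Type) (r : seq I) (L : I -> seq 'I_n) (p : I -> S) :
  (forall i, MI (L i) (p i)) -> MI (flatten [seq L i | i <- r]) (\prod_(i <- r) p i).
Proof.
move=> h; elim: r => [|i r IH]; first by rewrite big_nil.
by rewrite big_cons; apply: monidealM.
Qed.

Lemma complement_seq L M : (forall j, (count_mem j L <= count_mem j M)%N) ->
  exists R, perm_eq M (L ++ R).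
Proof.
elim: L M => [|j L IH] M h; first by exists M.
have jM : j \in M by rewrite -has_pred1 has_count; apply: leq_trans (h j); rewrite /= eqxx.
have [R hR] : exists R, perm_eq (rem j M) (L ++ R).
  apply: IH => k; rewrite count_rem jM /=; have := h k; rewrite /=.
  by case: (j == k) => /=; lia.
by exists R; rewrite (perm_trans (perm_to_rem jM)) //= perm_cons.
Qed.

Lemma count_flatten_map (I : Type) (r : seq I) (L : I -> seq 'I_n) j :
  count_mem j (flatten [seq L i | i <- r]) = (\sum_(i <- r) count_mem j (L i))%N.
Proof. by rewrite count_flatten -map_comp sumnE big_map. Qed.

Lemma powsysS (f : 'I_n -> S) N i u : powsys f N u -> powsys f N.+1 (f i * u).
Proof.
move: u; apply: (sidl_min (satid_colon (f i) (sidl_satid _))) => _ [al hal <-] /=.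
rewrite fmon_mul; apply: sidl_gen; eexists; last reflexivity.
rewrite /= big_split /= (bigD1 i (F := fun j => (j == i) : nat)) //= eqxx.
by rewrite addnA addn1 ltnS (leq_trans hal) // leq_addr.
Qed.

Section Fixed.
Variables (f : 'I_n -> 'I_n -> S) (J : {set 'I_n}).
Hypothesis fA : forall i j, MI [:: j] (f i j).
Hypothesis fJ : forall sg : {ffun 'I_n -> 'I_n}, (forall i, sg i \in J) ->
  exists L, joint_red (fun i => A (sg i)) (fun i => f i (sg i)) L.

Definition prodsys i : S := \prod_(j in J) f i j.

(** There are finitely many choices [sg], so one constant bounds the lists of all their joint
    reductions. *)
Lemma uniform_L : exists C, forall sg : {ffun 'I_n -> 'I_n}, (forall i, sg i \in J) ->
  exists L, joint_red (fun i => A (sg i)) (fun i => f i (sg i)) L /\ (size L <= C)%N.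
Proof.
have /choice [L hL] : forall sg : {ffun 'I_n -> 'I_n}, exists L, (forall i, sg i \in J) ->
    joint_red (fun i => A (sg i)) (fun i => f i (sg i)) L.
  move=> sg; have [h|h] := pselect (forall i, sg i \in J).
    by have [L hL] := fJ h; exists L.
  by exists [::] => /h.
exists (\max_sg size (L sg))%N => sg hsg; exists (L sg); split; first exact: hL.
exact: (leq_bigmax (F := fun sg => size (L sg))).
Qed.

Variable C : nat.
Hypothesis hC : forall sg : {ffun 'I_n -> 'I_n}, (forall i, sg i \in J) ->
  exists L, joint_red (fun i => A (sg i)) (fun i => f i (sg i)) L /\ (size L <= C)%N.

Lemma joint_red_step (sg : {ffun 'I_n -> 'I_n}) M u : (forall i, sg i \in J) ->
  (forall i, sg i \in M) -> MI (rep C J ++ M) u ->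
  exists q g, [/\ unit0 q, forall i, MI (rep C J ++ rem (sg i) M) (g i) &
    q * u = \sum_i f i (sg i) * g i].
Proof.
move=> sJ sM hu; have [L [jr sL]] := hC sJ.
have [R hR] : exists R, perm_eq (rep C J) (map sg L ++ R).
  apply: complement_seq => j; rewrite count_rep.
  have [jJ|jJ] := boolP (j \in J); first by rewrite muln1 (leq_trans (count_size _ _)) // size_map.
  rewrite muln0 leqn0; apply/eqP/count_memPn; apply: contra jJ => /mapP [i _ ->]; exact: sJ.
have {}hu : MI (map sg L ++ (R ++ M)) u.
  by apply: monideal_perm hu; rewrite catA perm_cat2r.
have [q [g [uq hg e]]] := joint_red_ext jr hu; exists q, g; split => // i.
apply: monideal_count (hg i) => j; rewrite !count_cat count_rem sM /=.
have iL : i \in L by case: jr.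
have /seq.permP/(_ (pred1 j)) := hR; rewrite count_cat => ->.
have /seq.permP/(_ (pred1 j)) := perm_map sg (perm_to_rem iL); rewrite /= => ->.
have : ((sg i == j) <= count_mem j M)%N.
  by case: eqP => // <-; rewrite -has_count has_pred1.
by move: (count _ _) (count _ _) (count _ _); case: (sg i == j) => /=; lia.
Qed.

Let e := enum J.
Let r := size e.
(** State of the pigeonhole argument: [s i] factors of the product in row [i] have been split off,
    and the tails list those still missing. *)
Let tailseq (s : 'I_n -> nat) : seq 'I_n := flatten [seq drop (s i) e | i <- enum 'I_n].
Let headprod (s : 'I_n -> nat) : S := \prod_i \prod_(j <- take (s i) e) f i j.

Definition prodideal M : set S :=
  sidl [set v | exists i w, MI (rep C J ++ rep n' J ++ M) w /\ v = prodsys i * w].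

Lemma count_e j : count_mem j e = (j \in J).
Proof. by rewrite /e count_uniq_mem ?enum_uniq // mem_enum. Qed.

(** Row [i0] is complete and gives [prodsys f J i0]. In each of the [n'] other rows the head and the
    tail together make up one copy of the product over [J]. *)
Lemma pigeonhole_base s M u i0 : s i0 = r -> MI (rep C J ++ tailseq s ++ M) u ->
  prodideal M (headprod s * u).
Proof.
move=> s0 hu; rewrite /headprod (bigD1 i0) //= s0 take_size -mulrA.
apply: sidl_gen; exists i0; eexists; split; last first.
  by rewrite /prodsys big_enum.
rewrite -big_filter.
set I := [seq i <- index_enum _ | i != i0].
have hp := @monideal_prod 'I_n I (fun i => flatten [seq [:: j] | j <- take (s i) e])
  (fun i => \prod_(j <- take (s i) e) f i j) (fun i => @monideal_prod 'I_n (take (s i) e) (fun j => [:: j]) (f i) (@fA i)).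
apply: monideal_count (monidealM hp hu) => j.
rewrite !count_cat !count_rep /tailseq !count_flatten_map.
rewrite (eq_bigr (fun i => count_mem j (take (s i) e))) => [|i _]; last first.
  by rewrite count_flatten_map -sumn_count sumnE big_map; apply: eq_bigr => k _ /=; rewrite addn0.
rewrite /I big_filter big_enum /= (bigD1 i0 (P := xpredT)) //=.
have key : (n' * (j \in J) <= \sum_(i | i != i0) count_mem j (take (s i) e) +
    \sum_(i | i != i0) count_mem j (drop (s i) e))%N.
  have -> : (n' * (j \in J) = \sum_(i | i != i0) (j \in J))%N.
    by rewrite sum_nat_const (eq_card (B := predC1 i0)) // cardC1 card_ord.
  rewrite -big_split; apply: leq_sum => i _ /=.
  by rewrite -count_cat cat_take_drop count_e.
move: key; move: (\sum_(i | i != i0) count_mem j (take (s i) e))%N => x.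
move: (\sum_(i | i != i0) count_mem j (drop (s i) e))%N (n' * _)%N => y z.
by move: (count_mem j M) (count _ _) (C * _)%N => u1 u2 u3; lia.
Qed.

(* Each use of the joint reduction of a system [i |-> f i (sg i)] extends one of the
   partial products [prod_(j <- take (s i) e) f i j] by a factor. *)
Lemma pigeonhole k s M u : (\sum_i (r - s i) = k)%N -> (forall i, s i <= r)%N ->
  MI (rep C J ++ tailseq s ++ M) u -> prodideal M (headprod s * u).
Proof.
elim: k s u => [|k IH] s u sk sr hu.
  have : (r - s ord0 == 0)%N.
    by move/eqP: sk; rewrite sum_nat_eq0 => /forallP/(_ ord0).
  rewrite subn_eq0 => h; apply: (pigeonhole_base (i0 := ord0)) hu.
  by apply/eqP; rewrite eqn_leq sr h.
have [i0 /eqP si0|lt] := pickP (fun i => s i == r); first exact: pigeonhole_base si0 hu.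
have {}lt i : (s i < r)%N by rewrite ltn_neqAle lt sr.
(* The next missing factor of every row; it exists since no row is complete. *)
pose sg := [ffun i => nth ord0 e (s i)].
have sge i : drop (s i) e = sg i :: drop (s i).+1 e by rewrite ffunE; apply: drop_nth; apply: lt.
have sJ i : sg i \in J by rewrite ffunE -mem_enum mem_nth //; apply: lt.
have sM i : sg i \in tailseq s ++ M.
  rewrite mem_cat; apply/orP; left; apply/flattenP; exists (drop (s i) e).
    by apply/mapP; exists i => //; rewrite mem_enum.
  by rewrite sge inE eqxx.
have [q [g [uq hg eg]]] := joint_red_step sJ sM hu.
apply: (sidl_unit uq); rewrite mulrCA eg mulr_sumr.
apply: ideal_sum => [|i _]; first exact: sidl_ideal.
pose s' j := (s j + (j == i))%N.
have -> : headprod s * (f i (sg i) * g i) = headprod s' * g i.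
  rewrite mulrA; congr (_ * _); rewrite /headprod !(bigD1 i (P := xpredT)) //= mulrAC /s'.
  rewrite eqxx addn1; congr (_ * _); last by apply: eq_bigr => j /negbTE ->; rewrite addn0.
  rewrite (take_nth ord0) // ; by rewrite -cats1 big_cat big_seq1 ffunE.
apply: IH.
- have : (\sum_i (r - s' i) + 1 = \sum_i (r - s i))%N; last by rewrite sk addn1 => -[].
  rewrite (bigD1 i) //= [RHS](bigD1 i) //= addnAC; congr addn.
    by rewrite /s' eqxx; have := lt i; lia.
  by apply: eq_bigr => j /negbTE e'; rewrite /s' e' addn0.
- by move=> j; rewrite /s'; case: eqP => [->|_]; rewrite ?addn1 ?addn0.
apply: monideal_count (hg i) => j; rewrite !count_cat count_rem sM /= count_cat.
suff : (count_mem j (tailseq s) = count_mem j (tailseq s') + (sg i == j))%N.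
  move=> ->; rewrite leq_add2l addnAC addnK //.
rewrite /tailseq !count_flatten_map !big_enum /= [LHS](bigD1 i) //= [in RHS](bigD1 i) //= sge.
have -> : s' i = (s i).+1 by rewrite /s' eqxx addn1.
rewrite /= -addnA addnC; congr (_ + _)%N; congr addn.
by apply: eq_bigr => k' /negbTE e'; rewrite /s' e' addn0.
Qed.

Lemma monideal_prodideal M u : MI (rep C J ++ rep n J ++ M) u -> prodideal M u.
Proof.
move=> hu; have -> : u = headprod (fun=> 0%N) * u.
  by rewrite /headprod big1 ?mul1r // => i _; rewrite take0 big_nil.
apply: (pigeonhole (erefl _)) => //; apply: monideal_perm hu.
have h (l : seq 'I_n) : [seq drop 0 e | _ <- l] = nseq (size l) e.
  by elim: l => //= x l ->; rewrite drop0.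
by rewrite /tailseq h size_enum_ord.
Qed.

(** Out of [n] copies of the product over [J], one is traded for an entry of the system and [n']
    survive; [n' + N] copies allow [N] trades. *)
Lemma monideal_powsys N : MI (rep C J ++ rep (n' + N) J) `<=` powsys prodsys N.
Proof.
elim: N => [|N IH] u.
  by move=> _; rewrite -[u]mulr1; apply: sidlM; apply: sidl_gen; exists (fun=> 0%N); rewrite /= ?sum_nat_eq0 // /fmon big1.
have -> : rep (n' + N.+1) J = rep n J ++ rep N J.
  by rewrite addnS -addSn /rep nseqD flatten_cat.
move=> /monideal_prodideal; apply: sidl_sub => _ [i [w [hw ->]]].
apply: powsysS; apply: IH; move: hw.
by rewrite /rep nseqD flatten_cat.
Qed.

End Fixed.
End Products.

(** * Multilinear expansion of the multiplicity *)

Section Expansion.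
Variables (n' : nat) (K : fieldType).
Local Notation n := n'.+1.
Local Notation S := (mpoly n K).
Variables (f : 'I_n -> 'I_n -> S).
Hypothesis cf : forall sg : {ffun 'I_n -> 'I_n}, cof (sys (fun i => f i (sg i))).
Variable J : {set 'I_n}.

Lemma mult_upd_prod (h : 'I_n -> S) i (r : seq 'I_n) (p : 'I_n -> S) :
  (forall j, cof (sys (upd h i (p j)))) ->
  cof (sys (upd h i (\prod_(j <- r) p j))) /\
  mult (upd h i (\prod_(j <- r) p j)) = (\sum_(j <- r) mult (upd h i (p j)))%N.
Proof.
move=> hp; elim: r => [|j r [IH1 IH2]].
  by rewrite !big_nil mult_upd1; split => //; apply: cof_upd1.
by rewrite !big_cons; split; [apply: cof_updM|rewrite mult_updM ?IH2].
Qed.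

Definition updf (sg : {ffun 'I_n -> 'I_n}) t j : {ffun 'I_n -> 'I_n} :=
  [ffun i => if i == t then j else sg i].

(** An intermediate stage: the entries before [t] are single factors chosen by [sg], the others are
    still products. *)
Let mix t (sg : {ffun 'I_n -> 'I_n}) (i : 'I_n) : S :=
  if (i < t)%N then f i (sg i) else prodsys f J i.

Lemma mix_upd (t : 'I_n) sg : mix t sg = upd (mix t.+1 sg) t (\prod_(j <- enum J) f t j).
Proof.
apply/funext => i; rewrite /upd /mix ltnS [(i <= t)%N]leq_eqVlt (inj_eq val_inj).
by have [->|ne] := eqVneq i t; [rewrite ltnn /prodsys big_enum|].
Qed.

Lemma mix_updf (t : 'I_n) sg j : upd (mix t.+1 sg) t (f t j) = mix t.+1 (updf sg t j).
Proof.
apply/funext => i; rewrite /upd /mix ffunE.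
by have [->|ne] := eqVneq i t; rewrite ?ltnSn.
Qed.

Lemma mix_cof t sg : (t <= n)%N -> cof (sys (mix t sg)).
Proof.
move=> le; rewrite -(subKn le); elim: (n - t)%N (leq_subr t n) sg => [|k IH] lk sg.
  rewrite subn0; have -> : mix n sg = fun i => f i (sg i); last exact: cf.
  by apply/funext => i; rewrite /mix ltn_ord.
have lt : (n - k.+1 < n)%N by lia.
rewrite -[(n - k.+1)%N]/(val (Ordinal lt)) mix_upd; apply: (proj1 (mult_upd_prod _ _)) => j.
by rewrite mix_updf /= -subSn // subSS; apply: IH; apply: ltnW.
Qed.

Lemma mult_mix (t : 'I_n) sg : mult (mix t sg) = (\sum_(j in J) mult (mix t.+1 (updf sg t j)))%N.
Proof.
rewrite mix_upd (proj2 (mult_upd_prod _ _)) => [|j]; last by rewrite mix_updf; apply: mix_cof.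
by rewrite big_enum; apply: eq_bigr => j _; rewrite mix_updf.
Qed.

(** The values of [sg] at the unexpanded places are normalised to [ord0], so that each partial
    choice is counted once. *)
Let dom t (sg : {ffun 'I_n -> 'I_n}) :=
  [forall i : 'I_n, if (i < t)%N then sg i \in J else sg i == ord0].

Lemma sum_mix_step (t : 'I_n) :
  (\sum_(sg | dom t sg) mult (mix t sg) = \sum_(sg | dom t.+1 sg) mult (mix t.+1 sg))%N.
Proof.
have domS sg j : j \in J -> dom t sg -> dom t.+1 (updf sg t j).
  move=> jJ /forallP h; apply/forallP => i; rewrite ffunE.
  have [->|ne] := eqVneq i t; first by rewrite ltnSn.
  by have := h i; rewrite ltnS [(i <= t)%N]leq_eqVlt (inj_eq val_inj) (negbTE ne).
have domP sg : dom t.+1 sg -> dom t (updf sg t ord0).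
  move=> /forallP h; apply/forallP => i; rewrite ffunE.
  have [->|ne] := eqVneq i t; first by rewrite ltnn.
  by have := h i; rewrite ltnS [(i <= t)%N]leq_eqVlt (inj_eq val_inj) (negbTE ne).
rewrite [RHS](partition_big (fun sg => updf sg t ord0) (dom t)) //=.
apply: eq_bigr => sg dsg; rewrite mult_mix.
have sgt : sg t = ord0 by have /forallP/(_ t) := dsg; rewrite ltnn => /eqP.
have upup sg' j j' : updf (updf sg' t j) t j' = updf sg' t j'.
  by apply/ffunP => i; rewrite !ffunE; case: eqP.
have upid sg' : updf sg' t (sg' t) = sg'.
  by apply/ffunP => i; rewrite !ffunE; case: eqP => // ->.
rewrite [RHS](reindex_onto (fun j => updf sg t j) (fun sg' => sg' t)) /=; last first.
  by move=> sg' /andP[_ /eqP <-]; rewrite upup upid.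
have sg0 : updf sg t ord0 = sg by have := upid sg; rewrite sgt.
apply: eq_bigl => j; rewrite ffunE eqxx upup sg0 !eqxx !andbT.
apply/idP/idP => [jJ|/forallP/(_ t)]; first exact: domS.
by rewrite ltnSn ffunE eqxx.
Qed.

Lemma mult_prodsys : mult (prodsys f J) =
  (\sum_(sg : {ffun 'I_n -> 'I_n} | [forall i, sg i \in J]) mult (fun i => f i (sg i)))%N.
Proof.
have key t : (t <= n)%N -> mult (prodsys f J) = (\sum_(sg | dom t sg) mult (mix t sg))%N.
  elim: t => [_|t IH lt]; last by rewrite IH ?(ltnW lt) // (sum_mix_step (Ordinal lt)).
  rewrite (big_pred1 [ffun=> ord0]) => [|sg]; first by congr mult.
  apply/forallP/eqP => [h|-> i]; last by rewrite ffunE.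
  by apply/ffunP => i; rewrite ffunE; apply/eqP/h.
rewrite (key n) //; apply: eq_big => [sg|sg _].
  by apply: eq_forallb => i; rewrite ltn_ord.
by congr mult; apply/funext => i; rewrite /mix ltn_ord.
Qed.

End Expansion.

(** The sum is the expansion of a product over the indices, in which every index outside [I]
    contributes the factor [1 - 1]. *)
Lemma altsum_supset (n : nat) (I : {set 'I_n}) :
  \sum_(J : {set 'I_n} | I \subset J) (-1) ^+ (n - #|J|) = (I == finset.setT)%:R :> int.
Proof.
transitivity (\sum_(J in {set 'I_n}) \prod_i (if i \in J then 1 else - (i \notin I)%:R) : int).
  rewrite big_mkcond; apply: eq_big => // J _.
  have [IJ|IJ] := boolP (I \subset J).
    rewrite (bigID (mem J)) /= [X in X * _]big1 => [|i ->] //; rewrite mul1r.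
    rewrite (eq_bigr (fun=> -1)) => [|i /negbTE iJ]; last first.
      by rewrite iJ; case: (boolP (i \in I)) => // /(fintype.subsetP IJ); rewrite iJ.
    rewrite (eq_bigl (mem (~: J)%SET)) => [|i]; last by rewrite !inE.
    by rewrite prodr_const [in RHS]cardsCs finset.setCK card_ord.
  have /subsetPn [i iI iJ] := IJ.
  by rewrite (bigD1 i) //= (negbTE iJ) iI /= oppr0 mul0r.
transitivity (\prod_(i : 'I_n) (1 - (i \notin I)%:R) : int); first by rewrite bigA_distr.
have [->|ne] := eqVneq I finset.setT.
  by rewrite big1 // => i _; rewrite inE /= subr0.
have : I \proper finset.setT by rewrite properT.
by move=> /properP [_ [i _ iI]]; rewrite (bigD1 i) //= iI subrr mul0r.
Qed.

(** * Generic points *)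

Section GenericPoints.
Variables (K : numFieldType) (W : Type).
Local Notation V := (W -> K).
Implicit Types (x y : V) (U : set V).

Definition line x y (s : K) : V := fun w => x w + s * (y w - x w).

(** To intersect two non-empty open sets it is enough to restrict their equations to the line
    through a point of each, where they become non-zero polynomials in one variable; no enumeration
    of variables is needed. *)
Definition polynomial_on_lines (g : V -> K) :=
  forall x y, exists P : {poly K}, forall s, P.[s] = g (line x y s).

Definition generic U := exists g, [/\ polynomial_on_lines g, exists x, g x != 0 &
  forall x, g x != 0 -> U x].

Lemma generic_setI U U' : generic U -> generic U' -> generic (U `&` U').
Proof.
move=> [g [pg [x gx] gU]] [g' [pg' [y gy] gU']].
exists (fun z => g z * g' z); split.
- move=> a b; have [P hP] := pg a b; have [P' hP'] := pg' a b.
  by exists (P * P') => s; rewrite hornerM hP hP'.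
- have [P hP] := pg x y; have [P' hP'] := pg' x y.
  have lx : line x y 0 = x by apply/funext => w; rewrite /line mul0r addr0.
  have ly : line x y 1 = y by apply/funext => w; rewrite /line mul1r addrC subrK.
  have P0 : P != 0 by apply: contraNneq gx => P0; rewrite -lx -hP P0 horner0.
  have P'0 : P' != 0 by apply: contraNneq gy => P0'; rewrite -ly -hP' P0' horner0.
  have [|s] := @poly_nonroot K (P * P'); first by rewrite mulf_neq0.
  by rewrite /root hornerM hP hP' => h; exists (line x y s).
- by move=> z; rewrite mulf_eq0 negb_or => /andP[/gU h /gU' h'].
Qed.

Lemma generic_setT : generic setT.
Proof.
exists (fun=> 1); split=> //; last by exists (fun=> 0); apply: oner_neq0.
by move=> x y; exists 1 => s; rewrite hornerC.
Qed.

Lemma generic_sub U U' : U `<=` U' -> generic U -> generic U'.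
Proof. by move=> UU' [g [h1 h2 h3]]; exists g; split => // x /h3 /UU'. Qed.

Lemma generic_forall (I : finType) (U : I -> set V) : (forall i, generic (U i)) ->
  generic [set x | forall i, U i x].
Proof.
move=> h; suff key (r : seq I) : generic [set x | forall i, i \in r -> U i x].
  by apply: generic_sub (key (enum I)) => x hx k; apply: hx; rewrite mem_enum.
elim: r => [|k r IH]; first by apply: generic_sub generic_setT => x _ k; rewrite in_nil.
apply: generic_sub (generic_setI (h k) IH) => x [h1 h2] j.
by rewrite inE => /predU1P[->|/h2].
Qed.

Lemma generic_ex U : generic U -> exists x, U x.
Proof. by move=> [g [_ [x gx] h]]; exists x; apply: h. Qed.

Lemma generic_meval k (p : mpoly k K) (L : V -> 'I_k -> K) :
  (forall x y s i, L (line x y s) i = L x i + s * (L y i - L x i)) ->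
  (exists x, meval (L x) p != 0) -> generic [set x | meval (L x) p != 0].
Proof.
move=> hL hx; exists (fun x => meval (L x) p); split => // x y.
exists (\sum_(m <- msupp p) (mcoeff m p)%:P * \prod_i ((L x i)%:P + 'X * (L y i - L x i)%:P) ^+ m i).
move=> s; rewrite mevalE horner_sum; apply: eq_bigr => m _.
rewrite hornerM hornerC horner_prod; congr (_ * _); apply: eq_bigr => i _.
by rewrite horner_exp !hornerE hL.
Qed.

End GenericPoints.

(** * Inclusion-exclusion for the generic multiplicity *)

Section GenericMultiplicity.
Variables (n' : nat) (K : numFieldType) (A : 'I_n'.+1 -> {fset multinom n'.+1}).
Local Notation n := n'.+1.
Local Notation S := (mpoly n K).
Local Notation T := (coef_index A).
Local Notation MI L := (@monideal n K A L).
Hypothesis H3 : forall i j, exists2 mu : nat,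
  (0 < mu)%N & mnm_muln (mnm1 i) mu \in A j.

Definition colength J N : nat := codimn (MI (rep N J)).

Lemma support_ne j : exists t : T, tag t = j.
Proof.
have [mu _ h] := H3 ord0 j.
by exists (Tagged (fun j => A j) [` h]%fset).
Qed.

(** The [N.+1]-st power of the ideal of the product system, whose codimension is known from
    [codim_powsys], lies between two powers of the product of the monomial ideals, with exponents
    differing by a constant. *)
Lemma prodsys_bounds (f : 'I_n -> 'I_n -> S) J :
  (forall i j, MI [:: j] (f i j)) ->
  (forall sg : {ffun 'I_n -> 'I_n}, exists L, joint_red (fun i => A (sg i)) (fun i => f i (sg i)) L) ->
  exists C, forall N, (colength J N.+1 <= 'C(n + N, n) * mult (prodsys f J) <= colength J (N + C))%N.
Proof.
move=> fA fJ.
have H3' (sg : {ffun 'I_n -> 'I_n}) : forall i j, exists2 mu : nat, (0 < mu)%N & mnm_muln (mnm1 i) mu \in A (sg j).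
  by move=> i j; apply: H3.
have cf (sg : {ffun 'I_n -> 'I_n}) : cof (sys (fun i => f i (sg i))).
  by have [L hL] := fJ sg; apply: joint_red_cof hL; apply: H3'.
have [C hC] := uniform_L (fun sg (_ : forall i, sg i \in J) => fJ sg).
have cF : cof (sys (prodsys f J)).
  have sub : MI (rep C J ++ rep (n' + 1) J) `<=` sys (prodsys f J).
    move=> u /(monideal_powsys fA hC); apply: sidl_sub => _ [al hal <-].
    have [i ali|al0] := pickP (fun i => 0 < al i)%N; last first.
      by move: hal; rewrite /= big1 // => i _; move/negbT: (al0 i); rewrite -eqn0Ngt => /eqP.
    rewrite /fmon (bigD1 i) //= -(prednK ali) exprSr -mulrA mulrCA; apply: sidlMr.
    by apply: sidl_gen; exists i.
  exact: cof_sub sub (monideal_cof K H3 _).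
exists (C + n).+1 => N; rewrite -codim_powsys //; apply/andP; split; apply: leq_codimn.
- exact: sidl_ideal.
- exact: monideal_ideal.
- apply: cof_sub (monideal_cof K H3 (rep C J ++ rep (n' + N.+1) J)).
  exact: monideal_powsys.
- apply: sidl_min; first exact: monideal_satid.
  move=> _ [al hal <-].
  have hp : MI (flatten [seq flatten (nseq (al i) (enum J)) | i <- enum 'I_n])
      (\prod_(i <- enum 'I_n) prodsys f J i ^+ al i).
    apply: monideal_prod => i; apply: monideal_exp; rewrite /prodsys -big_enum.
    have := @monideal_prod _ _ A _ (enum J) (fun j => [:: j]) (f i) (@fA i).
    by apply: monideal_count => j; rewrite count_flatten_map -sumn_count sumnE big_map; apply/eq_leq/eq_bigr => k _ /=; rewrite addn0.
  rewrite /fmon -big_enum; apply: monideal_count hp => j.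
  rewrite count_rep count_flatten_map big_enum /=.
  have e i : count_mem j (flatten (nseq (al i) (enum J))) = (al i * (j \in J))%N by apply: (count_rep _ J).
  by under eq_bigr => i _ do rewrite e; rewrite -big_distrl leq_mul2r hal orbT.
- exact: monideal_ideal.
- exact: sidl_ideal.
- exact: monideal_cof.
- move=> u hu; apply: (monideal_powsys fA hC); apply: monideal_count hu => j.
  rewrite count_cat !count_rep -mulnDl leq_mul2r; apply/orP; right; lia.
Qed.

(** The vector [c] is fixed first. The array of polynomials [f i j] is chosen afterwards, generic
    with respect to [c], so that each choice of one index per row is a joint reduction and each
    permutation is linked to [c] by hybrids. *)
Theorem generic_mult : exists p : mpoly #|{: T}| K,
  (exists c : T -> K, meval (c \o enum_val) p != 0) /\
  forall c : T -> K, meval (c \o enum_val) p != 0 ->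
  cof (sys (spoly c)) /\ exists (C : nat) (D : {set 'I_n} -> nat),
    (forall J N, (colength J N.+1 <= 'C(n + N, n) * D J <= colength J (N + C))%N) /\
    \sum_(J : {set 'I_n}) (-1) ^+ (n - #|J|) * (D J)%:Z = (n`! * mult (spoly c))%N%:Z.
Proof.
have [LA [pA [[cA hcA] hpA]]] := generic_joint_red K support_ne.
exists pA; split; first by exists cA.
move=> c hc; have jrc := hpA c hc; split; first exact: joint_red_cof jrc.
pose W := ('I_n * T)%type.
(* Each row [i] of the array has its own coefficients, so the same support may be chosen in several
   rows without sharing any. *)
pose slot (sg : 'I_n -> 'I_n) (t : coef_index (fun i => A (sg i))) : W :=
  (tag t, Tagged (fun j => A j) (tagged t : A (sg (tag t)))).
have slot_inj sg : injective (@slot sg).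
  move=> t t' /= e; apply: texp_inj; first exact: (congr1 fst e).
  by have := congr1 (fun w : W => texp w.2) e.
pose cs (cc : W -> K) (sg : 'I_n -> 'I_n) (t : coef_index (fun i => A (sg i))) : K := cc (@slot sg t).
have good1 (sg : {ffun 'I_n -> 'I_n}) :
    generic [set cc | exists L, joint_red (fun i => A (sg i)) (spoly (@cs cc sg)) L].
  have ne : forall j, exists t : coef_index (fun i => A (sg i)), tag t = j.
    move=> j; have [mu _ h] := H3 ord0 (sg j).
    by exists (Tagged (fun j => A (sg j)) [` h]%fset).
  have [L [p [[d hd] hp]]] := generic_joint_red K ne.
  apply: (@generic_sub _ _ [set cc | meval (@cs cc sg \o enum_val) p != 0]).
    by move=> cc /hp h; exists L.
  apply: generic_meval => //.
  exists (fun w => if [pick t | @slot sg t == w] is Some t then d t else 0).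
  rewrite (_ : _ \o _ = d \o enum_val) //; apply/funext => k; rewrite /cs /=.
  case: pickP => [t /eqP /slot_inj -> //|/(_ (enum_val k))]; by rewrite eqxx.
(* Hybrids between [c] and the polynomials of the array picked by a permutation. Copying [c] into
   every row makes each hybrid equal to [c], so the open condition on the array is non-empty. *)
pose hyb (cc : W -> K) (pi : {perm 'I_n}) t (tau : T) : K :=
  if (tag tau < t)%N then cc (pi^-1%g (tag tau), tau) else c tau.
have good2 (pt : {perm 'I_n} * 'I_n.+1) :
    generic [set cc | meval (hyb cc pt.1 pt.2 \o enum_val) pA != 0].
  apply: generic_meval => [x y s k|]; last first.
    exists (fun w => c w.2); rewrite (_ : _ \o _ = c \o enum_val) //.
    by apply/funext => k; rewrite /hyb /=; case: ifP.
  by rewrite /hyb /=; case: ifP => // _; rewrite subrr mulr0 addr0.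
have [cc [/= h1 h2]] := generic_ex (generic_setI (generic_forall good1) (generic_forall good2)).
pose f i j : S := spoly (fun t => cc (i, t)) j.
have fA i j : MI [:: j] (f i j) by apply: monideal_spoly.
have fJ (sg : {ffun 'I_n -> 'I_n}) : exists L,
    joint_red (fun i => A (sg i)) (fun i => f i (sg i)) L.
  exact: h1 sg.
have cf (sg : {ffun 'I_n -> 'I_n}) : cof (sys (fun i => f i (sg i))).
  have [L hL] := fJ sg; apply: joint_red_cof hL => i j; exact: H3.
have /choice [Cf hCf] : forall J, exists C, forall N,
    (colength J N.+1 <= 'C(n + N, n) * mult (prodsys f J) <= colength J (N + C))%N.
  by move=> J; apply: prodsys_bounds.
exists (\max_J Cf J)%N, (fun J => mult (prodsys f J)); split=> [J N|].
  have /andP[-> h] := hCf J N; apply: (leq_trans h); apply: leq_codimn.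
  - exact: monideal_ideal.
  - exact: monideal_ideal.
  - exact: monideal_cof.
  - move=> u; apply: monideal_count => j; rewrite !count_rep leq_mul2r leq_add2l.
    by rewrite (leq_bigmax J (F := Cf)) orbT.
have inj_mult (sg : {ffun 'I_n -> 'I_n}) : injective sg ->
    mult (fun i => f i (sg i)) = mult (spoly c).
  move=> isg; pose pi := perm isg.
  rewrite (@mult_eq_hybrid _ _ A H3 (spoly c) (fun j => f (pi^-1%g j) j)).
  - rewrite /mult; congr codimn; apply/seteqP; split; apply: sidl_sub => _ [k _ <-]; apply: sidl_gen.
      by exists (sg k) => //; rewrite -(permE isg) -/pi permK.
    by exists (pi^-1%g k) => //; rewrite -(permE isg) -/pi permKV.
  - by move=> i; apply: monideal_spoly.
  - by move=> i; apply: fA.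
  move=> t; exists LA; have [tn|tn] := leqP t n.
    have := hpA _ (h2 (pi, Ordinal (tn : (t < n.+1)%N))); rewrite /=; congr joint_red.
    by apply/funext => j; rewrite /f /spoly /hyb /=; case: ifP.
  have := hpA _ (h2 (pi, ord_max)); rewrite /=; congr joint_red.
  apply/funext => j; rewrite /f /spoly /hyb /= ltn_ord; case: ifP => //.
  by rewrite (ltn_trans _ tn).
have prodE J : (mult (prodsys f J))%:Z =
    \sum_(sg : {ffun 'I_n -> 'I_n} | (sg @: finset.setT \subset J)%SET) (mult (fun i => f i (sg i)))%:Z.
  rewrite (mult_prodsys cf) (big_morph Posz PoszD (erefl _)); apply: eq_bigl => sg.
  apply/forallP/fintype.subsetP => [h _ /imsetP[i _ ->] //|h i].
  by apply: h; apply/imsetP; exists i.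
under eq_bigr => J _ do rewrite prodE mulr_sumr.
(* For a fixed [sg] the alternating sum over the [J] containing its image vanishes unless [sg] is
   surjective; the [n!] permutations remain, each with the multiplicity of [spoly c]. *)
rewrite (exchange_big_dep xpredT) //=.
under eq_bigr => sg _ do rewrite -mulr_suml altsum_supset.
rewrite (bigID (fun sg : {ffun 'I_n -> 'I_n} => injectiveb sg)) /= [X in _ + X]big1 ?addr0; last first.
  move=> sg nsg; case: eqP => [e|]; last by rewrite mul0r.
  have /imset_injP h : #|(sg @: finset.setT)%SET| == #|[set: 'I_n]%SET| by rewrite e.
  by case/injectiveP: nsg => x y; apply: h; rewrite inE.
rewrite (eq_bigr (fun=> (mult (spoly c))%:Z)) => [|sg /injectiveP isg]; last first.
  rewrite inj_mult // (_ : _ == _) ?mul1r //.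
  by rewrite eqEcard finset.subsetT /= card_imset.
rewrite sumr_const -(eq_card (A := [set sg : {ffun 'I_n -> 'I_n} | injectiveb sg]%SET)); last first.
  by move=> sg; rewrite inE.
by rewrite card_inj_ffuns card_ord ffactnn PoszM mulrC -mulr_natr natz.
Qed.

End GenericMultiplicity.

Import numFieldNormedType.Exports.

(** * Lower envelopes and inf-convolutions *)

Section LinearProgram.
Variable R : realType.

Lemma continuous_combination (T : topologicalType) (I : Type) (r : seq I)
    (c : I -> R) (f : I -> T -> R) :
  (forall i, continuous (f i)) -> continuous (fun x => \sum_(i <- r) c i * f i x).
Proof.
move=> fc; elim: r => [|i r IH] x.
  by under eq_fun do rewrite big_nil; exact: cvg_cst.
under eq_fun do rewrite big_cons.
by apply: cvgD; [apply: cvgM; [exact: cvg_cst|exact: fc]|exact: IH].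
Qed.

Lemma continuous_linear_form N (c : 'I_N -> R) :
  continuous (fun la : 'rV[R]_N => \sum_i c i * la 0 i).
Proof.
exact: (@continuous_combination 'rV[R]_N _ _ c (fun i (x : 'rV[R]_N) => x 0 i)
  (fun i => @coord_continuous R 1 N 0 i)).
Qed.

(** The bounds on the coordinates make the feasible set compact. *)
Lemma lp_min N (I : Type) (M : I -> 'I_N -> R) (v : I -> R) (c : 'I_N -> R) :
  let feas la := (forall i, 0 <= la i <= 1) /\ forall k, \sum_i M k i * la i <= v k in
  (exists la, feas la) ->
  exists la, feas la /\ forall la', feas la' -> \sum_i c i * la i <= \sum_i c i * la' i.
Proof.
move=> feas [la0 hla0].
pose A : set 'rV[R]_N := [set x | forall i, `[0, 1]%classic (x ord0 i)] `&`
  \bigcap_(k in setT) [set x | \sum_i M k i * x 0 i <= v k].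
have A0 : A !=set0.
  exists (\row_i la0 i); split; first by move=> i; rewrite /= mxE in_itv; exact: (proj1 hla0 i).
  by move=> k _ /=; rewrite (eq_bigr (fun i => M k i * la0 i)) => [|i _]; [apply: (proj2 hla0)|rewrite mxE].
have cA : compact A.
  apply: compact_closedI.
    exact: (@rV_compact R N (fun=> `[0, 1]%classic) (fun=> @segment_compact R 0 1)).
  apply: closed_bigI => k _; apply: (preimage_closed _ (@closed_le _ (v k))).
  by move=> x _; apply: continuous_linear_form.
have [x Ax hx] := EVT_min_rV A0 cA (continuous_subspaceT (@continuous_linear_form N c)).
exists (fun i => x 0 i); move: Ax; rewrite inE => -[h1 h2]; split.
  by split=> [i|k]; [have := h1 i; rewrite /= in_itv|apply: (h2 k)].
move=> la [k1 k2]; have := hx (\row_i la i); rewrite inE.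
have -> : \sum_i c i * (\row_i la i : 'rV[R]_N) 0 i = \sum_i c i * la i.
  by apply: eq_bigr => i _; rewrite mxE.
apply; split; first by move=> i; rewrite /= mxE in_itv; exact: k1.
by move=> k _ /=; rewrite (eq_bigr (fun i => M k i * la i)) => [|i _]; [apply: k2|rewrite mxE].
Qed.

Lemma set_minP (S : set R) s : S s -> lbound S s -> set_min S = s.
Proof.
move=> Ss ls; rewrite /set_min; apply: xget_unique; first by split.
by move=> t [St lt]; apply/eqP; rewrite eq_le lt //= ls.
Qed.

Lemma set_min_nat (P : set nat) : P !=set0 ->
  exists2 k, P k & set_min [set k%:R | k in P] = k%:R :> R.
Proof.
move=> [k0 Pk0]; have ex : exists k, `[< P k >] by exists k0; apply/asboolP.
case: (ex_minnP ex) => k /asboolP Pk hk; exists k => //; apply: set_minP; first by exists k.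
by move=> _ [l Pl <-]; rewrite ler_nat; apply: hk; apply/asboolP.
Qed.

End LinearProgram.

Section ConvexHull.
Variables (R : realType) (V : lmodType R).

Lemma conv_hull_sub (S C : set V) :
  (forall k (p : 'I_k -> V) (w : 'I_k -> R), (forall i, C (p i)) ->
     (forall i, 0 <= w i) -> \sum_i w i = 1 -> C (\sum_i w i *: p i)) ->
  S `<=` C -> conv_hull S `<=` C.
Proof. by move=> hC SC x [k [p [w [hp hw sw ->]]]]; apply: hC => // i; apply/SC/hp. Qed.

End ConvexHull.

Section SimplexAndPolytope.
Variables (R : realType) (m : nat).
Local Notation n := m.+1.

Lemma newton_polytopeP (A : {fset multinom n}) (x : 'rV[R]_n) :
  newton_polytope R A x <-> exists la : A -> R,
    [/\ forall a, 0 <= la a, \sum_a la a = 1 &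
        forall i, x 0 i = \sum_a la a * (fun_of_multinom (val a) i)%:R].
Proof.
split.
  move=> [k [p [w [hp hw sw ->]]]].
  have /choice [a ha] : forall i, exists a : A, exp_row R (val a) = p i.
    by move=> i; have [a /= aA <-] := hp i; exists [` aA]%fset.
  exists (fun a' => \sum_(i | a i == a') w i); split.
  - by move=> a'; apply: sumr_ge0.
  - by rewrite -sw [RHS](partition_big a xpredT) //=; apply: eq_bigr.
  - move=> i; rewrite summxE [LHS](partition_big a xpredT) //=; apply: eq_bigr => a' _.
    rewrite mulr_suml; apply: eq_bigr => j /eqP <-.
    by rewrite -ha !mxE.
move=> [la [h0 h1 hx]]; pose e (i : 'I_#|{: A}|) : A := enum_val i.
exists #|{: A}|, (fun i => exp_row R (val (e i))), (fun i => la (e i)); split.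
- by move=> i; exists (val (e i)) => //=; apply: valP.
- by move=> i.
- by rewrite -h1 [RHS](reindex e) //=; apply: onW_bij; exact: enum_val_bij.
- apply/rowP => i; rewrite hx summxE [LHS](reindex e) /=; last by apply: onW_bij; exact: enum_val_bij.
  by apply: eq_bigr => j _; rewrite !mxE.
Qed.

Lemma newton_polytope_mem (A : {fset multinom n}) a : a \in A -> newton_polytope R A (exp_row R a).
Proof.
move=> aA; exists 1%N, (fun=> exp_row R a), (fun=> 1); split => //.
- by move=> _; exists a.
- by rewrite big_ord1.
- by rewrite big_ord1 scale1r.
Qed.

Lemma proj_simplexP (la : 'I_n -> R) (y : 'rV[R]_m) : (forall i, 0 < la i) ->
  [set proj_last x | x in conv_hull (0 |` [set la i *: delta_mx 0 i | i in setT])] y <->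
  (forall i, 0 <= y 0 i) /\ \sum_i y 0 i / la (lift ord_max i) <= 1.
Proof.
move=> la0; split.
  move=> [x hx <-].
  pose C : set 'rV[R]_n := [set x | (forall i, 0 <= x 0 i) /\ \sum_i x 0 i / la i <= 1].
  have : C x.
    apply: conv_hull_sub hx => [k p w hp hw sw|z [->|[i _ <-]]].
    - split=> [i|].
        rewrite summxE; apply: sumr_ge0 => j _; rewrite mxE mulr_ge0 //.
        by case: (hp j).
      under eq_bigr => i _ do rewrite summxE mulr_suml.
      rewrite exchange_big /= -sw; apply: ler_sum => j _.
      rewrite (eq_bigr (fun i => w j * (p j 0 i / la i))) => [|i _]; last by rewrite mxE mulrA.
      by rewrite -mulr_sumr ler_piMr //; case: (hp j).
    - by split=> [i|]; [rewrite mxE|rewrite big1 // => i _; rewrite mxE mul0r].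
    - split=> [j|]; first by rewrite !mxE mulr_ge0 // ?ler0n // ltW.
      rewrite (bigD1 i) //= !mxE !eqxx mulr1 divff ?gt_eqF // big1 ?addr0 // => j ji.
      by rewrite !mxE (negbTE ji) andbF mulr0 mul0r.
  move=> [h1 h2]; split=> [i|]; first by rewrite mxE.
  apply: le_trans h2; rewrite [leRHS](bigD1_ord ord_max) //= -[leLHS]add0r lerD //.
    by rewrite divr_ge0 // ltW.
  by apply: ler_sum => i _; rewrite mxE.
move=> [y0 y1].
(* Barycentric coordinates; the slack of the inequality is the weight of the vertex 0, which takes
   the place of the vertex on the last axis. *)
pose w (k : 'I_n) : R := if unlift ord_max k is Some i then y 0 i / la k
  else 1 - \sum_i y 0 i / la (lift ord_max i).
pose p (k : 'I_n) : 'rV[R]_n := if unlift ord_max k is Some i then la k *: delta_mx 0 k else 0.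
exists (\sum_k w k *: p k).
  exists n, p, w; split => //.
  - by move=> k; rewrite /p; case: unliftP => [i _|_]; [right; exists k|left].
  - move=> k; rewrite /w; case: unliftP => [i _|_]; first by rewrite divr_ge0 // ltW.
    by rewrite subr_ge0.
  - rewrite (bigD1_ord ord_max) //= {1}/w unlift_none.
    under [X in _ + X]eq_bigr => i _ do rewrite /w liftK.
    by rewrite subrK.
apply/rowP => i; rewrite mxE summxE (bigD1_ord ord_max) //= {1}/p unlift_none scaler0 mxE add0r.
rewrite (bigD1 i) //= /w /p liftK scalerA divfK ?gt_eqF // !mxE !eqxx mulr1 big1 ?addr0 //.
move=> k ki; rewrite liftK scalerA divfK ?gt_eqF // !mxE.
by rewrite (inj_eq lift_inj) eq_sym (negbTE ki) andbF mulr0.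
Qed.

End SimplexAndPolytope.

Section Geometry.
Variables (R : realType) (m : nat).
Local Notation n := m.+1.
Variable A : 'I_n -> {fset multinom n}.
Hypothesis H3 : forall i j, exists2 mu : nat,
  (0 < mu)%N & mnm_muln (mnm1 i) mu \in A j.

Local Notation T := (coef_index A).
Local Notation Q j := (newton_polytope R (A j)).
Local Notation P := (fun j => [set proj_last x | x in axis_simplex (Q j)] : set 'rV[R]_m).
Local Notation rho := (fun j => lower_envelope (Q j)).
Local Notation up i := (lift ord_max i).

Definition axlen j i : R := axis_min (Q j) i.

Lemma axlenP j i : 0 < axlen j i /\ Q j (axlen j i *: delta_mx 0 i).
Proof.
rewrite /axlen /axis_min; set S := [set mu : nat | _ ].
have [mu mu0 hmu] := H3 i j.
have [|k [k0 Qk] ->] := @set_min_nat R S; last by rewrite ltr0n.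
exists mu; split => //.
suff -> : mu%:R *: delta_mx 0 i = exp_row R (mnm_muln (mnm1 i) mu) by exact: newton_polytope_mem.
apply/rowP => k; rewrite !mxE /= mulmnE mnm1E.
by rewrite eq_sym natrM mulrC.
Qed.

(** On the non-negative orthant it cuts out [P j] by the bound 1, with equality on the face opposite
    to the origin. *)
Definition simplex_gauge j (y : 'rV[R]_m) : R := \sum_i y 0 i / axlen j (up i).

Lemma PP j y : P j y <-> (forall i, 0 <= y 0 i) /\ simplex_gauge j y <= 1.
Proof. by apply: proj_simplexP => i; case: (axlenP j i). Qed.

(** The point of height [t] over [y] lies in the polytope; the weights are indexed by the support
    itself, which makes minimal heights a linear program. *)
Definition slice j (y : 'rV[R]_m) (t : R) := exists w : A j -> R,
  [/\ forall a, 0 <= w a, \sum_a w a = 1,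
      forall i, y 0 i = \sum_a w a * (fun_of_multinom (val a) (up i))%:R &
      t = \sum_a w a * (fun_of_multinom (val a) ord_max)%:R].

Lemma sliceP j y t : slice j y t <->
  exists q, [/\ Q j q, proj_last q = y & q 0 ord_max = t].
Proof.
split.
  move=> [w [w0 w1 hy ht]].
  exists (\row_i \sum_a w a * (fun_of_multinom (val a) i)%:R); split.
  - by apply/newton_polytopeP; exists w; split => // i; rewrite mxE.
  - by apply/rowP => i; rewrite !mxE hy.
  - by rewrite mxE ht.
move=> [q [/newton_polytopeP [w [w0 w1 hq]] <- <-]]; exists w; split => //.
by move=> i; rewrite mxE hq.
Qed.

Lemma slice_ge0 j y t : slice j y t -> (forall i, 0 <= y 0 i) /\ 0 <= t.
Proof.
move=> [w [w0 _ hy ->]]; split=> [i|]; first rewrite hy;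
  by apply: sumr_ge0 => a _; rewrite mulr_ge0.
Qed.

Lemma slice_comb k j (mu : 'I_k -> R) y t : (forall i, 0 <= mu i) -> \sum_i mu i = 1 ->
  (forall i, slice j (y i) (t i)) -> slice j (\sum_i mu i *: y i) (\sum_i mu i * t i).
Proof.
move=> mu0 mu1 /choice [w hw]; exists (fun a => \sum_i mu i * w i a); split.
- by move=> a; apply: sumr_ge0 => i _; rewrite mulr_ge0 //; case: (hw i).
- rewrite exchange_big /= -mu1; apply: eq_bigr => i _; rewrite -mulr_sumr.
  by case: (hw i) => _ -> _ _; rewrite mulr1.
- move=> l; rewrite summxE; under [RHS]eq_bigr => a _ do rewrite mulr_suml.
  rewrite exchange_big /=; apply: eq_bigr => i _; rewrite mxE.
  case: (hw i) => _ _ -> _; rewrite mulr_sumr.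
  by apply: eq_bigr => a _; rewrite mulrA.
- under [RHS]eq_bigr => a _ do rewrite mulr_suml.
  rewrite exchange_big /=; apply: eq_bigr => i _.
  case: (hw i) => _ _ _ ->; rewrite mulr_sumr.
  by apply: eq_bigr => a _; rewrite mulrA.
Qed.

Lemma slice_conv j s y1 t1 y2 t2 : 0 <= s <= 1 -> slice j y1 t1 -> slice j y2 t2 ->
  slice j (s *: y1 + (1 - s) *: y2) (s * t1 + (1 - s) * t2).
Proof.
move=> /andP [s0 s1] h1 h2.
have := @slice_comb 2 j (fun i => if val i == 0%N then s else 1 - s)
  (fun i => if val i == 0%N then y1 else y2) (fun i => if val i == 0%N then t1 else t2).
rewrite !big_ord_recl !big_ord0 /= !addr0; apply; last by move=> i; case: ifP.
  by move=> i; case: ifP; rewrite ?subr_ge0.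
by rewrite addrC subrK.
Qed.

Lemma slice_eq j y y' t t' : y = y' -> t = t' -> slice j y t -> slice j y' t'.
Proof. by move=> -> ->. Qed.

(** A convex combination of the axis points, the slack going to the last axis. On the face where the
    gauge is 1 the height is 0. *)
Lemma slice_simplex j y : P j y -> slice j y ((1 - simplex_gauge j y) * axlen j ord_max).
Proof.
move=> /PP [y0 y1].
pose mu (k : 'I_n) : R := if unlift ord_max k is Some i then y 0 i / axlen j k else 1 - simplex_gauge j y.
have hs (k : 'I_n) : slice j (proj_last (axlen j k *: delta_mx 0 k))
   ((axlen j k *: delta_mx 0 k : 'rV[R]_n) 0 ord_max).
  by apply/sliceP; exists (axlen j k *: delta_mx 0 k); split => //; case: (axlenP j k).
have mu0 k : 0 <= mu k.
  rewrite /mu; case: unliftP => [i _|_]; last by rewrite subr_ge0.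
  by rewrite divr_ge0 // ltW; case: (axlenP j k).
have mu1 : \sum_i mu i = 1.
  rewrite (bigD1_ord ord_max) //= {1}/mu unlift_none.
  under [X in _ + X]eq_bigr => i _ do rewrite /mu liftK.
  by rewrite subrK.
have nm1 (i : 'I_m) : (up i == ord_max) = false by rewrite eq_sym; exact/negbTE/neq_lift.
have nm2 (i : 'I_m) : (ord_max == up i) = false by exact/negbTE/neq_lift.
apply: (slice_eq _ _ (slice_comb mu0 mu1 hs)).
  rewrite (bigD1_ord ord_max) //=; apply/rowP => i.
  rewrite mxE summxE (bigD1 i) //= /mu liftK.
  rewrite !mxE !eqxx nm1 andbF !mulr0 add0r mulr1 divfK; last by case: (axlenP j (up i)) => /lt0r_neq0.
  rewrite big1 ?addr0 // => k ki; rewrite !mxE (inj_eq lift_inj) eq_sym (negbTE ki) andbF.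
  by rewrite !mulr0.
rewrite (bigD1_ord ord_max) //= {1}/mu unlift_none !mxE !eqxx mulr1 big1 ?addr0 // => k _.
by rewrite !mxE nm2 andbF !mulr0.
Qed.

End Geometry.

Section Minimum.
Variables (R : realType) (m : nat).
Local Notation n := m.+1.
Variable A : 'I_n -> {fset multinom n}.
Hypothesis H3 : forall i j, exists2 mu : nat,
  (0 < mu)%N & mnm_muln (mnm1 i) mu \in A j.

Local Notation T := (coef_index A).
Local Notation Q j := (newton_polytope R (A j)).
Local Notation P := (fun j => [set proj_last x | x in axis_simplex (Q j)] : set 'rV[R]_m).
Local Notation rho := (fun j => lower_envelope (Q j)).
Local Notation up i := (lift ord_max i).
Local Notation axlen := (@axlen R m A).
Local Notation gauge := (@simplex_gauge R m A).
Local Notation slice := (@slice R m A).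

Definition wdeg (w : T -> R) j : R := \sum_(s : T | tag s == j) w s.
Definition wpt (w : T -> R) j (i : 'I_n) : R := \sum_(s : T | tag s == j) w s * (texp s i)%:R.

Lemma sum_tag (j : 'I_n) (F : T -> R) :
  \sum_(s : T | tag s == j) F s = \sum_(a : A j) F (Tagged (fun j => A j) a).
Proof.
have := @sig_big_dep R 0 (+%R) 'I_n (fun j => A j) (pred1 j) (fun _ _ => true)
  (fun j a => F (Tagged (fun j => A j) a)).
rewrite big_pred1_eq => ->; apply: eq_big => [s|[j' a] _] //=.
by rewrite andbT.
Qed.

Lemma sum_tag_in (J : {set 'I_n}) (F : T -> R) :
  \sum_(j in J) \sum_(s : T | tag s == j) F s = \sum_(s : T | tag s \in J) F s.
Proof.
rewrite [RHS](partition_big tag (mem J)) //=; apply: eq_bigr => j jJ.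
by apply: eq_bigl => s; case: eqP => [->|_]; rewrite ?jJ ?andbF.
Qed.

Lemma slices_weights (J : {set 'I_n}) y t : (forall j, j \in J -> slice j (y j) (t j)) <->
  exists2 w : T -> R, forall s, 0 <= w s & forall j, j \in J ->
    [/\ wdeg w j = 1, forall i, y j 0 i = wpt w j (up i) & t j = wpt w j ord_max].
Proof.
split=> [h|[w w0 h] j jJ]; last first.
  have [h1 h2 h3] := h j jJ; exists (fun a => w (Tagged (fun j => A j) a)); split => //.
  - by rewrite -h1 /wdeg sum_tag.
  - by move=> i; rewrite h2 /wpt sum_tag.
  - by rewrite h3 /wpt sum_tag.
have W j : {w : A j -> R | (forall a, 0 <= w a) /\ (j \in J ->
   [/\ \sum_a w a = 1,
      forall i, y j 0 i = \sum_a w a * (fun_of_multinom (val a) (up i))%:R &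
      t j = \sum_a w a * (fun_of_multinom (val a) ord_max)%:R])}.
  apply: cid; have [jJ|_] := boolP (j \in J); last by exists (fun=> 0); split.
  by have [w [h0 h1 h2 h3]] := h j jJ; exists w; split.
exists (fun s => projT1 (W (tag s)) (tagged s)).
  by move=> s; case: (W (tag s)) => w [].
move=> j jJ; rewrite /wdeg /wpt sum_tag /=.
case: (projT2 (W j)) => _ /(_ jJ) [h1 h2 h3]; split => //.
  by move=> i; rewrite h2 sum_tag.
by rewrite h3 sum_tag.
Qed.

Lemma lp_min_fin (F : finType) (I : Type) (M : I -> F -> R) (v : I -> R) (c : F -> R) :
  let feas la := (forall s, 0 <= la s <= 1) /\ forall k, \sum_s M k s * la s <= v k in
  (exists la, feas la) ->
  exists la, feas la /\ forall la', feas la' -> \sum_s c s * la s <= \sum_s c s * la' s.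
Proof.
have re (f : F -> R) : \sum_s f s = \sum_(i < #|F|) f (enum_val i).
  by rewrite (reindex (enum_val : 'I_#|F| -> F)) //=; apply: onW_bij; exact: enum_val_bij.
move=> feas [la0 [h1 h2]].
have [|la [[k1 k2] k3]] := @lp_min R #|F| I (fun k i => M k (enum_val i)) v (fun i => c (enum_val i)).
  by exists (fun i => la0 (enum_val i)); split => // k; rewrite -(re (fun s => M k s * la0 s)).
have en (f : F -> R) : \sum_s f s * la (enum_rank s) = \sum_i f (enum_val i) * la i.
  by rewrite re; apply: eq_bigr => i _; rewrite enum_valK.
exists (fun s => la (enum_rank s)); split.
  by split=> // k; rewrite en.
move=> la' [l1 l2]; rewrite en re.
by apply: k3; split => // k; rewrite -(re (fun s => M k s * la' s)).
Qed.

Definition conv_pt (J : {set 'I_n}) (x : 'rV[R]_m) y (t : 'I_n -> R) :=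
  (forall j, j \in J -> P j (y j) /\ slice j (y j) (t j)) /\ \sum_(j in J) y j = x.

(** The minimum over the decompositions of [x] and the minima defining the envelopes are taken
    together, as one linear program in the weights on all supports. *)
Lemma conv_min J x : minkowski_sum P J x ->
  exists y t, conv_pt J x y t /\
    forall y' t', conv_pt J x y' t' -> \sum_(j in J) t j <= \sum_(j in J) t' j.
Proof.
move=> [y0 Py0 sy0].
(* An equality is coded by two inequalities of opposite signs. The constraints are total weight 1,
   gauge at most 1 and the coordinates of [x]. *)
pose b2 (b : bool) : R := if b then 1 else -1.
pose I := ('I_n * bool + ('I_n + 'I_m * bool))%type.
pose M (k : I) (s : T) : R := match k with
  | inl (j, b) => b2 b * ((tag s == j) && (j \in J))%:R
  | inr (inl j) => ((tag s == j) && (j \in J))%:R * \sum_i (texp s (up i))%:R / axlen j (up i)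
  | inr (inr (i, b)) => b2 b * (tag s \in J)%:R * (texp s (up i))%:R
  end.
pose v (k : I) : R := match k with
  | inl (j, b) => b2 b * (j \in J)%:R
  | inr (inl j) => 1
  | inr (inr (i, b)) => b2 b * x 0 i
  end.
pose c (s : T) : R := (tag s \in J)%:R * (texp s ord_max)%:R.
have b2P (u u' : R) : (forall b, b2 b * u <= b2 b * u') <-> u = u'.
  split=> [h|-> //]; have := h true; have := h false.
  by rewrite !mulN1r !mul1r lerN2 => a b; apply/le_anti; rewrite a b.
have M1 w j : \sum_(s : T) ((tag s == j) && (j \in J))%:R * w s = (j \in J)%:R * wdeg w j.
  rewrite /wdeg mulr_sumr [LHS](bigID (fun s => tag s == j)) /= [X in _ + X]big1 ?addr0 => [|s /negbTE ->].
    by apply: eq_bigr => s ->.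
  by rewrite mul0r.
have M2 w j : \sum_(s : T) M (inr (inl j)) s * w s =
    (j \in J)%:R * \sum_i wpt w j (up i) / axlen j (up i).
  rewrite /wpt; under [X in _ = _ * X]eq_bigr => i _ do rewrite mulr_suml.
  rewrite exchange_big /= mulr_sumr [LHS](bigID (fun s => tag s == j)) /= [X in _ + X]big1 ?addr0 => [|s /negbTE ->].
    apply: eq_bigr => s ->; rewrite -mulrA mulr_suml; congr (_ * _).
    by apply: eq_bigr => i _; rewrite mulrC mulrA.
  by rewrite !mul0r.
have M3 w i : \sum_(s : T) (tag s \in J)%:R * (texp s i)%:R * w s = \sum_(j in J) wpt w j i.
  rewrite /wpt sum_tag_in [LHS](bigID (fun s => tag s \in J)) /= [X in _ + X]big1 ?addr0 => [|s /negbTE ->].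
    by apply: eq_bigr => s ->; rewrite mul1r mulrC.
  by rewrite !mul0r.
have M4 w i b : \sum_(s : T) M (inr (inr (i, b))) s * w s = b2 b * \sum_(j in J) wpt w j (up i).
  rewrite -M3 mulr_sumr; apply: eq_bigr => s _; rewrite /M.
  by rewrite !mulrA.
have M5 w j b : \sum_(s : T) M (inl (j, b)) s * w s = b2 b * ((j \in J)%:R * wdeg w j).
  by rewrite -M1 mulr_sumr; apply: eq_bigr => s _; rewrite /M mulrA.
have feasP w : (forall s, 0 <= w s <= 1) -> (forall k, \sum_s M k s * w s <= v k) <->
   [/\ forall j, j \in J -> wdeg w j = 1,
       forall j, j \in J -> \sum_i wpt w j (up i) / axlen j (up i) <= 1 &
       forall i, \sum_(j in J) wpt w j (up i) = x 0 i].
  move=> _; split=> [h|[h1 h2 h3] [[j b]|[j|[i b]]]].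
  - split=> [j jJ|j jJ|i].
    + apply: (proj1 (b2P _ _)) => b; by have := h (inl (j, b)); rewrite M5 /v /= jJ mul1r.
    + by have := h (inr (inl j)); rewrite M2 jJ mul1r.
    + apply: (proj1 (b2P _ _)) => b; by have := h (inr (inr (i, b))); rewrite M4.
  - rewrite M5 /v; case: (boolP (j \in J)) => jJ; last by rewrite mul0r.
    by rewrite h1 // mul1r.
  - rewrite M2 /v; case: (boolP (j \in J)) => jJ; last by rewrite mul0r ler01.
    by rewrite mul1r h2.
  - by rewrite M4 h3.
have obj w : \sum_(s : T) c s * w s = \sum_(j in J) wpt w j ord_max by exact: M3.
have toF y t : conv_pt J x y t -> exists w, [/\ forall s, 0 <= w s <= 1,
    forall k, \sum_s M k s * w s <= v k & \sum_(s : T) c s * w s = \sum_(j in J) t j].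
  move=> [h sy]; have /slices_weights [w w0 hw] : forall j, j \in J -> slice j (y j) (t j).
    by move=> j /h [].
  (* Nothing bounds the weights with index outside [J]; they are set to 0 to meet the upper bound
     1. *)
  pose w' s := (tag s \in J)%:R * w s.
  have e1 j : j \in J -> wdeg w' j = 1.
    move=> jJ; have [<- _ _] := hw j jJ; apply: eq_bigr => s /eqP ts.
    by rewrite /w' ts jJ mul1r.
  have e2 j i : j \in J -> wpt w' j i = wpt w j i.
    by move=> jJ; apply: eq_bigr => s /eqP ts; rewrite /w' ts jJ mul1r.
  have w'01 s : 0 <= w' s <= 1.
    rewrite /w'; case: (boolP (tag s \in J)) => ts; last by rewrite mul0r lexx ler01.
    rewrite mul1r w0 /=; have [<- _ _] := hw _ ts.
    rewrite /wdeg (bigD1 s) //= lerDl; exact: sumr_ge0.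
  exists w'; split => //; first apply/feasP => //; first split => //.
  - move=> j jJ; have [/PP-/(_ H3) [_ g1] _] := h j jJ; apply: le_trans g1.
    by apply: ler_sum => i _; have [_ -> _] := hw j jJ; rewrite e2.
  - move=> i; rewrite -sy summxE; apply: eq_bigr => j jJ.
    by have [_ -> _] := hw j jJ; rewrite e2.
  - by rewrite obj; apply: eq_bigr => j jJ; have [_ _ ->] := hw j jJ; rewrite e2.
have [|w [[w1 w2] wmin]] := @lp_min_fin T I M v c.
  have [|w [hw1 hw2 _]] := toF y0 (fun j => (1 - gauge j (y0 j)) * axlen j ord_max); last by exists w.
  split=> // j jJ; split; first exact: Py0.
  by apply: slice_simplex => //; exact: Py0.
have [d1 d2 d3] := (feasP w w1).1 w2.
exists (fun j => \row_i wpt w j (up i)), (fun j => wpt w j ord_max); split.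
  split=> [j jJ|]; last by apply/rowP => i; rewrite summxE -d3; apply: eq_bigr => j _; rewrite mxE.
  split.
    apply/PP => //; split=> [i|]; last by rewrite /simplex_gauge; under eq_bigr do rewrite mxE; exact: d2.
    by rewrite mxE; apply: sumr_ge0 => s _; rewrite mulr_ge0 //; case/andP: (w1 s).
  apply: (proj2 (slices_weights J (fun k => \row_i wpt w k (up i)) (fun k => wpt w k ord_max)) _ j jJ).
  exists w; first by move=> s; case/andP: (w1 s).
  by move=> k kJ; split => //; [exact: d1|move=> i; rewrite mxE].
by move=> y' t' /toF [w' [k1 k2 <-]]; rewrite -obj; apply: wmin.
Qed.

End Minimum.

Section Envelope.
Variables (R : realType) (m : nat).
Local Notation n := m.+1.
Variable A : 'I_n -> {fset multinom n}.
Hypothesis H3 : forall i j, exists2 mu : nat,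
  (0 < mu)%N & mnm_muln (mnm1 i) mu \in A j.

Local Notation Q j := (newton_polytope R (A j)).
Local Notation P := (fun j => [set proj_last x | x in axis_simplex (Q j)] : set 'rV[R]_m).
Local Notation rho := (fun j => lower_envelope (Q j)).
Local Notation up i := (lift ord_max i).
Local Notation axlen := (@axlen R m A).
Local Notation gauge := (@simplex_gauge R m A).
Local Notation slice := (@slice R m A).
Local Notation conv_pt := (@conv_pt R m A).

Lemma axlen_gt0 j i : 0 < axlen j i.
Proof. by case: (axlenP R H3 j i). Qed.

Lemma lower_envelope_min j y : P j y ->
  slice j y (rho j y) /\ forall t, slice j y t -> rho j y <= t.
Proof.
move=> Py.
have D : minkowski_sum P [set j]%SET y.
  by exists (fun=> y); [move=> k /set1P ->|rewrite big_set1].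
have [y' [t [[h sy] hmin]]] := conv_min H3 D.
have [_ sl] := h j (set11 j); move: sy; rewrite big_set1 => yy; rewrite yy in sl.
have lb t' : slice j y t' -> t j <= t'.
  move=> st'; have := hmin (fun=> y) (fun=> t'); rewrite !big_set1; apply.
  by split; [move=> k /set1P ->|rewrite big_set1].
suff -> : rho j y = t j by split.
apply: set_minP; first by apply/sliceP.
by move=> t' /sliceP /lb.
Qed.

Lemma inf_convolution_min (J : {set 'I_n}) x : minkowski_sum P J x ->
  (exists t, conv_pt J x t.1 t.2 /\ \sum_(j in J) t.2 j = inf_convolution P rho J x) /\
  forall y t, conv_pt J x y t -> inf_convolution P rho J x <= \sum_(j in J) t j.
Proof.
move=> D; have [y [t [cp hmin]]] := conv_min H3 D.
suff -> : inf_convolution P rho J x = \sum_(j in J) t j.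
  by split=> //; exists (y, t).
have hr j : j \in J -> t j = rho j (y j).
  move=> jJ; have [Py sl] := (proj1 cp) j jJ; have [sr rmin] := lower_envelope_min Py.
  apply/eqP; rewrite eq_le rmin // andbT.
  have := hmin y (fun k => if k == j then rho j (y j) else t k).
  have cp' : conv_pt J x y (fun k => if k == j then rho j (y j) else t k).
    split; last by case: cp.
    by move=> k kJ; have [? ?] := (proj1 cp) k kJ; split => //; case: eqP => [->|].
  move=> /(_ cp'); rewrite (bigD1 j) //= [leRHS](bigD1 j) //= eqxx.
  rewrite [in leRHS](eq_bigr t) ?lerD2r // => k /andP[_ /negbTE ->].
  by [].
apply: set_minP.
  exists y; split; [by move=> j /(proj1 cp) []|by case: cp|].
  by apply: eq_bigr => j jJ; rewrite hr.
move=> s [y' [Py' sy' <-]]; apply: (hmin y'); split=> // j jJ; split; first exact: Py'.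
by case: (lower_envelope_min (Py' j jJ)).
Qed.

(** Membership in the sum of the polytopes plus the non-negative orthant. Unlike the inf-convolution
    it does not mention the simplices, and it is what monomial ideals see. *)
Definition dominated (J : {set 'I_n}) (c : 'rV[R]_m) (t : R) := exists y h,
  [/\ forall j, j \in J -> slice j (y j) (h j),
      forall i, \sum_(j in J) y j 0 i <= c 0 i & \sum_(j in J) h j <= t].

Lemma dominated_conv (J : {set 'I_n}) x (c : 'rV[R]_m) : minkowski_sum P J x -> (forall i, x 0 i <= c 0 i) ->
  forall t, inf_convolution P rho J x <= t -> dominated J c t.
Proof.
move=> D xc t gt; have [[[y h] [/= [cp sy] sh]] _] := inf_convolution_min D.
exists y, h; split; first by move=> j /cp [].
  by move=> i; rewrite -summxE sy.
by rewrite sh.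
Qed.

Lemma minkowski_ge0 J x : minkowski_sum P J x ->
  (forall i, 0 <= x 0 i) /\ 0 <= inf_convolution P rho J x.
Proof.
move=> D; have [[[y h] [/= [cp sy] sh]] _] := inf_convolution_min D; split=> [i|].
  rewrite -sy summxE; apply: sumr_ge0 => j /cp [_ /slice_ge0 [h1 _]]; exact: h1.
by rewrite -sh; apply: sumr_ge0 => j /cp [_ /slice_ge0 []].
Qed.

Lemma minkowski_bound (J : {set 'I_n}) x : minkowski_sum P J x ->
  forall i, x 0 i <= \sum_(j in J) axlen j (up i).
Proof.
move=> [y Py <-] i; rewrite summxE; apply: ler_sum => j /Py /(PP H3) [y0 y1].
rewrite -[leRHS]mul1r -ler_pdivrMr ?axlen_gt0 //; apply: le_trans y1.
rewrite /simplex_gauge (bigD1 i) //= lerDl; apply: sumr_ge0 => k _.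
by rewrite divr_ge0 // ltW // axlen_gt0.
Qed.

Lemma dominated_large (J : {set 'I_n}) (c : 'rV[R]_m) t : (forall i, 0 <= c 0 i) -> 0 <= t ->
  (exists i, \sum_(j in J) axlen j (up i) <= c 0 i) \/ \sum_(j in J) axlen j ord_max <= t ->
  dominated J c t.
Proof.
move=> c0 t0 [[i hi]|ht].
  exists (fun j => axlen j (up i) *: delta_mx 0 i), (fun=> 0); split.
  - move=> j jJ; have e : gauge j (axlen j (up i) *: delta_mx 0 i) = 1.
      rewrite /simplex_gauge (bigD1 i) //= !mxE !eqxx mulr1 divff ?gt_eqF ?axlen_gt0 // big1 ?addr0 // => k ki.
      by rewrite !mxE (negbTE ki) andbF mulr0 mul0r.
    have -> : 0 = (1 - gauge j (axlen j (up i) *: delta_mx 0 i)) * axlen j ord_max by rewrite e subrr mul0r.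
    apply: slice_simplex => //.
    apply/PP => //; rewrite e; split=> // k.
    by rewrite !mxE mulr_ge0 // ltW // axlen_gt0.
  - move=> k; under eq_bigr do rewrite !mxE eqxx /=.
    have [->|_] := eqVneq k i; first by under eq_bigr do rewrite mulr1.
    by under eq_bigr do rewrite mulr0; rewrite big1.
  - by rewrite big1.
exists (fun=> 0), (fun j => axlen j ord_max); split => //.
- move=> j jJ; have e : gauge j 0 = 0 by rewrite /simplex_gauge big1 // => k _; rewrite mxE mul0r.
  have -> : axlen j ord_max = (1 - gauge j 0) * axlen j ord_max by rewrite e subr0 mul1r.
  apply: slice_simplex => //.
  by apply/PP => //; rewrite e; split=> // k; rewrite mxE.
- by move=> i; rewrite big1 // => j _; rewrite mxE.
Qed.

Lemma dominated_upward (J : {set 'I_n}) (c c' : 'rV[R]_m) t t' : (forall i, c 0 i <= c' 0 i) -> t <= t' ->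
  dominated J c t -> dominated J c' t'.
Proof.
move=> cc tt [y [h [h1 h2 h3]]]; exists y, h; split=> // [i|]; last exact: le_trans tt.
exact: le_trans (cc i).
Qed.

Lemma gauge_face j (y : 'rV[R]_m) : (forall i, 0 <= y 0 i) -> gauge j y = 1 -> P j y /\ slice j y 0.
Proof.
move=> y0 gy; have Py : P j y by apply/PP => //; rewrite gy.
by split=> //; have := slice_simplex H3 Py; rewrite gy subrr mul0r.
Qed.

Lemma gaugeZ j s y : gauge j (s *: y) = s * gauge j y.
Proof. by rewrite /simplex_gauge mulr_sumr; apply: eq_bigr => i _; rewrite mxE mulrA. Qed.

Lemma gaugeD j y z : gauge j (y + z) = gauge j y + gauge j z.
Proof. by rewrite /simplex_gauge -big_split; apply: eq_bigr => i _; rewrite mxE mulrDl. Qed.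

Lemma gauge_ge0 j (y : 'rV[R]_m) : (forall i, 0 <= y 0 i) -> 0 <= gauge j y.
Proof. by move=> y0; apply: sumr_ge0 => i _; rewrite divr_ge0 // ltW // axlen_gt0. Qed.

Lemma gauge_gt0 j (y : 'rV[R]_m) : (forall i, 0 <= y 0 i) -> y != 0 -> 0 < gauge j y.
Proof.
move=> y0 yn0; rewrite lt_def gauge_ge0 // andbT; apply: contra yn0 => /eqP gy.
apply/eqP/rowP => i; rewrite mxE; apply/eqP.
have /eqP := gy; rewrite psumr_eq0 => [/allP /(_ i)|k _]; last by rewrite divr_ge0 // ltW // axlen_gt0.
rewrite mem_index_enum => /(_ isT) /=; rewrite mulf_eq0 invr_eq0.
by rewrite [X in _ || X]gt_eqF ?axlen_gt0 // orbF.
Qed.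

(** Greedy choice: if [x] lies in the simplex of [r], it is taken whole and the other points are 0;
    otherwise its multiple on the face is subtracted and the remainder is passed on. *)
Lemma faces_or_sum (s : seq 'I_n) (x : 'rV[R]_m) : uniq s -> (forall i, 0 <= x 0 i) ->
  (exists2 y, forall j, j \in s -> P j (y j) & \sum_(j <- s) y j = x) \/
  (exists2 y, forall j, j \in s -> slice j (y j) 0 & forall i, \sum_(j <- s) y j 0 i <= x 0 i).
Proof.
elim: s x => [|r s IH] x /=.
  move=> _ x0; have [->|_] := eqVneq x 0; [left|right]; exists (fun=> 0) => //; rewrite ?big_nil //.
  by move=> i; rewrite big_nil.
move=> /andP [rs us] x0.
have upd (F : 'I_n -> 'rV[R]_m) u : \sum_(j <- r :: s) (if j == r then u else F j) = u + \sum_(j <- s) F j.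
  rewrite big_cons eqxx; congr (_ + _); apply: eq_big_seq => j js.
  by case: eqP => // e; rewrite -e js in rs.
have [g1|g1] := lerP (gauge r x) 1.
  left; exists (fun j => if j == r then x else 0).
    move=> j _; case: eqP => [->|_]; apply/PP => //; split => //.
      by move=> i; rewrite mxE.
    by rewrite /simplex_gauge big1 // => i _; rewrite mxE mul0r.
  by rewrite upd big1 ?addr0.
have g0 : 0 < gauge r x by apply: lt_trans g1.
pose u := (gauge r x)^-1 *: x.
have u0 i : 0 <= u 0 i by rewrite mxE mulr_ge0 // invr_ge0 ltW.
have [Pu su] : P r u /\ slice r u 0.
  by apply: gauge_face => //; rewrite gaugeZ mulVf ?gt_eqF.
have xu0 i : 0 <= (x - u) 0 i.
  rewrite !mxE subr_ge0 -[leRHS]mul1r ler_wpM2r //.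
  by rewrite invf_le1 // ltW.
have [[y Py sy]|[y Sy sy]] := IH (x - u) us xu0; [left|right].
  exists (fun j => if j == r then u else y j); last by rewrite upd sy addrC subrK.
  by move=> j; rewrite inE; case: eqP => [->|_] //= /Py.
exists (fun j => if j == r then u else y j).
  by move=> j; rewrite inE; case: eqP => [->|_] //= /Sy.
move=> i; have := sy i; rewrite -!summxE upd !mxE => h.
by rewrite addrC -lerBrDr.
Qed.

Lemma dominated_outside (J : {set 'I_n}) (x c : 'rV[R]_m) t : (forall i, 0 <= x 0 i) -> ~ minkowski_sum P J x ->
  (forall i, x 0 i <= c 0 i) -> 0 <= t -> dominated J c t.
Proof.
move=> x0 nD xc t0.
have [[y Py sy]|[y Sy sy]] := faces_or_sum (enum_uniq J) x0.
  case: nD; exists y; first by move=> j jJ; apply: Py; rewrite mem_enum.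
  by rewrite -sy big_enum.
exists y, (fun=> 0); split; first by move=> j jJ; apply: Sy; rewrite mem_enum.
  by move=> i; apply: le_trans (xc i); have := sy i; rewrite big_enum.
by rewrite big1.
Qed.

(* The point [z j] is pushed along [v = x - \sum_j z j] to the face of the
   simplex, where the envelope vanishes, and the two decompositions of [x + s v]
   are averaged with weights [s] and [1]. *)
Lemma conv_dominated (J : {set 'I_n}) x (c : 'rV[R]_m) t : minkowski_sum P J x -> (forall i, c 0 i <= x 0 i) ->
  dominated J c t -> inf_convolution P rho J x <= t.
Proof.
move=> D cx [y [h [sl sy sh]]].
(* A point over the outside of the simplex is shrunk to the face and given height 0, which raises
   neither its coordinates nor its height. *)
pose z j := if gauge j (y j) <= 1 then y j else (gauge j (y j))^-1 *: y j.
pose e j := if gauge j (y j) <= 1 then h j else 0.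
have hz j : j \in J -> [/\ P j (z j), slice j (z j) (e j), 0 <= e j <= h j & forall i, z j 0 i <= y j 0 i].
  move=> jJ; have [y0 h0] := slice_ge0 (sl j jJ); rewrite /z /e; case: lerP => g1.
    split=> //; [by apply/PP|exact: sl|by rewrite h0 lexx].
  have g0 : 0 < gauge j (y j) by apply: lt_trans g1.
  have [|| Pu su] := @gauge_face j ((gauge j (y j))^-1 *: y j).
  - by move=> i; rewrite mxE mulr_ge0 // invr_ge0 ltW.
  - by rewrite gaugeZ mulVf ?gt_eqF.
  split=> //; first by rewrite lexx h0.
  by move=> i; rewrite mxE -[leRHS]mul1r ler_wpM2r // invf_le1 // ltW.
have [_ gmin] := inf_convolution_min D.
have et : \sum_(j in J) e j <= t.
  by apply: le_trans sh; apply: ler_sum => j /hz [_ _ /andP[]].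
pose v := x - \sum_(j in J) z j.
have v0 i : 0 <= v 0 i.
  rewrite !mxE summxE subr_ge0; apply: le_trans (cx i); apply: le_trans (sy i).
  by apply: ler_sum => j jJ; have [_ _ _ zy] := hz j jJ.
have [vE|vn0] := eqVneq v 0.
  apply: le_trans et; apply: (gmin z); split; first by move=> j /hz [].
  by apply/esym/eqP; rewrite -subr_eq0 -/v vE.
have [w Pw sw] := D.
pose s j := (1 - gauge j (w j)) / gauge j v.
have s0 j : j \in J -> 0 <= s j.
  move=> /Pw /(PP H3) [w0 w1]; rewrite divr_ge0 ?subr_ge0 //.
  by apply: ltW; apply: gauge_gt0.
pose S := \sum_(j in J) s j.
have S0 : 0 <= S by apply: sumr_ge0.
have S1 : 0 < 1 + S by rewrite ltr_wpDr.
pose u j := w j + s j *: v.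
have hu j : j \in J -> P j (u j) /\ slice j (u j) 0.
  move=> jJ; have [w0 w1] := proj1 (PP H3 _ _) (Pw j jJ); apply: gauge_face.
    by move=> i; rewrite mxE addr_ge0 // mxE mulr_ge0 //; exact: s0.
  by rewrite gaugeD gaugeZ divfK ?gt_eqF ?gauge_gt0 // addrC subrK.
(* The first decomposition sums to [x - v] and the second to [x + S v]; these weights average them
   to [x]. *)
pose a := S / (1 + S).
have a01 : 0 <= a <= 1.
  by rewrite divr_ge0 ?(ltW S1) //= ler_pdivrMr // mul1r lerDr.
have a1 : 1 - a = (1 + S)^-1 by rewrite /a; field; rewrite gt_eqF.
pose p j := a *: z j + (1 - a) *: u j.
apply: le_trans et; apply: (@le_trans _ _ (\sum_(j in J) a * e j)); last first.
  by apply: ler_sum => j /hz [_ _ /andP[e0 _] _]; rewrite ler_piMl //; case/andP: a01.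
apply: (gmin p (fun j => a * e j)); split.
  move=> j jJ; have [Pz Sz _ _] := hz j jJ; have [Pu Su] := hu j jJ; split.
    move: Pz Pu => /(PP H3) [z0 z1] /(PP H3) [u0 u1]; case/andP: a01 => a0 a1'.
    apply/PP => //; split.
      by move=> i; rewrite mxE addr_ge0 // mxE mulr_ge0 // ?subr_ge0.
    rewrite gaugeD !gaugeZ; apply: (@le_trans _ _ (a * 1 + (1 - a) * 1)).
      by rewrite lerD // ler_wpM2l // subr_ge0.
    by rewrite !mulr1 addrC subrK.
  by have := slice_conv a01 Sz Su; rewrite mulr0 addr0.
rewrite /p big_split /= -!scaler_sumr.
have -> : \sum_(j in J) u j = x + S *: v.
  by rewrite /u big_split /= sw -scaler_suml.
have -> : \sum_(j in J) z j = x - v by rewrite /v opprB addrC subrK.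
apply/rowP => i; rewrite a1 !mxE /a.
by field; rewrite gt_eqF.
Qed.

End Envelope.

(** * Colengths as numbers of lattice points *)

Section MonomialCount.
Variables (n' : nat) (K : fieldType) (A : 'I_n'.+1 -> {fset multinom n'.+1}).
Local Notation n := n'.+1.
Hypothesis H3 : forall i j, exists2 mu : nat,
  (0 < mu)%N & mnm_muln (mnm1 i) mu \in A j.

(** Distinct monomials outside a monomial ideal are independent modulo it; [nu] describes a finite
    set of exponents by a finite type. *)
Lemma card_codim_monideal (F : finType) (nu : F -> multinom n) (E : {set F}) L :
  injective nu -> (forall x, x \in E -> ~ mon A L (nu x)) ->
  (#|E| <= codimn (@monideal n K A L))%N.
Proof.
move=> nuI hE; have hI := @monideal_ideal n K A L.
have [b [sb _]] := codimnP hI (monideal_cof K H3 L).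
apply: (leq_spans_indep (ideal_sspace hI) sb (b' := fun i : 'I_#|E| => mpolyX K (nu (enum_val i)))).
move=> c hc i; apply/eqP/contraT => ci; case: (hE _ (enum_valP i)).
apply: hc; rewrite raddf_sum /= (bigD1 i) //= big1 ?addr0 => [|k ki].
  by rewrite mcoeffZ mcoeffX eqxx mulr1.
rewrite mcoeffZ mcoeffX (inj_eq nuI) (inj_eq enum_val_inj) (negbTE ki) mulr0 //.
Qed.

Lemma codim_monideal_card (F : finType) (nu : F -> multinom n) (E : {set F}) L :
  injective nu -> (forall b, ~ mon A L b -> exists2 x, x \in E & nu x = b) ->
  (codimn (@monideal n K A L) <= #|E|)%N.
Proof.
move=> nuI hE; have hI := @monideal_ideal n K A L.
have [||d dE hd] := @spans_codim _ _ (@monideal n K A L) #|E| (fun i => mpolyX K (nu (enum_val i))).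
- exact: ideal_sspace.
- move=> u; exists (fun i => mcoeff (nu (enum_val i)) u) => b hb.
  have [//|/hE [x xE xb]] := pselect (mon A L b).
  case/eqP: hb; rewrite mcoeffB raddf_sum /= (bigD1 (enum_rank_in xE x)) //= big1 => [|k kx].
    by rewrite mcoeffZ mcoeffX enum_rankK_in // xb eqxx mulr1 addr0 subrr.
  rewrite mcoeffZ mcoeffX -xb (inj_eq nuI); case: eqP => [e|_]; last by rewrite mulr0.
  by case/eqP: kx; apply: enum_val_inj; rewrite enum_rankK_in.
- by rewrite (codimnE hI hd).
Qed.

End MonomialCount.

Section Lattice.
Variables (R : realType) (m : nat).
Local Notation n := m.+1.
Variable A : 'I_n -> {fset multinom n}.
Hypothesis H3 : forall i j, exists2 mu : nat,
  (0 < mu)%N & mnm_muln (mnm1 i) mu \in A j.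

Local Notation T := (coef_index A).
Local Notation up i := (lift ord_max i).
Local Notation dominated := (@dominated R m A).

Definition lattice_pt q (b : 'I_m -> nat) : 'rV[R]_m := \row_i ((b i)%:R / q%:R).

(** The multiplicities of a decomposition, divided by [q], are weights of total 1 on each support of
    [J]. *)
Lemma mon_dominated J q (b : multinom n) : (0 < q)%N -> mon A (rep q J) b ->
  dominated J (lattice_pt q (fun i => b (up i))) ((b ord_max)%:R / q%:R).
Proof.
move=> q0 /mon_decomp [de [hd hs]].
have q0' : 0 < q%:R :> R by rewrite ltr0n.
pose w (s : T) : R := (de s)%:R / q%:R.
have sw (i : 'I_n) : \sum_(j in J) wpt w j i <= (b i)%:R / q%:R.
  rewrite sum_tag_in; apply: (@le_trans _ _ ((dsum de i)%:R / q%:R)); last first.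
    by rewrite ler_pM2r ?invr_gt0 // ler_nat.
  rewrite /dsum natr_sum mulr_suml [leRHS](bigID (fun s => tag s \in J)) /= -[leLHS]addr0 lerD //.
    by apply: ler_sum => s _; rewrite natrM mulrAC.
  by apply: sumr_ge0 => s _; rewrite divr_ge0.
exists (fun j => \row_i wpt w j (up i)), (fun j => wpt w j ord_max); split => //.
  apply/slices_weights; exists w; first by move=> s; rewrite divr_ge0.
  move=> j jJ; split=> // [|i]; last by rewrite mxE.
  rewrite /wdeg -mulr_suml -natr_sum; have := hd j; rewrite /ddeg => ->.
  by rewrite count_rep jJ muln1 divff ?gt_eqF.
by move=> i; under eq_bigr do rewrite mxE; rewrite mxE; exact: sw.
Qed.

(** The weights multiplied by [q] are rounded down. Each rounding loses at most one factor, so a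
    support loses at most [#|T|] of them. *)
Lemma dominated_mon J q (b : multinom n) : (0 < q)%N ->
  dominated J (lattice_pt q (fun i => b (up i))) ((b ord_max)%:R / q%:R) ->
  mon A (rep (q - #|T|) J) b.
Proof.
move=> q0 [y [h [/slices_weights [w w0 hw] hy hh]]].
have q0' : 0 < q%:R :> R by rewrite ltr0n.
pose de (s : T) : nat := if tag s \in J then Num.truncn (q%:R * w s) else 0%N.
have tr s : (Num.truncn (q%:R * w s))%:R <= q%:R * w s < (Num.truncn (q%:R * w s)).+1%:R.
  by apply: truncn_itv; rewrite mulr_ge0.
have sw (i : 'I_n) : \sum_(j in J) wpt w j i <= (b i)%:R / q%:R.
  have [i' ->|->] := unliftP ord_max i.
    have := hy i'; rewrite mxE; apply: le_trans; apply: ler_sum => j /hw [_ -> _]; exact: lexx.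
  by apply: le_trans hh; apply: ler_sum => j /hw [_ _ ->].
apply/monP; exists de; split=> [j|i].
  rewrite count_rep; case: (boolP (j \in J)) => jJ; last by rewrite muln0.
  rewrite muln1 leq_subLR -(ler_nat R).
  have [wd _ _] := hw j jJ.
  have -> : q%:R = \sum_(s : T | tag s == j) q%:R * w s :> R by rewrite -mulr_sumr -/(wdeg w j) wd mulr1.
  apply: (@le_trans _ _ (\sum_(s : T | tag s == j) (1 + (de s)%:R))).
    by apply: ler_sum => s /eqP ts; rewrite /de ts jJ nat1r; apply: ltW; case/andP: (tr s).
  rewrite big_split /= natrD lerD //; last by rewrite /ddeg natr_sum.
  by rewrite sumr_const ler_nat max_card.
rewrite -(ler_nat R); apply: (@le_trans _ _ (q%:R * \sum_(j in J) wpt w j i)); last first.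
  by rewrite mulrC -ler_pdivlMr.
rewrite sum_tag_in mulr_sumr /dsum natr_sum [leLHS](bigID (fun s => tag s \in J)) /=.
rewrite [X in _ + X]big1 ?addr0 => [|s /negbTE sJ]; last by rewrite /de sJ mul0n.
apply: ler_sum => s sJ; rewrite /de sJ natrM mulrA ler_wpM2r //.
by case/andP: (tr s).
Qed.

(** The last coordinate is kept apart, as a height over the other [m]. *)
Definition multinom_of (B : nat) (x : {ffun 'I_m -> 'I_B} * 'I_B) : multinom n :=
  Multinom [tuple if unlift ord_max k is Some i then x.1 i : nat else x.2 | k < n].

Lemma multinom_of_up B x i : @multinom_of B x (up i) = x.1 i :> nat.
Proof. by rewrite /multinom_of multinomE tnth_mktuple liftK. Qed.

Lemma multinom_of_max B x : @multinom_of B x ord_max = x.2 :> nat.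
Proof. by rewrite /multinom_of multinomE tnth_mktuple unlift_none. Qed.

Lemma multinom_of_inj B : injective (@multinom_of B).
Proof.
move=> [f s] [g t] /mnmP e; congr (_, _).
  by apply/ffunP => i; apply/val_inj; have := e (up i); rewrite !multinom_of_up.
by apply/val_inj; have := e ord_max; rewrite !multinom_of_max.
Qed.

Definition undominated J q B : {set {ffun 'I_m -> 'I_B} * 'I_B} :=
  [set x : {ffun 'I_m -> 'I_B} * 'I_B | ~~ `[< dominated J (lattice_pt q (fun i => x.1 i)) (x.2%:R / q%:R) >]]%SET.

Lemma undominated_le (K : numFieldType) J q B : (0 < q)%N ->
  (#|undominated J q B| <= colength K A J q)%N.
Proof.
move=> q0; apply: (card_codim_monideal _ H3 (@multinom_of_inj B)) => x; rewrite inE => /asboolPn nd.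
move=> /(mon_dominated q0); rewrite multinom_of_max.
have -> : lattice_pt q (fun i => multinom_of x (up i)) = lattice_pt q (fun i => x.1 i).
  by apply/rowP => i; rewrite !mxE multinom_of_up.
by [].
Qed.

Lemma dominated_bound J : exists L : nat, forall (c : 'rV[R]_m) t,
  (forall i, 0 <= c 0 i) -> 0 <= t ->
  (exists i, L%:R <= c 0 i) \/ L%:R <= t -> dominated J c t.
Proof.
pose M : R := \sum_i \sum_(j in J) @axlen R m A j i.
have Mi i : \sum_(j in J) @axlen R m A j i <= M.
  rewrite /M [leRHS](bigD1 i) //= lerDl; apply: sumr_ge0 => k _; apply: sumr_ge0 => j _.
  by rewrite ltW // axlen_gt0.
exists (Num.truncn M).+1 => c t c0 t0 h; apply: dominated_large => //.
have M0 : 0 <= M by apply: le_trans (Mi ord_max); apply: sumr_ge0 => j _; rewrite ltW // axlen_gt0.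
have ML : M <= (Num.truncn M).+1%:R by apply: ltW; case/andP: (truncn_itv M0).
by case: h => [[i hi]|ht]; [left; exists i|right]; apply: le_trans (Mi _) (le_trans ML _).
Qed.

(** Beyond [L] every point is dominated, so a box of side at least [L * q] contains the exponents of
    all monomials outside the ideal. *)
Lemma leq_undominated (K : numFieldType) J : exists L : nat, forall L', (L <= L')%N -> forall q, (0 < q)%N ->
  (colength K A J (q - #|T|) <= #|undominated J q (L' * q)|)%N.
Proof.
have [L hL] := dominated_bound J; exists L => L' LL q q0.
apply: (codim_monideal_card _ (@multinom_of_inj _)) => b nb.
have q0' : 0 < q%:R :> R by rewrite ltr0n.
have nd : ~ dominated J (lattice_pt q (fun i => b (up i))) ((b ord_max)%:R / q%:R).
  by move/(dominated_mon q0).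
have lb (i : 'I_n) : (b i < L' * q)%N.
  rewrite ltnNge; apply/negP => hb; apply: nd; apply: hL.
  - by move=> k; rewrite mxE divr_ge0.
  - by rewrite divr_ge0.
  have hb' : L%:R <= (b i)%:R / q%:R :> R.
    by rewrite ler_pdivlMr // -natrM ler_nat (leq_trans _ hb) // leq_mul2r LL orbT.
  have [i' e|e] := unliftP ord_max i; rewrite e in hb'; [left|by right].
  by exists i'; rewrite mxE.
pose x := ([ffun i => Ordinal (lb (up i))], Ordinal (lb ord_max)).
have xb : multinom_of x = b.
  apply/mnmP => k; have [i ->|->] := unliftP ord_max k; last by rewrite multinom_of_max.
  by rewrite multinom_of_up ffunE.
exists x => //; rewrite inE; apply/asboolPn; rewrite /=.
have -> : lattice_pt q (fun i => [ffun i => Ordinal (lb (up i))] i) = lattice_pt q (fun i => b (up i)).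
  by apply/rowP => i; rewrite !mxE ffunE.
by [].
Qed.

End Lattice.

(** * Riemann sums *)

Section Boxes.
Variable R : realType.

Definition box k (lo hi : 'I_k -> R) : set (k.-tuple (measurableTypeR R)) :=
  [set t | forall i, lo i <= tnth t i < hi i].

Lemma measurable_box k (lo hi : 'I_k -> R) : measurable (box lo hi).
Proof.
have -> : box lo hi = \bigcap_(i in setT) ((fun t : k.-tuple (measurableTypeR R) => tnth t i) @^-1` `[lo i, hi i[%classic).
  apply/seteqP; split=> [t ht i _|t h i]; first by rewrite /= in_itv; exact: ht.
  by have := h i I; rewrite /= in_itv.
apply: fin_bigcap_measurable => // i _; rewrite -[X in measurable X]setTI.
by apply: measurable_tnth => //; exact: measurable_itv.
Qed.

(** [lebesgue_tuple] is a bare set function. It is identified with a sigma-finite measure,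
    sigma-finiteness being carried along so that the product construction can be iterated. *)
Lemma lebesgue_tuple_measure k :
  exists2 M : {sigma_finite_measure set (k.-tuple (measurableTypeR R)) -> \bar R},
    @lebesgue_tuple R k = M :> (set _ -> \bar R) &
    forall lo hi, (forall i, lo i <= hi i) -> M (box lo hi) = (\prod_i (hi i - lo i))%:E.
Proof.
elim: k => [|k [M eM hM]].
  exists (dirac [tuple]) => // lo hi _; rewrite big_ord0.
  have -> : box lo hi = setT by apply/seteqP; split => // t _ -[].
  by rewrite [LHS]diracT.
pose cns (p : measurableTypeR R * k.-tuple (measurableTypeR R)) :
  k.+1.-tuple (measurableTypeR R) := [tuple of p.1 :: p.2].
have mc : measurable_fun setT cns by apply: measurable_cons.
pose mu : {measure set _ -> \bar R} := measure_function_pushforward__canonical__measure_function_Measure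
  (product_measure1 (@lebesgue_measure R) M) mc.
have mubox lo hi : (forall i, lo i <= hi i) -> mu (box lo hi) = (\prod_i (hi i - lo i))%:E.
  move=> lh; rewrite /= /pushforward.
  have -> : cns @^-1` box lo hi = `[lo ord0, hi ord0[%classic `*` box (lo \o lift ord0) (hi \o lift ord0).
    apply/seteqP; split=> -[x t] /=.
      move=> h; split=> [|i]; first by rewrite in_itv /=; exact: (h ord0).
      by have := h (lift ord0 i); rewrite tnthS.
    rewrite in_itv /= => -[hx ht] i; have [j ->|->] := unliftP ord0 i; last by [].
    by rewrite tnthS; exact: ht.
  rewrite product_measure1E; [|exact: measurable_itv|exact: measurable_box].
  rewrite (hM _ _ (fun i => lh (lift ord0 i))) big_ord_recl EFinM; congr (_ * _)%E.
  apply: (etrans (lebesgue_measure_itv `[lo ord0, hi ord0[)); rewrite /= lte_fin.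
  by case: ltgtP (lh ord0) => // ->; rewrite subrr.
have sf : sigma_finite setT mu.
  exists (fun N : nat => box (fun=> - N%:R) (fun=> N%:R)); last first.
    by move=> N; split; [exact: measurable_box|rewrite mubox ?ltry // => i; rewrite ge0_cp].
  apply/seteqP; split=> // t _.
  pose B := \sum_i `|tnth t i|.
  exists (Num.truncn B).+1 => // i.
  have : `|tnth t i| < (Num.truncn B).+1%:R.
    apply: (@le_lt_trans _ _ B); first by rewrite /B (bigD1 i) //= lerDl sumr_ge0.
    by case/andP: (@truncn_itv _ B (sumr_ge0 _ (fun _ _ => normr_ge0 _))).
  by rewrite ltr_norml => /andP [/ltW -> ->].
pose H2 := isSFinite.Build _ _ _ _ (sfinite_measure_sigma_finite sf).
pose H3 := isSigmaFinite.Build _ _ _ _ sf.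
pose M' := HB.pack_for (SigmaFiniteMeasure.type _ R) (Measure.sort mu) H2 H3.
exists M'; last exact: mubox.
by rewrite /= eM.
Qed.

End Boxes.

Section StepIntegral.
Variables (R : realType) (k : nat).
Local Notation T := (k.-tuple (measurableTypeR R)).

(* No measurability is needed: the integral of a nonnegative function is a
   supremum over the simple functions below it. *)
Lemma ge0_le_integral_sup (M : {measure set T -> \bar R}) (f g : T -> \bar R) :
  (forall t, 0 <= f t)%E -> (forall t, f t <= g t)%E ->
  (\int[M]_t f t <= \int[M]_t g t)%E.
Proof.
move=> f0 fg; have g0 t : (0 <= g t)%E by apply: le_trans (fg t).
rewrite !ge0_integralTE //; apply: le_ereal_sup => _ [h hf <-]; exists h => // t.
by apply: le_trans (fg t); apply: hf.
Qed.

Definition step (F : finType) (c : F -> R) (lo hi : F -> 'I_k -> R) (t : T) : R :=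
  \sum_x c x * \1_(box (lo x) (hi x)) t.

Lemma integral_step (M : {measure set T -> \bar R}) (F : finType) (c : F -> R) lo hi :
  (forall x, 0 <= c x) -> 
  (\int[M]_t (step c lo hi t)%:E = \sum_x (c x)%:E * M (box (lo x) (hi x)))%E.
Proof.
move=> c0; under eq_integral do rewrite /step -sumEFin.
have mi x : measurable_fun setT (\1_(box (lo x) (hi x)) : T -> R).
  by apply: measurable_indic; exact: measurable_box.
rewrite (@ge0_integral_sum _ _ _ M setT measurableT _ (fun x (t : T) => (c x * \1_(box (lo x) (hi x)) t)%:E)).
- apply: eq_bigr => x _; under eq_integral do rewrite EFinM.
  rewrite ge0_integralZl_EFin //.
  + by rewrite integral_indic ?setIT //; exact: measurable_box.
  + exact/measurable_EFinP.
- move=> x; apply/measurable_EFinP; apply: measurable_funM => //.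
- by move=> x t _; rewrite lee_fin mulr_ge0.
Qed.

Lemma row_integral_step (D : set 'rV[R]_k) (g : 'rV[R]_k -> R) (F : finType)
    (c1 c2 : F -> R) (lo1 hi1 lo2 hi2 : F -> 'I_k -> R) :
  (forall x, D x -> 0 <= g x) -> (forall x, 0 <= c1 x) -> (forall x, 0 <= c2 x) ->
  (forall x i, lo1 x i <= hi1 x i) -> (forall x i, lo2 x i <= hi2 x i) ->
  (forall t, D (\row_i tnth t i) -> step c1 lo1 hi1 t <= g (\row_i tnth t i) <= step c2 lo2 hi2 t) ->
  (forall t, ~ D (\row_i tnth t i) -> step c1 lo1 hi1 t <= 0) ->
  \sum_x c1 x * \prod_i (hi1 x i - lo1 x i) <= row_integral D g <=
  \sum_x c2 x * \prod_i (hi2 x i - lo2 x i).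
Proof.
move=> g0 c10 c20 le1 le2 gin gout; have [M eM hM] := lebesgue_tuple_measure R k.
rewrite /row_integral eM integral_mkcond.
pose f (t : T) : \bar R := ((fun t : T => (g (\row_i tnth t i))%:E) \_ ((fun t : T => \row_i tnth t i) @^-1` D)) t.
have st0 (c : F -> R) (lo hi : F -> 'I_k -> R) t : (forall x, 0 <= c x) -> 0 <= step c lo hi t.
  by move=> c0; apply: sumr_ge0 => x _; rewrite mulr_ge0.
have lo t : ((step c1 lo1 hi1 t)%:E <= f t)%E.
  rewrite /f patchE; case: ifPn => [|]; rewrite (inE, notin_setE) /= => Dt.
    by rewrite lee_fin; case/andP: (gin t Dt).
  by rewrite lee_fin; exact: gout.
have hi t : (f t <= (step c2 lo2 hi2 t)%:E)%E.
  rewrite /f patchE; case: ifPn => [|]; rewrite (inE, notin_setE) /= => Dt.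
    by rewrite lee_fin; case/andP: (gin t Dt).
  by rewrite lee_fin st0.
have f0 t : (0 <= f t)%E by apply: le_trans (lo t); rewrite lee_fin st0.
have i2 := ge0_le_integral_sup M f0 hi.
have eM1 (c : F -> R) (l h : F -> 'I_k -> R) : (forall x i, l x i <= h x i) ->
  (\sum_x (c x)%:E * M (box (l x) (h x)) = (\sum_x c x * \prod_i (h x i - l x i))%:E)%E.
  by move=> lh; rewrite -sumEFin; apply: eq_bigr => x _; rewrite hM // EFinM.
move: i2; rewrite integral_step // eM1 // => i2.
have {}i1 : ((\sum_x c1 x * \prod_i (hi1 x i - lo1 x i))%:E <= \int[M]_t f t)%E.
  rewrite -eM1 // -integral_step //; apply: ge0_le_integral_sup lo => t.
  by rewrite lee_fin st0.
(* [fine] sends an infinite value to 0; the upper step function excludes this. *)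
have fin : (\int[M]_t f t)%E \is a fin_num.
  by rewrite fin_numElt (lt_le_trans _ i1) ?ltNyr // (le_lt_trans i2) ?ltry.
by move: i1 i2; rewrite -(fineK fin) !lee_fin => -> ->.
Qed.

End StepIntegral.

Lemma card_initial B (p : nat -> bool) : (forall s t, (s <= t)%N -> p t -> p s) ->
  let c := #|[set t : 'I_B | p t]%SET| in (c <= B)%N /\ forall t, (t < B)%N -> p t = (t < c)%N.
Proof.
move=> hp c; split=> [|t tB]; first by rewrite -[leqRHS]card_ord max_card.
have cardw s (sB : (s <= B)%N) : #|[set widen_ord sB i | i : 'I_s]%SET| = s.
  by rewrite card_imset ?card_ord // => i j /(congr1 val) /= /val_inj.
apply/idP/idP => [pt|tc].
  rewrite -(cardw _ tB); apply: subset_leq_card; apply/fintype.subsetP => s /imsetP [i _ ->].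
  by rewrite inE /=; apply: hp pt; rewrite -ltnS.
apply/contraT => npt; move: tc; rewrite ltnNge => /negP []; rewrite -(cardw _ (ltnW tB)).
apply: subset_leq_card; apply/fintype.subsetP => s; rewrite inE => ps.
have st : (s < t)%N by rewrite ltnNge; apply: contra npt => ts; exact: hp ps.
by apply/imsetP; exists (Ordinal st) => //; apply/val_inj.
Qed.

Lemma card_zero_coord k B (i : 'I_k) : (0 < B)%N ->
  (B * #|[set b : {ffun 'I_k -> 'I_B} | b i == 0 :> nat]%SET| <= B ^ k)%N.
Proof.
case: B => // B _.
pose F (l : 'I_k) (x : 'I_B.+1) : nat := if l == i then x == ord0 else true.
have := @bigA_distr_bigA nat 0%N 1%N muln addn 'I_k 'I_B.+1 F.
rewrite (bigD1 i) //= {1}/F eqxx -big_mkcond sum1_card card1 mul1n.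
rewrite (eq_bigr (fun=> B.+1)) => [|l /negbTE li]; last first.
  by under eq_bigr do rewrite /F li; rewrite sum1_card card_ord.
rewrite prod_nat_const => e.
have -> : #|[set b : {ffun 'I_k -> 'I_B.+1} | b i == 0 :> nat]%SET| =
   (\sum_(f : {ffun 'I_k -> 'I_B.+1}) \prod_l F l (f l))%N.
  rewrite -sum1_card big_mkcond; apply: eq_bigr => f _; rewrite inE (bigD1 i) //= {1}/F eqxx.
  rewrite big1 ?muln1 => [|l /negbTE li]; last by rewrite /F li.
  by rewrite -[f i == ord0]/(val (f i) == 0%N); case: eqP.
rewrite -e -expnS cardC1 card_ord; case: k i {F e} => [[]//|k i].
by rewrite /= leqnn.
Qed.

(** * Lattice points between two step functions *)

Section Sandwich.
Variables (R : realType) (m : nat).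
Local Notation n := m.+1.
Variable A : 'I_n -> {fset multinom n}.
Hypothesis H3 : forall i j, exists2 mu : nat,
  (0 < mu)%N & mnm_muln (mnm1 i) mu \in A j.

Local Notation T := (coef_index A).
Local Notation Q j := (newton_polytope R (A j)).
Local Notation P := (fun j => [set proj_last x | x in axis_simplex (Q j)] : set 'rV[R]_m).
Local Notation rho := (fun j => lower_envelope (Q j)).
Local Notation dominated := (@dominated R m A).
Local Notation lattice_pt := (@lattice_pt R m).
Local Notation D J := (minkowski_sum P J).
Local Notation g J := (inf_convolution P rho J).

(** The undominated levels of a column form an initial segment, so their number is also the first
    dominated level, if there is one below [B]. *)
Definition height J q B (b : {ffun 'I_m -> 'I_B}) : nat :=
  #|[set t : 'I_B | ~~ `[< dominated J (lattice_pt q (fun i => b i)) (t%:R / q%:R) >]]%SET|.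

Lemma card_undominated J q B : #|@undominated R m A J q B| = (\sum_b @height J q B b)%N.
Proof.
rewrite -sum1_card; under [RHS]eq_bigr do rewrite /height -sum1_card.
rewrite pair_big_dep /=; apply: eq_big => [[b t]|//] /=.
by rewrite !inE.
Qed.

Lemma heightP J q B b : (0 < q)%N -> (@height J q B b <= B)%N /\
  forall t, (t < B)%N -> dominated J (lattice_pt q (fun i => b i)) (t%:R / q%:R) <-> (height J q b <= t)%N.
Proof.
move=> q0; have := @card_initial B (fun t => ~~ `[< dominated J (lattice_pt q (fun i => b i)) (t%:R / q%:R) >]).
case=> [s t st|c1 c2].
  apply: contra => /asboolP ds; apply/asboolP; apply: dominated_upward ds => //.
  by rewrite ler_pM2r ?invr_gt0 ?ltr0n // ler_nat.
split=> // t tB; rewrite leqNgt -/(height _ _ _) -(c2 t tB) negbK; split=> [/asboolP|/asboolP] //.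
Qed.

Lemma minkowski_nat_bound J : exists L : nat, forall x, D J x -> forall i, x 0 i < L%:R.
Proof.
pose M : R := \sum_i \sum_(j in J) @axlen R m A j i.
have s0 (i : 'I_n) : 0 <= \sum_(j in J) @axlen R m A j i.
  by apply: sumr_ge0 => j _; rewrite ltW // axlen_gt0.
have M0 : 0 <= M by apply: sumr_ge0.
exists (Num.truncn M).+1 => x Dx i.
apply: (@le_lt_trans _ _ M); last by case/andP: (truncn_itv M0).
apply: le_trans (minkowski_bound H3 Dx i) _.
by rewrite /M [leRHS](bigD1 (lift ord_max i)) //= lerDl sumr_ge0.
Qed.

Section FixedScale.
Variables (J : {set 'I_n}) (q L : nat).
Hypotheses (q_gt0 : (0 < q)%N) (L_gt0 : (0 < L)%N).
Hypothesis hL : forall (c : 'rV[R]_m) t, (forall i, 0 <= c 0 i) -> 0 <= t ->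
  (exists i, L%:R <= c 0 i) \/ L%:R <= t -> dominated J c t.
Hypothesis hD : forall x, D J x -> forall i, x 0 i < L%:R.
Local Notation B := (L * q)%N.
Local Notation F := {ffun 'I_m -> 'I_B}.

Let qR : 0 < q%:R :> R. Proof. by rewrite ltr0n. Qed.

(** Upper step function: [b / q] is the lowest corner of the cube, so domination there bounds the
    inf-convolution on the whole cube. *)
Let up_c (b : F) : R := (height J q b)%:R / q%:R.
Let up_lo (b : F) (i : 'I_m) : R := (b i)%:R / q%:R.
Let up_hi (b : F) (i : 'I_m) : R := (b i).+1%:R / q%:R.
(** Lower step function: [b / q] is now the highest corner, and the last undominated level is one
    less than the height. An index with a zero coordinate has no full cube below it and gets the
    value 0. *)
Let low_c (b : F) : R := if [forall i, 0 < b i]%N then (height J q b).-1%:R / q%:R else 0.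
Let low_lo (b : F) (i : 'I_m) : R := (b i).-1%:R / q%:R.
Let low_hi (b : F) (i : 'I_m) : R := (b i)%:R / q%:R.

Lemma le_up_step (t : m.-tuple (measurableTypeR R)) : D J (\row_i tnth t i) ->
  g J (\row_i tnth t i) <= step up_c up_lo up_hi t.
Proof.
set x := \row_i _ => Dx; have [x0 _] := minkowski_ge0 H3 Dx.
have tr (i : 'I_m) := truncn_itv (mulr_ge0 (x0 i) (ltW qR)).
have lb (i : 'I_m) : (Num.truncn (x 0 i * q%:R)%R < B)%N.
  rewrite -(ltr_nat R) natrM; case/andP: (tr i) => h _; apply: le_lt_trans h _.
  by rewrite ltr_pM2r //; exact: hD.
pose b : F := [ffun i => Ordinal (lb i)].
have c_ge0 (b' : F) : 0 <= up_c b' * \1_(box (up_lo b') (up_hi b')) t.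
  by rewrite mulr_ge0 // divr_ge0.
rewrite /step (bigD1 b) //=; apply: (@le_trans _ _ (up_c b)); last first.
  rewrite indicE mem_set ?mulr1 ?lerDl ?sumr_ge0 // => i; rewrite /up_lo /up_hi ffunE /=.
  have := tr i; rewrite ler_pdivrMr // ltr_pdivlMr //.
  by rewrite /x mxE.
apply: (conv_dominated H3 Dx (c := lattice_pt q (fun i => b i))).
  by move=> i; rewrite mxE ffunE /= ler_pdivrMr //; case/andP: (tr i).
have [hB ht] := heightP J b q_gt0.
(* If no level of the column is dominated, [up_c b] equals [L], where domination comes from [hL]. *)
have [e|hlt] := eqVneq (height J q b) B.
  apply: hL; first by move=> i; rewrite mxE divr_ge0.
    by rewrite divr_ge0.
  by right; rewrite /up_c e natrM mulfK ?gt_eqF.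
by apply/ht => //; rewrite ltn_neqAle hlt.
Qed.

(** At most one of the cubes with a non-zero value contains [t], its index being determined by the
    integer parts of the scaled coordinates. *)
Lemma low_stepE (t : m.-tuple (measurableTypeR R)) (s : R) : 0 <= s ->
  (forall b : F, (forall i, 0 < b i)%N -> box (low_lo b) (low_hi b) t -> low_c b <= s) ->
  step low_c low_lo low_hi t <= s.
Proof.
move=> s0 hs.
have nz (b : F) : low_c b * \1_(box (low_lo b) (low_hi b)) t != 0 ->
    (forall i, 0 < b i)%N /\ box (low_lo b) (low_hi b) t.
  rewrite indicE /low_c; case: ifPn => [/forallP b0|_]; last by rewrite mul0r eqxx.
  by case: (boolP (t \in _)) => [/set_mem //|]; rewrite mulr0 eqxx.
have bE (b : F) i : (0 < b i)%N -> box (low_lo b) (low_hi b) t ->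
    b i = (Num.truncn (tnth t i * q%:R)).+1 :> nat.
  move=> b0 /(_ i); rewrite /low_lo /low_hi ler_pdivrMr // ltr_pdivlMr // => h.
  by rewrite (@truncn_def _ _ (b i).-1) prednK.
rewrite /step; have [b|all0] := pickP (fun b : F => low_c b * \1_(box (low_lo b) (low_hi b)) t != 0); last first.
  by rewrite big1 // => b _; move/negbFE/eqP: (all0 b).
move=> /nz [b0 bt]; rewrite (bigD1 b) //= big1 ?addr0 => [|b' b'b].
  by rewrite indicE mem_set // mulr1; exact: hs.
apply/eqP; apply: contraNT b'b => /nz [b0' bt']; apply/eqP/ffunP => i; apply/val_inj => /=.
by rewrite (bE b' i (b0' i) bt') (bE b i (b0 i) bt).
Qed.

Lemma low_step_le (t : m.-tuple (measurableTypeR R)) : D J (\row_i tnth t i) ->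
  step low_c low_lo low_hi t <= g J (\row_i tnth t i).
Proof.
set x := \row_i _ => Dx; have [x0 g0] := minkowski_ge0 H3 Dx; apply: low_stepE => // b b0 bt.
rewrite /low_c; case: ifP => // _; have [hB ht] := heightP J b q_gt0.
case: (height J q b) hB ht => [|c] /= hB ht; first by rewrite mul0r.
rewrite leNgt; apply/negP => gc; suff : (c < c)%N by rewrite ltnn.
apply/(ht c hB).
apply: (dominated_conv H3 Dx); last exact: ltW.
by move=> i; rewrite !mxE; have /andP [_ /ltW] := bt i.
Qed.

(** By [dominated_outside] the highest corner of a cube containing such a point is dominated at
    every level, so the height there is 0. *)
Lemma low_step_outside (t : m.-tuple (measurableTypeR R)) : ~ D J (\row_i tnth t i) ->
  step low_c low_lo low_hi t <= 0.
Proof.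
set x := \row_i _ => nD; apply: low_stepE => // b b0 bt.
rewrite /low_c; case: ifP => // _; have [hB ht] := heightP J b q_gt0.
case: (height J q b) hB ht => [|c] /= hB ht; first by rewrite mul0r.
suff : (c < c)%N by rewrite ltnn.
apply/(ht c hB).
apply: (dominated_outside H3 _ nD).
- move=> i; rewrite mxE; have /andP [h _] := bt i; apply: le_trans h.
  by rewrite divr_ge0.
- by move=> i; rewrite !mxE; have /andP [_ /ltW] := bt i.
- by rewrite divr_ge0.
Qed.

(** The error term: one point is lost in each of the [B ^ m] columns, and the columns with a zero
    coordinate, at most [m B ^ (m - 1)] of them, lose at most [B] points each. This is at most
    [n B ^ m] points, to be divided by [q ^ n]. *)
Lemma row_integral_undominated :
  #|@undominated R m A J q B|%:R / q%:R ^+ n - (n * L ^ m)%:R / q%:R <= row_integral (D J) (g J) <=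
  #|@undominated R m A J q B|%:R / q%:R ^+ n.
Proof.
have B0 : (0 < B)%N by rewrite muln_gt0 L_gt0.
have up0 (b : F) : 0 <= up_c b by rewrite divr_ge0.
have low0 (b : F) : 0 <= low_c b by rewrite /low_c; case: ifP => // _; rewrite divr_ge0.
have lel (b : F) i : low_lo b i <= low_hi b i.
  by rewrite ler_pM2r ?invr_gt0 // ler_nat leq_pred.
have leu (b : F) i : up_lo b i <= up_hi b i by rewrite ler_pM2r ?invr_gt0 // ler_nat.
have g0 x : D J x -> 0 <= g J x by move=> /(minkowski_ge0 H3) [].
have gin (t : m.-tuple (measurableTypeR R)) : D J (\row_i tnth t i) ->
  step low_c low_lo low_hi t <= g J (\row_i tnth t i) <= step up_c up_lo up_hi t.
  by move=> Dt; rewrite le_up_step // low_step_le.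
have /andP [lo hi] := row_integral_step g0 low0 up0 lel leu gin low_step_outside.
have volu (b : F) : \prod_i (up_hi b i - up_lo b i) = q%:R ^- m.
  rewrite (eq_bigr (fun=> q%:R^-1)) => [|i _]; first by rewrite prodr_const card_ord exprVn.
  by rewrite /up_hi /up_lo -mulrBl -natrB // subSnn mul1r.
have voll (b : F) : low_c b * \prod_i (low_hi b i - low_lo b i) = low_c b * q%:R ^- m.
  rewrite /low_c; case: ifPn => [/forallP b0|_]; last by rewrite !mul0r.
  congr (_ * _); rewrite (eq_bigr (fun=> q%:R^-1)) => [|i _]; first by rewrite prodr_const card_ord exprVn.
  by rewrite /low_hi /low_lo -mulrBl -natrB ?leq_pred // -subn1 subKn ?b0 // mul1r.
have qn (x : R) : x / q%:R * q%:R ^- m = x / q%:R ^+ n by rewrite exprS invfM mulrA.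
rewrite card_undominated natr_sum; apply/andP; split; last first.
  apply: le_trans hi _; rewrite mulr_suml; apply: ler_sum => b _.
  by rewrite volu /up_c qn.
apply: le_trans lo; under [leRHS]eq_bigr do rewrite voll.
rewrite -mulr_suml lerBlDr.
have cover : (\sum_(b : F) height J q b <=
   \sum_(b : F) (if [forall i, 0 < b i] then (height J q b).-1 else 0) + n * B ^ m)%N.
  have hb (b : F) : (height J q b <=
      (if [forall i, 0 < b i] then (height J q b).-1 else 0) + 1 + \sum_i (b i == 0 :> nat) * B)%N.
    case: ifPn => [_|]; first lia.
    rewrite negb_forall => /existsP [l]; rewrite -eqn0Ngt => bl.
    rewrite (bigD1 l) //= bl mul1n; have [hB _] := heightP J b q_gt0.
    by apply: leq_trans hB _; rewrite addnCA leq_addr.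
  apply: leq_trans (leq_sum _ (fun b _ => hb b)) _.
  rewrite !big_split /= -addnA leq_add2l sum1_card card_ffun !card_ord mulSn leq_add2l.
  rewrite exchange_big /= -[X in (_ <= X * _)%N](card_ord m) -sum_nat_const; apply: leq_sum => i _.
  rewrite -big_distrl /= mulnC; apply: leq_trans (card_zero_coord i B0).
  rewrite leq_mul2l -sum1_card [X in (_ <= X)%N]big_mkcond /=.
  apply/orP; right; apply: leq_sum => b _; rewrite inE.
  by case: (_ == _).
have -> : \sum_(b : F) low_c b = (\sum_(b : F) (if [forall i, 0 < b i] then (height J q b).-1 else 0))%N%:R / q%:R.
  rewrite natr_sum mulr_suml; apply: eq_bigr => b _; rewrite /low_c.
  by case: ifP; rewrite ?mul0r.
rewrite qn.
have -> : (n * L ^ m)%:R / q%:R = (n * B ^ m)%:R / q%:R ^+ n :> R.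
  rewrite expnMn mulnA [in RHS]natrM natrX [in RHS]exprS invfM mulrACA divff ?mulr1 //.
  by rewrite expf_neq0 // gt_eqF.
rewrite -mulrDl ler_pM2r ?invr_gt0 ?exprn_gt0 //.
by rewrite -natr_sum -natrD ler_nat.
Qed.

End FixedScale.

End Sandwich.

Lemma ffact_bounds k N : (N ^ k <= (k + N) ^_ k <= (k + N) ^ k)%N.
Proof.
elim: k => [|k /andP[IH1 IH2]]; first by rewrite ffactn0 !expn0.
rewrite addSn ffactSS !expnS; apply/andP; split; apply: leq_mul => //.
  by rewrite -addSn leq_addl.
by apply: leq_trans IH2 _; case: k {IH1} => // k; rewrite leq_exp2r.
Qed.

(** * Passage to the limit *)

Section Asymptotics.
Variable R : realType.

Lemma expr_1D_le k (x : R) : 0 <= x <= 1 -> (1 + x) ^+ k <= 1 + 3 ^+ k * x.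
Proof.
move=> /andP [x0 x1]; elim: k => [|k IH]; first by rewrite !expr0 mul1r lerDl.
rewrite exprS; apply: (@le_trans _ _ ((1 + x) * (1 + 3 ^+ k * x))).
  by rewrite ler_wpM2l // addr_ge0.
have t1 : 1 <= 3 ^+ k :> R by rewrite exprn_ege1 // ler1n.
rewrite exprS; move: (3 ^+ k) t1 => t t1.
have h1 : 0 <= (t - 1) * x by rewrite mulr_ge0 // subr_ge0.
have h2 : 0 <= t * (x * (1 - x)) by rewrite !mulr_ge0 ?subr_ge0 // (le_trans _ t1).
nra.
Qed.

Lemma expr_1B_ge k (x : R) : 0 <= x <= 1 -> 1 - k%:R * x <= (1 - x) ^+ k.
Proof.
move=> /andP [x0 x1]; elim: k => [|k IH]; first by rewrite expr0 mul0r subr0.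
have k0 : 0 <= k%:R :> R by [].
rewrite exprS -natr1; apply: (@le_trans _ _ ((1 - x) * (1 - k%:R * x))); first nra.
by rewrite ler_wpM2l // subr_ge0.
Qed.

Lemma eq_of_small (x y E : R) q0 :
  (forall q, (q0 < q)%N -> y - E / q%:R <= x <= y + E / q%:R) -> x = y.
Proof.
move=> h; apply/eqP; rewrite -subr_eq0 -normr_le0; apply: contraT; rewrite -ltNge => d0.
pose d := `|x - y|; pose q := (q0 + Num.truncn (`|E| / d)).+1.
have dE : d <= `|E| / q%:R.
  have /andP [h1 h2] : y - E / q%:R <= x <= y + E / q%:R by apply: h; rewrite ltnS leq_addr.
  have EE : E / q%:R <= `|E| / q%:R by rewrite ler_pM2r ?invr_gt0 ?ltr0n // ler_norm.
  by rewrite ler_norml; apply/andP; split; lra.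
have : `|E| / d < q%:R.
  have /andP [_ h1] := truncn_itv (divr_ge0 (normr_ge0 E) (ltW d0)).
  by apply: lt_le_trans h1 _; rewrite ler_nat ltnS leq_addl.
rewrite ltr_pdivrMr // => h1; move: dE; rewrite ler_pdivlMr ?ltr0n //.
by rewrite leNgt mulrC h1.
Qed.

End Asymptotics.

Section Volume.
Variables (R : realType) (K : numFieldType) (m : nat).
Local Notation n := m.+1.
Variable A : 'I_n -> {fset multinom n}.
Hypothesis H3 : forall i j, exists2 mu : nat,
  (0 < mu)%N & mnm_muln (mnm1 i) mu \in A j.

Local Notation T := (coef_index A).
Local Notation Q j := (newton_polytope R (A j)).
Local Notation P := (fun j => [set proj_last x | x in axis_simplex (Q j)] : set 'rV[R]_m).
Local Notation rho := (fun j => lower_envelope (Q j)).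

(** Up to lower order terms, both the colength and the number of undominated points are a constant
    times [q ^ n]; the shifts by [C], by [#|T|] and by [n] do not affect the leading coefficient. *)
Lemma row_integral_colength J C D :
  (forall N, (colength K A J N.+1 <= 'C(n + N, n) * D <= colength K A J (N + C))%N) ->
  n`!%:R * row_integral (minkowski_sum P J) (inf_convolution P rho J) = D%:R.
Proof.
move=> hD; set I := row_integral _ _.
have [L1 h1] := dominated_bound R H3 J.
have [L2 h2] := minkowski_nat_bound R H3 J.
have [L3 h3] := leq_undominated R H3 K J.
pose L := (L1 + L2 + L3).+1.
have hL (c : 'rV[R]_m) t : (forall i, 0 <= c 0 i) -> 0 <= t ->
    (exists i, L%:R <= c 0 i) \/ L%:R <= t -> dominated A J c t.
  move=> c0 t0 h; have l1 : L1%:R <= L%:R :> R by rewrite ler_nat /L; lia.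
  apply: h1 => //; case: h => [[i hi]|ht]; [left; exists i|right]; exact: le_trans l1 _.
have hM x : minkowski_sum P J x -> forall i, x 0 i < L%:R.
  by move=> Dx i; apply: lt_le_trans (h2 x Dx i) _; rewrite ler_nat /L; lia.
(* [s] gathers the shifts due to the joint reductions and to the rounding of weights; [E] is the
   boundary error of the Riemann sums. *)
pose s := (#|{: T}| + C)%N; pose E := (n * L ^ m)%N.
have bounds q : (s + n < q)%N ->
    D%:R * ((q - s)%:R / q%:R) ^+ n - n`!%:R * (E%:R / q%:R) <= n`!%:R * I <= D%:R * ((n + q)%:R / q%:R) ^+ n.
  move=> sq; have q0 : (0 < q)%N by lia.
  have qR : 0 < q%:R ^+ n :> R by rewrite exprn_gt0 // ltr0n.
  have f0 : 0 <= n`!%:R :> R by [].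
  have /andP [lo hi] := row_integral_undominated H3 q0 (isT : (0 < L)%N) hL hM.
  rewrite -/I -/E in lo hi.
  apply/andP; split.
    apply: le_trans (ler_wpM2l f0 lo); rewrite mulrBr lerD2r.
    rewrite expr_div_n !mulrA ler_pM2r ?invr_gt0 // -!natrX -!natrM ler_nat.
    have l3 : (L3 <= L)%N by rewrite /L; lia.
    have := h3 L l3 q q0; have /andP [_] := hD (q - s)%N.
    have -> : (q - s + C = q - #|{: T}|)%N by rewrite /s; lia.
    move=> k1 k2; have k3 := leq_trans k1 k2.
    apply: (@leq_trans (n`! * ('C(n + (q - s), n) * D))%N); last by rewrite leq_mul2l k3 orbT.
    rewrite mulnA [(n`! * _)%N]mulnC bin_ffact mulnC leq_mul2r.
    by case/andP: (ffact_bounds n (q - s)) => ->; rewrite orbT.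
  apply: le_trans (ler_wpM2l f0 hi) _.
  rewrite expr_div_n !mulrA ler_pM2r ?invr_gt0 // -!natrX -!natrM ler_nat.
  have k1 := undominated_le R H3 K J (L * q) q0.
  have /andP [k2 _] := hD q.-1; rewrite prednK // in k2.
  apply: (@leq_trans (n`! * ('C(n + q.-1, n) * D))%N).
    by rewrite leq_mul2l (leq_trans k1 k2) orbT.
  rewrite mulnA [(n`! * _)%N]mulnC bin_ffact mulnC leq_mul2l.
  case/andP: (ffact_bounds n q.-1) => _ k3; apply/orP; right; apply: leq_trans k3 _.
  by rewrite leq_exp2r // leq_add2l leq_pred.
pose E' : R := D%:R * (n%:R * s%:R) + n`!%:R * E%:R + D%:R * (3 ^+ n * n%:R).
apply: (@eq_of_small R _ _ E' (s + n)) => q sq.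
have /andP [b1 b2] := bounds q sq.
have q0 : 0 < q%:R :> R by rewrite ltr0n; lia.
have D0 : 0 <= D%:R :> R by [].
have sx : 0 <= (s%:R / q%:R : R) <= 1.
  by rewrite divr_ge0 //= ler_pdivrMr // mul1r ler_nat; lia.
have nx : 0 <= (n%:R / q%:R : R) <= 1.
  by rewrite divr_ge0 //= ler_pdivrMr // mul1r ler_nat; lia.
have e1 : (q - s)%:R / q%:R = 1 - s%:R / q%:R :> R.
  by rewrite natrB ?mulrBl ?divff ?gt_eqF //; lia.
have e2 : (n + q)%:R / q%:R = 1 + n%:R / q%:R :> R.
  by rewrite natrD mulrDl divff ?gt_eqF // addrC.
rewrite e1 in b1; rewrite e2 in b2.
have l1 := ler_wpM2l D0 (expr_1B_ge n sx); have l2 := ler_wpM2l D0 (expr_1D_le n nx).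
have p1 : 0 <= D%:R * (n%:R * (s%:R / q%:R)) :> R by rewrite !mulr_ge0 ?invr_ge0 // ltW.
have p2 : 0 <= n`!%:R * (E%:R / q%:R) :> R by rewrite !mulr_ge0 ?invr_ge0 // ltW.
have p3 : 0 <= D%:R * (3 ^+ n * (n%:R / q%:R)) :> R by rewrite !mulr_ge0 ?invr_ge0 // ltW.
have -> : E' / q%:R = D%:R * (n%:R * (s%:R / q%:R)) + n`!%:R * (E%:R / q%:R) + D%:R * (3 ^+ n * (n%:R / q%:R)).
  by rewrite /E' !mulrDl !mulrA.
rewrite mulrBr mulr1 in l1; rewrite mulrDr mulr1 in l2.
move: b1 b2 l1 l2 p1 p2 p3; set u1 := D%:R * (1 - _) ^+ _; set u2 := D%:R * (1 + _) ^+ _.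
by move=> *; apply/andP; split; lra.
Qed.

End Volume.

(** * The local ring at the origin *)

Section LocalAlgebra.
Variables (C : numClosedFieldType) (n' : nat).
Local Notation n := n'.+1.
Local Notation S := (mpoly n C).
Local Notation zero := (fun=> 0 : C).

Lemma meval_zero (p : S) : meval zero p = mcoeff (@mnm0 n) p.
Proof.
rewrite mevalE [in RHS](mpolyE p) raddf_sum /=; apply: eq_bigr => b _.
rewrite mcoeffZ mcoeffX; congr (_ * _); have [->|b0] := eqVneq b (@mnm0 n).
  by rewrite big1 // => i _; rewrite mnm0E.
have /existsP [i bi] : [exists i, b i != 0%N].
  apply: contraNT b0; rewrite negb_exists => /forallP h; apply/eqP/mnmP => i.
  by rewrite mnm0E; move/negPn/eqP: (h i).
by rewrite (bigD1 i) //= expr0n (negbTE bi) mul0r.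
Qed.

Lemma unit0E (p : S) : unit0 p = (meval zero p != 0).
Proof. by rewrite meval_zero. Qed.

(** For coordinates smaller than [e <= 1], every non-constant monomial is at most [e]. Hence [q]
    varies by at most [e * s], which is less than its absolute value at 0. *)
Lemma meval_neq0_near (q : S) : unit0 q ->
  exists2 e : C, 0 < e & forall w, (forall i, `|w i| < e) -> meval w q != 0.
Proof.
rewrite unit0E => q0; pose s := \sum_(b <- msupp q) `|mcoeff b q|.
pose c := `|meval zero q|; have c0 : 0 < c by rewrite normr_gt0.
have s0 : 0 <= s by apply: sumr_ge0.
have d0 : 0 < c + s + 1 by apply: ltr_wpDr => //; apply: ltr_wpDr.
pose e := c / (c + s + 1); have e0 : 0 < e by rewrite divr_gt0.
have e1 : e <= 1 by rewrite ler_pdivrMr // mul1r -addrA lerDl addr_ge0.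
exists e => // w we; apply/negP => /eqP qw.
suff : c <= e * s.
  have lt : e * s < c.
    rewrite /e mulrAC ltr_pdivrMr // !mulrDr mulr1 addrAC ltrDr.
    by rewrite addr_gt0 // mulr_gt0.
  by move=> /(lt_le_trans lt); rewrite ltxx.
have -> : c = `|meval w q - meval zero q| by rewrite qw sub0r normrN.
rewrite !mevalE -sumrB /s mulr_sumr; apply: le_trans (ler_norm_sum _ _ _) _.
apply: ler_sum => b _; rewrite -mulrBr normrM mulrC ler_wpM2r //.
have [->|b0] := eqVneq b (@mnm0 n).
  rewrite !big1 ?subrr ?normr0 ?ltW // => i _; by rewrite mnm0E.
have /existsP [l bl] : [exists i, b i != 0%N].
  apply: contraNT b0; rewrite negb_exists => /forallP h; apply/eqP/mnmP => i.
  by rewrite mnm0E; move/negPn/eqP: (h i).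
rewrite [X in _ - X](bigD1 l) //= expr0n (negbTE bl) mul0r subr0 normr_prod (bigD1 l) //=.
rewrite -[leRHS]mulr1; apply: ler_pM; rewrite ?prodr_ge0 //.
  rewrite normrX -(prednK (_ : 0 < b l)%N) ?lt0n // exprS -[leRHS]mulr1.
  apply: ler_pM; rewrite ?exprn_ge0 //; first exact: ltW.
  by rewrite exprn_ile1 // (le_trans _ e1) // ltW.
apply: prodr_ile1 => i _; rewrite normr_ge0 normrX exprn_ile1 //.
by rewrite (le_trans _ e1) // ltW.
Qed.

Lemma sys_explicit (f : 'I_n -> S) u : sys f u ->
  exists q a, unit0 q /\ q * u = \sum_i a i * f i.
Proof.
move=> h; apply: (@sidl_explicit _ _ 'I_n xpredT f u); move: h; apply: sidl_sub => _ [l _ <-].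
by apply: sidl_gen; exists l.
Qed.

(** A multiple of each [x_i ^ M] by some [q i] in [unit0] is in the ideal. Near the origin no [q i]
    vanishes, so a common zero has all coordinates 0. *)
Lemma isolated_zero_cof (f : 'I_n -> S) : (forall j, mcoeff (@mnm0 n) (f j) = 0) ->
  cof (sys f) -> isolated_zero f zero.
Proof.
move=> f0 [M hM]; split; first by move=> j; rewrite meval_zero.
have ex i : exists q a, unit0 q /\ q * mpolyX C (mnm_muln (mnm1 i) M) = \sum_j a j * f j.
  by apply: sys_explicit; apply: hM; rewrite mdegMn mdeg1 mul1n.
have /choice [q hq] := ex.
have uq : unit0 (\prod_i q i).
  by apply: (big_ind (fun q : S => is_true (unit0 q))) => [|u v|i _]; [exact: unit0_1|exact: unit0M|case: (hq i) => a []].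
have [e e0 he] := meval_neq0_near uq.
exists e => // w we wz; apply/funext => i; apply/eqP.
have [a [_ ha]] := hq i; have := congr1 (meval w) ha.
rewrite mevalM -mpolyXn rmorphXn /= mevalXU raddf_sum /= big1 => [|j _]; last by rewrite mevalM wz mulr0.
move/eqP; rewrite mulf_eq0 expf_eq0 => /orP [qi|/andP [_ //]].
have : meval w (\prod_i q i) = 0.
  by rewrite (bigD1 i) //= mevalM (eqP qi) mul0r.
by move/eqP; rewrite (negbTE (he w _)) // => l; have := we l; rewrite subr0.
Qed.

Section Multiplicity.
Variable f : 'I_n -> S.
Hypothesis cf : cof (sys f).
Local Notation LI := (local_ideal f zero).
Local Notation LR := (@local_ring C n zero).

Lemma tofrac_neq0 (q : S) : unit0 q -> tofrac q != 0.
Proof. by rewrite tofrac_eq0; apply: contraNneq => ->; rewrite mcoeff0. Qed.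

Lemma local_ringX (p : S) : LR (tofrac p).
Proof. by exists p, 1; split; [rewrite meval1 oner_neq0|rewrite tofrac1 divr1]. Qed.

Lemma local_ringM u v : LR u -> LR v -> LR (u * v).
Proof.
move=> [p [q [q0 ->]]] [p' [q' [q'0 ->]]]; exists (p * p'), (q * q').
by rewrite mevalM mulf_neq0 // !tofracM invfM mulrACA.
Qed.

Lemma local_idealM u v : LR u -> LI v -> LI (u * v).
Proof.
move=> hu [g hg ->]; exists (fun j => u * g j) => [j|]; first exact: local_ringM.
by rewrite mulr_sumr; apply: eq_bigr => j _; rewrite mulrA.
Qed.

Lemma local_ringD u v : LR u -> LR v -> LR (u + v).
Proof.
move=> [p [q [q0 ->]]] [p' [q' [q'0 ->]]]; exists (p * q' + p' * q), (q * q').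
rewrite mevalM mulf_neq0 //; split=> //; rewrite tofracD !tofracM addf_div // tofrac_neq0 // unit0E //.
Qed.

Lemma local_idealD u v : LI u -> LI v -> LI (u + v).
Proof.
move=> [g hg ->] [h hh ->]; exists (fun j => g j + h j) => [j|]; first exact: local_ringD.
by rewrite -big_split; apply: eq_bigr => j _; rewrite mulrDl.
Qed.

(** The ideal [sys f] is the contraction of the local one: coefficients are brought to a common
    denominator in one direction and divided by [q] in the other. *)
Lemma local_ideal_poly (p : S) : LI (tofrac p) <-> sys f p.
Proof.
split=> [[g hg hp]|/sys_explicit [q [a [q0 e]]]].
  have /choice [pq hpq] : forall j, exists pq : S * S, unit0 pq.2 /\ g j = tofrac pq.1 / tofrac pq.2.
    by move=> j; have [p' [q' [q0 ->]]] := hg j; exists (p', q'); rewrite unit0E.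
  pose q := \prod_j (pq j).2.
  have uq : unit0 q.
    by apply: (big_ind (fun q : S => is_true (unit0 q))) => [|u v|i _]; [exact: unit0_1|exact: unit0M|case: (hpq i)].
  apply: (sidl_unit uq).
  have -> : q * p = \sum_j (pq j).1 * (\prod_(k | k != j) (pq k).2) * f j.
    apply/eqP; rewrite -tofrac_eq tofracM hp raddf_sum /= mulr_sumr; apply/eqP.
    apply: eq_bigr => j _; have [uj ->] := hpq j.
    rewrite mulrA; rewrite !tofracM; congr (_ * _).
    rewrite /q (bigD1 j) //= tofracM.
    by rewrite mulrC mulrA divfK ?tofrac_neq0.
  apply: (@ideal_sum _ _ (sys f)) => [|j _]; first exact: sidl_ideal.
  by apply: sidlM; apply: sidl_gen; exists j.
exists (fun j => tofrac (a j) / tofrac q) => [j|]; first by exists (a j), q; rewrite -unit0E.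
apply: (mulfI (tofrac_neq0 q0)); rewrite -tofracM e raddf_sum /= mulr_sumr.
apply: eq_bigr => j _; rewrite tofracM mulrA; congr (_ * _).
by rewrite mulrC divfK // tofrac_neq0.
Qed.

(** Denominators are invertible modulo the cofinite ideal [sys f], so fractions bring no new
    classes. *)
Lemma local_representative u : LR u -> exists p : S, LI (u - tofrac p).
Proof.
move=> [p [q [q0 ->]]].
have hI : ideal (sys f) := sidl_ideal _.
have [_ /(_ q 1)] := satid_cofactor q hI cf.
rewrite mulr1 /= => -[||s hs]; first by rewrite unit0E.
  by exists 1; rewrite mulr1 subrr; case: hI.
exists (p * s).
have -> : tofrac p / tofrac q - tofrac (p * s) = tofrac p / tofrac q * tofrac (1 - q * s).
  have fid (F : fieldType) (x y z : F) : y != 0 -> x / y - x * z = x / y * (1 - y * z).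
    by move=> y0; rewrite mulrBr mulr1 mulrA divfK.
  by rewrite rmorphB !rmorphM rmorph1 fid // tofrac_neq0 // unit0E.
by apply: local_idealM; [exists p, q|apply/local_ideal_poly].
Qed.

Lemma has_mult_sys : has_mult f zero (mult f).
Proof.
have [b [sb ib]] := multP cf.
exists (fun i => tofrac (b i)) => [i|u hu]; first exact: local_ringX.
have comb (c : 'rV[C]_(mult f)) : \sum_i tofrac (mpolyC n (c 0 i)) * tofrac (b i) =
    tofrac (\sum_i c 0 i *: b i).
  by rewrite raddf_sum; apply: eq_bigr => i _; rewrite /= -tofracM mul_mpolyC.
have [p hp] := local_representative hu; have [c hc] := sb p.
exists (\row_i c i); split=> [|c' hc'].
  rewrite comb -(subrK (tofrac p) u) -addrA; apply: local_idealD => //.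
  rewrite -tofracB; apply/local_ideal_poly.
  by under eq_bigr => i _ do rewrite mxE.
apply/rowP => i; rewrite mxE; apply/eqP; rewrite -subr_eq0; apply/eqP.
apply: (ib (fun i => c i - c' 0 i)) => //.
have h : LI (tofrac (p - \sum_i c' 0 i *: b i)).
  rewrite tofracB -comb -(subrK u (tofrac p)) -addrA; apply: local_idealD => //.
  rewrite -opprB -mulN1r -tofrac1 -tofracN; apply: local_idealM => //; exact: local_ringX.
move/local_ideal_poly: h => h.
have -> : \sum_i (c i - c' 0 i) *: b i = p - \sum_i c' 0 i *: b i - (p - \sum_i c i *: b i).
  rewrite opprB addrC addrA subrK -sumrB; apply: eq_bigr => l _; exact: scalerBl.
exact: idealB (sidl_ideal _) h hc.
Qed.

End Multiplicity.

End LocalAlgebra.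

(** Needed to discard the empty [J], which occurs in the inclusion-exclusion formula but not in the
    mixed integral. *)
Lemma colength_set0 (K : numFieldType) n' (A : 'I_n'.+1 -> {fset multinom n'.+1}) N :
  colength K A finset.set0 N = 0%N.
Proof.
apply: codimnE; first exact: monideal_ideal.
apply: codim_full => u b _; apply/monP; exists (fun=> 0%N); split=> [j|i].
  by rewrite count_rep inE muln0.
by rewrite /dsum big1.
Qed.

Lemma mixed_integralE (R : realType) m (P : 'I_m.+1 -> set 'rV[R]_m) rho :
  mixed_integral P rho = \sum_(J : {set 'I_m.+1} | (0 < #|J|)%N)
    (-1) ^+ (m.+1 - #|J|) * row_integral (minkowski_sum P J) (inf_convolution P rho J).
Proof.
rewrite /mixed_integral; under eq_bigr do rewrite mulr_sumr.
rewrite big_nat (exchange_big_dep (fun J : {set 'I_m.+1} => (0 < #|J|)%N)) /=; last first.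
  by move=> k J /andP [k0 _] /eqP ->.
apply: eq_bigr => J J0.
rewrite (eq_bigl (fun k => (1 <= k < m.+2)%N && (k == #|J|))) => [|k]; last by rewrite eq_sym.
rewrite -big_nat_cond big_nat1_eq J0 ltnS.
by rewrite -[X in (_ <= X)%N](card_ord m.+1) max_card.
Qed.

Theorem theorem10 (R : realType) (m : nat)
    (A : 'I_m.+1 -> {fset multinom m.+1})
    (H1 : forall j, @mnm0 m.+1 \notin A j)
    (H3 : forall i j, exists2 mu : nat,
       (0 < mu)%N & mnm_muln (mnm1 i) mu \in A j) :
  let Q j : set 'rV[R]_m.+1 := newton_polytope R (A j) in
  let P j : set 'rV[R]_m := [set proj_last x | x in axis_simplex (Q j)] in
  let rho j : 'rV[R]_m -> R := lower_envelope (Q j) in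
  generically A (fun f : 'I_m.+1 -> mpoly m.+1 R[i] =>
    isolated_zero f (fun=> 0) /\
    exists2 d : nat, has_mult f (fun=> 0) d & d%:R = mixed_integral P rho).
Proof.
move=> Q P rho; have [p [[c0 hc0] hp]] := @generic_mult m R[i] A H3.
(* The factor [mons] removes the coefficient vectors with a zero coordinate from the open set. *)
pose T := coef_index A; pose mons : mpoly #|T| R[i] := \prod_i mpolyX R[i] (mnm1 i).
have mevalm (c : T -> R[i]) : (meval (c \o enum_val) mons != 0) = [forall t, c t != 0].
  rewrite rmorph_prod /=; under eq_bigr do rewrite mevalXU.
  apply/prodf_neq0/forallP => h t; last by move=> _; exact: h (enum_val t).
  by have := h (enum_rank t) isT; rewrite /= enum_rankK.
exists [set c : T -> R[i] | exists2 q, [set p * mons] q & meval (c \o enum_val) q != 0]; split.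
- by exists [set p * mons].
- have lin (x y : T -> R[i]) s (i : 'I_#|T|) :
    (line x y s \o enum_val) i = (x \o enum_val) i + s * ((y \o enum_val) i - (x \o enum_val) i) by [].
  have g1 := generic_meval lin (ex_intro _ c0 hc0).
  have g2 : generic [set c : T -> R[i] | meval (c \o enum_val) mons != 0].
    apply: (generic_meval lin); exists (fun=> 1).
    rewrite -[X in is_true X]/(meval ((fun=> 1) \o enum_val) mons != 0) mevalm.
    by apply/forallP => t; exact: oner_neq0.
  have [c [/= h1 h2]] := generic_ex (generic_setI g1 g2).
  exists c, (p * mons); first by [].
  by rewrite mevalM mulf_eq0 negb_or; apply/andP; split; [exact: h1|exact: h2].
move=> c [_ -> ]; rewrite mevalM mulf_eq0 negb_or mevalm => /andP [pc /forallP c0'].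
split=> //; have [cofc [C [D [bounds alt]]]] := hp c pc.
have f0 j : mcoeff (@mnm0 m.+1) (spoly c j) = 0.
  rewrite raddf_sum big1 // => a _; rewrite /= mcoeffZ mcoeffX.
  case: eqP => [e|_]; last by rewrite mulr0.
  by case/negP: (H1 j); rewrite -e; exact: valP.
split; first exact: isolated_zero_cof.
exists (mult (spoly c)); first exact: has_mult_sys.
have vol J := row_integral_colength R H3 (bounds J).
have fact0 : (m.+1)`!%:R != 0 :> R by rewrite pnatr_eq0 -lt0n fact_gt0.
apply: (mulfI fact0); rewrite mixed_integralE mulr_sumr.
have := congr1 (fun z : int => z%:~R : R) alt.
rewrite /= PoszM intrM => <-; rewrite raddf_sum /= (bigID (fun J : {set _} => 0 < #|J|)%N) /=.
(* The term of the empty [J]: the bounds at [N = 0] force [D set0] to be 0. *)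
rewrite [X in _ + X]big1 ?addr0 => [|J]; last first.
  rewrite -leqNgt leqn0 cards_eq0 => /eqP ->.
  have /andP [_] := bounds finset.set0 0%N; rewrite colength_set0 leqn0 muln_eq0.
  by rewrite addn0 binn /= => /eqP ->; rewrite mulr0.
apply: eq_bigr => J _; rewrite mulrCA vol rmorphM rmorphXn /= rmorphN1.
by [].
Qed.
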